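(* $R_{Ba}(z,\xi)$ is a unitary dynamical $R$-matrix and $K_{Ba}(z,\xi)$ is a unitary right dynamical $K$-matrix associated to $R_{Ba}(z,\xi)$.
   Context: Let $0<q<1$, $q^x=e^{x\log q}$, and $\kappa,\zeta,\zeta',\upsilon,\upsilon'\in\mathbb{C}$. Let $V=\mathbb{C}^2$ with ordered basis $(v_+,v_-)$ and $hv_\pm=\pm v_\pm$; operators on $V$ and $V\otimes V$ are written as matrices with respect to $(v_+,v_-)$ and $(v_+\otimes v_+,v_+\otimes v_-,v_-\otimes v_+,v_-\otimes v_-)$. Subscripts denote tensor legs on which operators act; $R_{21}=PRP$ with $P$ the flip. $h_i$ is $h$ acting on the $i$th tensor leg. For an operator $S(\xi)$ on $V^{\otimes n}$ depending meromorphically on $\xi$ and $\alpha\in\mathbb{C}$, $S(\xi+\alpha h_i)v:=S(\xi+\alpha\mu_i)v$ if $h_iv=\mu_iv$. A family $R(z,\xi)$ of operators on $V\otimes V$, meromorphic in $(z,\xi)\in\mathbb{C}^2$, is a dynamical $R$-matrix if $$R_{12}(z_1-z_2,\xi-2\kappa h_3)R_{13}(z_1-z_3,\xi)R_{23}(z_2-z_3,\xi-2\kappa h_1)=R_{23}(z_2-z_3,\xi)R_{13}(z_1-z_3,\xi-2\kappa h_2)R_{12}(z_1-z_2,\xi);$$ it is unitary if $R_{21}(z,\xi)R(-z,\xi)=\mathrm{Id}$. A meromorphic family $K(z,\xi)$ of operators on $V$ is a right dynamical $K$-matrix with respect to (associated to) $R$ if $$R_{21}(z_1-z_2,2\xi)K_1(z_1,\xi-\kappa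 h_2)R_{12}(z_1+z_2,2\xi)K_2(z_2,\xi-\kappa h_1)=K_2(z_2,\xi-\kappa h_1)R_{21}(z_1+z_2,2\xi)K_1(z_1,\xi-\kappa h_2)R_{12}(z_1-z_2,2\xi);$$ it is unitary if $K(z,\xi)K(-z,\xi)=\mathrm{Id}_V$. Let $\theta(x;q)=\prod_{j\ge0}(1-q^jx)(1-q^{j+1}/x)$, $\theta(x_1,\dots,x_r;q)=\prod_i\theta(x_i;q)$. Baxter's dynamical $R$-matrix is $$R_{Ba}(z,\xi)=\begin{pmatrix}1&0&0&0\\0&A_{Ba}(z,\xi)&B_{Ba}(z,\xi)&0\\0&B_{Ba}(z,-\xi)&A_{Ba}(z,-\xi)&0\\0&0&0&1\end{pmatrix},\quad A_{Ba}(z,\xi)=\frac{\theta(q^{-z},q^{2\kappa+\xi};q)}{\theta(q^{2\kappa-z},q^\xi;q)},\quad B_{Ba}(z,\xi)=\frac{\theta(q^{-z-\xi},q^{2\kappa};q)}{\theta(q^{2\kappa-z},q^{-\xi};q)}.$$ Let $a=q^{\zeta+\upsilon}$, $b=-q^{\zeta-\upsilon}$, $c=q^{\frac12+\zeta'+\upsilon'}$, $d=-q^{\frac12+\zeta'-\upsilon'}$, $\widetilde a=q^{\zeta+\zeta'}$, $\widetilde b=-q^{\zeta-\zeta'}$, $\widetilde c=q^{\frac12+\upsilon+\upsilon'}$, $\widetilde d=-q^{\frac12+\upsilon-\upsilon'}$, and $$\mathcal{C}(z,\xi)=\frac{\theta(\widetilde aq^\xi,\widetilde bq^\xi,\widetilde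 cq^\xi,dq^{\xi-z}/\widetilde a;q)}{\theta(q^{2\xi},dq^{-z};q)}q^{-(\zeta+\upsilon-z)(\zeta+\zeta'-\xi)},\quad\widetilde{\mathcal{C}}(z,\xi)=\frac{\theta(aq^\xi,bq^\xi,cq^\xi,\widetilde dq^{\xi-z}/a;q)}{\theta(q^{2\xi},\widetilde dq^{-z};q)}q^{-(\zeta+\zeta'-z)(\zeta+\upsilon-\xi)}.$$ Then $$K_{Ba}(z,\xi)=\begin{pmatrix}\alpha_{Ba}(z,\xi)&\beta_{Ba}(z,\xi)\\\beta_{Ba}(z,-\xi)&\alpha_{Ba}(z,-\xi)\end{pmatrix},\quad\alpha_{Ba}(z,\xi)=\frac{\mathcal{C}(z,\xi)-\widetilde{\mathcal{C}}(\xi,z)}{\widetilde{\mathcal{C}}(\xi,-z)}q^{2z\xi},\quad\beta_{Ba}(z,\xi)=\frac{\mathcal{C}(z,\xi)}{\widetilde{\mathcal{C}}(-\xi,-z)}.$$ *)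

(* Defs.v *)
From HB Require Import structures.
From mathcomp Require Import all_boot all_order all_algebra.
From mathcomp Require Import complex mxtens.
From mathcomp Require Import all_classical all_reals all_analysis.

Set Implicit Arguments.
Unset Strict Implicit.
Unset Printing Implicit Defensive.

Import Order.TTheory GRing.Theory Num.Theory.
Import numFieldNormedType.Exports.

Local Open Scope classical_set_scope.
Local Open Scope ring_scope.
Local Open Scope complex_scope.

(* R[i] is normed over itself, so that `differentiable` below is complex
   (C-linear Frechet) differentiability. *)
HB.instance Definition _ (R : rcfType) := PseudoPointedMetric.copy R[i] R[i]^o.
HB.instance Definition _ (R : rcfType) := GRing.ComAlgebra.copy R[i] R[i]^o.
HB.instance Definition _ (R : rcfType) := Vector.copy R[i] R[i]^o.
HB.instance Definition _ (R : rcfType) := NormedModule.copy R[i] R[i]^o.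

Section Meromorphic.
Context {R : realType}.
Local Notation C := R[i].

(* A meromorphic function is represented by a total function that is locally a
   quotient of holomorphic functions; its values where the denominator vanishes
   (a nowhere dense set) carry no information. *)
Definition meromorphic {V : normedModType C} (f : V -> C) : Prop :=
  forall p : V, exists (U : set V) (g h : V -> C),
    [/\ open_nbhs p U,
        forall x, U x -> differentiable g x /\ differentiable h x,
        U `<=` closure [set x | h x != 0] &
        forall x, U x -> h x != 0 -> f x = g x / h x].

(* Equality of meromorphic functions, insensitive to the values at poles. *)
Definition mero_eq {V : topologicalType} {T : Type} (f g : V -> T) : Prop :=
  exists D : set V, [/\ open D, dense D & forall x, D x -> f x = g x].

Definition meromorphic_family {n : nat} (S : C -> C -> 'M[C]_n) : Prop :=
  forall i j, meromorphic (fun p : C * C => S p.1 p.2 i j).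

End Meromorphic.

(* Operators are matrices acting on column vectors.  The index 0 : 'I_2 stands
   for v_+ and 1 : 'I_2 for v_-; V (x) V is indexed by 'I_(2 * 2) and
   V (x) V (x) V by 'I_(2 * 2 * 2), in lexicographic order (mxtens_index).  The
   bracketings 2 * (2 * 2) and 2 * 2 * 2 are convertible. *)
Section TensorLegs.
Context {R : realType}.
Local Notation C := R[i].

Definition h_op : 'M[C]_2 := \matrix_(i, j) ((-1) ^+ i *+ (i == j)).

Definition flip : 'M[C]_(2 * 2) :=
  \matrix_(i, j)
    (mxtens_unindex i == swap_pair (mxtens_unindex j) :> 'I_2 * 'I_2)%:R.

Definition leg1 (A : 'M[C]_2) : 'M[C]_(2 * 2) := A *t 1%:M.
Definition leg2 (A : 'M[C]_2) : 'M[C]_(2 * 2) := (1%:M : 'M[C]_2) *t A.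
Definition leg21 (A : 'M[C]_(2 * 2)) : 'M[C]_(2 * 2) := flip *m A *m flip.

Definition leg12_3 (A : 'M[C]_(2 * 2)) : 'M[C]_(2 * 2 * 2) := A *t 1%:M.
Definition leg23_3 (A : 'M[C]_(2 * 2)) : 'M[C]_(2 * 2 * 2) :=
  (1%:M : 'M[C]_2) *t A.
Definition leg13_3 (A : 'M[C]_(2 * 2)) : 'M[C]_(2 * 2 * 2) :=
  leg23_3 flip *m leg12_3 A *m leg23_3 flip.

Definition h1_3 : 'M[C]_(2 * 2 * 2) := leg12_3 (leg1 h_op).
Definition h2_3 : 'M[C]_(2 * 2 * 2) := leg12_3 (leg2 h_op).
Definition h3_3 : 'M[C]_(2 * 2 * 2) := leg23_3 (leg2 h_op).

(* S(xi + alpha h) for a diagonal operator h: its j-th column is the image of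
   the j-th basis vector, which has h-eigenvalue h j j. *)
Definition dyn_shift {n : nat} (S : C -> 'M[C]_n) (xi alpha : C) (h : 'M[C]_n) :
    'M[C]_n :=
  \matrix_(i, j) S (xi + alpha * h j j) i j.

End TensorLegs.

Section DynamicalMatrices.
Context {R : realType}.
Local Notation C := R[i].
Implicit Types (Rm : C -> C -> 'M[C]_(2 * 2)) (K : C -> C -> 'M[C]_2).

Definition dynamical_YBE (kappa : C) Rm : Prop :=
  mero_eq (V := (C * C * C * C)%type)
    (fun '(z1, z2, z3, xi) =>
       dyn_shift (fun x => leg12_3 (Rm (z1 - z2) x)) xi (- (2 * kappa)) h3_3
       *m leg13_3 (Rm (z1 - z3) xi)
       *m dyn_shift (fun x => leg23_3 (Rm (z2 - z3) x)) xi (- (2 * kappa)) h1_3)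
    (fun '(z1, z2, z3, xi) =>
       leg23_3 (Rm (z2 - z3) xi)
       *m dyn_shift (fun x => leg13_3 (Rm (z1 - z3) x)) xi (- (2 * kappa)) h2_3
       *m leg12_3 (Rm (z1 - z2) xi)).

Definition dynamical_R_matrix (kappa : C) Rm : Prop :=
  meromorphic_family Rm /\ dynamical_YBE kappa Rm.

Definition unitary_R Rm : Prop :=
  mero_eq (V := (C * C)%type)
    (fun '(z, xi) => leg21 (Rm z xi) *m Rm (- z) xi)
    (fun=> 1%:M).

Definition right_dynamical_RE (kappa : C) Rm K : Prop :=
  mero_eq (V := (C * C * C)%type)
    (fun '(z1, z2, xi) =>
       leg21 (Rm (z1 - z2) (2 * xi))
       *m dyn_shift (fun x => leg1 (K z1 x)) xi (- kappa) (leg2 h_op)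
       *m Rm (z1 + z2) (2 * xi)
       *m dyn_shift (fun x => leg2 (K z2 x)) xi (- kappa) (leg1 h_op))
    (fun '(z1, z2, xi) =>
       dyn_shift (fun x => leg2 (K z2 x)) xi (- kappa) (leg1 h_op)
       *m leg21 (Rm (z1 + z2) (2 * xi))
       *m dyn_shift (fun x => leg1 (K z1 x)) xi (- kappa) (leg2 h_op)
       *m Rm (z1 - z2) (2 * xi)).

Definition right_dynamical_K_matrix (kappa : C) Rm K : Prop :=
  meromorphic_family K /\ right_dynamical_RE kappa Rm K.

Definition unitary_K K : Prop :=
  mero_eq (V := (C * C)%type)
    (fun '(z, xi) => K z xi *m K (- z) xi)
    (fun=> 1%:M).

End DynamicalMatrices.

Section Baxter.
Context {R : realType}.
Local Notation C := R[i].

Definition cexp (z : C) : C :=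
  let: x +i* y := z in (expR x * cos y) +i* (expR x * sin y).

Definition qpow (q : R) (x : C) : C := cexp (x * (ln q)%:C).

Definition theta1 (q : R) (x : C) : C :=
  lim ((fun n : nat => \prod_(0 <= j < n)
    ((1 - (q ^+ j)%:C * x) * (1 - (q ^+ j.+1)%:C / x))) @ \oo).

Definition theta (q : R) (xs : seq C) : C := \prod_(x <- xs) theta1 q x.

Definition mx_of_rows (n : nat) (rows : seq (seq C)) : 'M[C]_n :=
  \matrix_(i, j) nth 0 (nth [::] rows i) j.

Section R_matrix.
Variables (q : R) (kappa : C).
Local Notation qp := (qpow q).

Definition A_Ba (z xi : C) : C :=
  theta q [:: qp (- z); qp (2 * kappa + xi)]
  / theta q [:: qp (2 * kappa - z); qp xi].

Definition B_Ba (z xi : C) : C :=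
  theta q [:: qp (- z - xi); qp (2 * kappa)]
  / theta q [:: qp (2 * kappa - z); qp (- xi)].

Definition R_Ba (z xi : C) : 'M[C]_(2 * 2) :=
  mx_of_rows (2 * 2)
    [:: [:: 1; 0; 0; 0];
        [:: 0; A_Ba z xi; B_Ba z xi; 0];
        [:: 0; B_Ba z (- xi); A_Ba z (- xi); 0];
        [:: 0; 0; 0; 1]].

End R_matrix.

Section K_matrix.
Variables (q : R) (zeta zeta' upsilon upsilon' : C).
Local Notation qp := (qpow q).

Definition a_par : C := qp (zeta + upsilon).
Definition b_par : C := - qp (zeta - upsilon).
Definition c_par : C := qp (2^-1 + zeta' + upsilon').
Definition d_par : C := - qp (2^-1 + zeta' - upsilon').
Definition a_tilde : C := qp (zeta + zeta').
Definition b_tilde : C := - qp (zeta - zeta').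
Definition c_tilde : C := qp (2^-1 + upsilon + upsilon').
Definition d_tilde : C := - qp (2^-1 + upsilon - upsilon').

Definition calC (z xi : C) : C :=
  theta q [:: a_tilde * qp xi; b_tilde * qp xi; c_tilde * qp xi;
              d_par * qp (xi - z) / a_tilde]
  / theta q [:: qp (2 * xi); d_par * qp (- z)]
  * qp (- ((zeta + upsilon - z) * (zeta + zeta' - xi))).

Definition calCt (z xi : C) : C :=
  theta q [:: a_par * qp xi; b_par * qp xi; c_par * qp xi;
              d_tilde * qp (xi - z) / a_par]
  / theta q [:: qp (2 * xi); d_tilde * qp (- z)]
  * qp (- ((zeta + zeta' - z) * (zeta + upsilon - xi))).

Definition alpha_Ba (z xi : C) : C :=
  (calC z xi - calCt xi z) / calCt xi (- z) * qp (2 * z * xi).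

Definition beta_Ba (z xi : C) : C := calC z xi / calCt (- xi) (- z).

Definition K_Ba (z xi : C) : 'M[C]_2 :=
  mx_of_rows 2
    [:: [:: alpha_Ba z xi; beta_Ba z xi];
        [:: beta_Ba z (- xi); alpha_Ba z (- xi)]].

End K_matrix.

End Baxter.

(* Main.v *)
Require Import Defs.
From HB Require Import structures.
From mathcomp Require Import all_boot all_order all_algebra finmap.
From mathcomp Require Import complex mxtens ring lra zify.
From mathcomp Require Import all_classical all_reals all_analysis.

Set Implicit Arguments.
Unset Strict Implicit.
Unset Printing Implicit Defensive.

Import Order.TTheory GRing.Theory Num.Theory.
Import numFieldNormedType.Exports.

Local Open Scope classical_set_scope.
Local Open Scope ring_scope.
Local Open Scope complex_scope.

(** Multiplying theta1(q^z) by q^(-z/2) gives an odd entire function [sigma] that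
    satisfies Weierstrass's three-term relation ([sigma_odd], [sigma_three]).
    Once all theta functions are written with [sigma], the exponential factors of
    the R-matrix cancel, and everything except nonvanishing of denominators is
    algebra with an odd function S subject to the three-term relation.

    R-matrix.  Every entry of the dynamical Yang-Baxter equation is trivial, or one
    instance of the three-term relation, or (the central entry, [ybe22]) follows
    from two others because the determinant of the middle block does not depend on
    the dynamical parameter ([R_det]).

    K-matrix.  Writing -1 as a power of q makes a, b, c, d and their tilde versions
    powers of q.  Then alpha and beta share a factor [K_scale] depending on z only:
    alpha = K_scale(z) diagK(z, xi), beta = K_scale(z) K_off(xi), where [diagK] is a
    kind of divided difference of a product [quartic] of four sigmas.  The symmetry
    diagK(-w, -x) = - diagK(w, x) is a partial fraction identity with four poles; it
    gives the value of diagK(w, x) diagK(w, -x) and hence unitarity.  In the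
    reflection equation the common factors drop out, and three relations between the
    functions diagK(z1, .) and diagK(z2, .) remain: a linear one, which is a partial
    fraction identity with five poles ([reflection_linear]); its image under
    unitarity of R ([reflection_linear_dual]); and a quadratic one, which follows
    from the linear one and the value of diagK(w, x) diagK(w, -x)
    ([reflection_quadratic]).

    Theta function.  The q-binomial theorem, with a dominated passage to the limit
    ([tannery]), gives Jacobi's triple product: theta1 is a constant times
    the sum of (-1)^n q^(n(n-1)/2) x^n over the integers ([theta_limit]).  Splitting
    pairs of integers (m, n) by the parity of m + n shows that
    theta1(x y) theta1(x / y) has rank two as a function of (x, y)
    ([theta_rank2]); an antisymmetric function of rank two has vanishing
    Pfaffians, and this is the three-term relation.

    Generic points.  The product shows that sigma(z) <> 0 unless Re z is an integer
    ([sigma_neq0]).  Hence finitely many conditions sigma(l(p)) <> 0, with l affine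
    and not constant, hold on an open dense set, where the algebra applies.  The
    Laurent series makes sigma entire, so all entries are quotients of entire
    functions. *)

(** * The R-matrix of an odd function with a three-term relation *)

Lemma lincomb_eq (F : pzRingType) (c l' r' l r : F) : l' = r' -> l - r = c * (l' - r') -> l = r.
Proof. by move=> ->; rewrite subrr mulr0 => /eqP; rewrite subr_eq0 => /eqP. Qed.

Section OddThreeTerm.
Context {F : fieldType} (S : F -> F).
Hypothesis S_odd : forall x, S (- x) = - S x.
Hypothesis S_three : forall y1 y2 y3 u v,
  S (y1 + u) * S (y1 + v) * S (y2 + y3 + u + v) * S (y2 - y3)
  + S (y2 + u) * S (y2 + v) * S (y3 + y1 + u + v) * S (y3 - y1)
  + S (y3 + u) * S (y3 + v) * S (y1 + y2 + u + v) * S (y1 - y2) = 0.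

(** To prove an identity from P = 0 it suffices to exhibit the multiplier of P; this
    is how every identity below is reduced to a certificate checked by [ring] or
    [field]. *)
Lemma lincomb (c P l r : F) : P = 0 -> l - r = c * P -> l = r.
Proof. by move=> ->; rewrite mulr0 => /eqP; rewrite subr_eq0 => /eqP. Qed.

(* Values of S become variables, arguments that agree up to sign sharing one; without
   this [field] would not see S (- t) and - S t as related.  Comparing squares first
   discards unrelated arguments with a single failing call. *)
Local Ltac S_abstract :=
  repeat match goal with |- context [S ?t] =>
    first
    [ match goal with E : ?x = S ?u |- _ =>
        assert_succeeds (have _ : t * t = u * u by ring);
        first [ rewrite (_ : S t = x); [|by rewrite E; congr S; ring]
              | rewrite (_ : S t = - x); [|by rewrite E -S_odd; congr S; ring] ]
      end
    | let x := fresh "x" in let E := fresh "E" in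
      destruct (ex_intro (fun x => x = S t) (S t) erefl) as [x E]; rewrite -E ]
  end;
  repeat match goal with E : _ = S _ |- _ => clear E end;
  rewrite ?oppr_eq0.

Local Ltac S_field :=
  S_abstract; intros;
  by field; rewrite ?oppr_eq0; repeat (apply/andP; split).

(** With S = sigma these are A_Ba and B_Ba for p = 2 kappa, without exponential
    factors. *)
Definition R_diag p z xi := - S z * S (p + xi) / (S (p - z) * S xi).
Definition R_off p z xi := S (z + xi) * S p / (S (p - z) * S xi).

Section FixedParameter.
Variable p : F.
Local Notation RA := (R_diag p).
Local Notation RB := (R_off p).

Section YBE.
Variables a b xi : F.
Hypotheses (na : S (p-a) != 0) (nb : S (p-b) != 0)
  (nab : S (p-(a+b)) != 0) (nxi : S xi != 0) (nxp : S (p - xi) != 0).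

(** This and the five lemmas that follow are entries of the Yang-Baxter equation on
    the weight space with one v_-, named by row and column; each is one instance of
    the three-term relation, multiplied by the factor displayed. *)
Lemma ybe31 : RA b (xi-p) * RB (a+b) (-xi) * RA a (p-xi) + RB b (p-xi) * RB a (p-xi) = RB (a+b) (p-xi).
Proof.
apply: (lincomb (c := - S p / (S (p-a) * S (p-b) * S (p-(a+b)) * S (p-xi) ^+2)) (S_three a p 0 (b-p) (p-xi))).
rewrite /R_diag /R_off; move: na nb nab nxi nxp.
S_field.
Qed.

Lemma ybe21 : RA b (xi-p) * RB (a+b) (-xi) * RB a (xi-p) + RB b (p-xi) * RA a (xi-p) = RA (a+b) (xi-p) * RB b (-xi).
Proof.
apply: (lincomb (c := S p / (S (p-a) * S (p-b) * S (p-(a+b)) * S (p-xi) ^+2)) (S_three (-xi) (-p) 0 (a+b) (xi-b))).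
rewrite /R_diag /R_off; move: na nb nab nxi nxp.
S_field.
Qed.

Lemma ybe12 : RB b (xi-p) * RA (a+b) xi = RA a xi * RB b xi + RB a (-xi) * RB (a+b) (xi-p) * RA b xi.
Proof.
apply: (lincomb (c := S p * S (p+xi) / (S (p-a) * S (p-b) * S (p-(a+b)) * S (p-xi) * S xi ^+2)) (S_three (-xi) (-a) 0 p (-b))).
rewrite /R_diag /R_off; move: na nb nab nxi nxp.
S_field.
Qed.

Lemma ybe32 : RB b (xi-p) * RB (a+b) (-xi) * RA a (p-xi) + RA b (p-xi) * RB a (p-xi) = RB a (-xi) * RA (a+b) (p-xi).
Proof.
apply: (lincomb (c := S p * S (p+p-xi) / (S (p-a) * S (p-b) * S (p-(a+b)) * S (p-xi)^+2 * S xi)) (S_three p xi 0 (a-xi) (-(a+b)))).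
rewrite /R_diag /R_off; move: na nb nab nxi nxp.
S_field.
Qed.

Lemma ybe13 : RB (a+b) xi = RB a xi * RB b xi + RA a (-xi) * RB (a+b) (xi-p) * RA b xi.
Proof.
apply: (lincomb (c := - S p / (S (p-a) * S (p-b) * S (p-(a+b)) * S xi ^+2)) (S_three xi (-p) 0 a b)).
rewrite /R_diag /R_off; move: na nb nab nxi nxp.
S_field.
Qed.

Lemma ybe23 : RA (a+b) (-xi) * RB a (xi-p) = RB a xi * RA b (-xi) + RA a (-xi) * RB (a+b) (xi-p) * RB b (-xi).
Proof.
apply: (lincomb (c := S p / (S (p-a) * S (p-b) * S (p-(a+b)) * S xi ^+2)) (S_three b xi 0 a (-p))).
rewrite /R_diag /R_off; move: na nb nab nxi nxp.
S_field.
Qed.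

End YBE.

(** The determinant of the middle block does not depend on xi; this is what makes
    the remaining entry [ybe22] of the Yang-Baxter equation follow from [ybe32] and
    [ybe23]. *)
Lemma R_det a xi : S (p-a) != 0 -> S xi != 0 -> RA a xi * RA a (-xi) - RB a xi * RB a (-xi) = - S (p + a) / S (p - a).
Proof.
move=> na nxi.
apply: (lincomb (c := 1 / (S (p-a) ^+2 * S xi ^+2)) (S_three a p 0 xi (-xi))).
rewrite /R_diag /R_off; move: na nxi.
S_field.
Qed.

Lemma R_unit_diag a xi : S (p - a) != 0 -> S (p + a) != 0 -> S xi != 0 ->
  RA a (- xi) * RA (- a) xi + RB a (- xi) * RB (- a) (- xi) = 1.
Proof.
move=> na na' nxi.
apply: (lincomb (c := - 1 / (S (p-a) * S (p+a) * S xi ^+2)) (S_three a (-p) 0 xi (-xi))).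
rewrite /R_diag /R_off; move: na na' nxi; S_field.
Qed.

Lemma R_unit_off a xi :
  RA a (- xi) * RB (- a) xi + RB a (- xi) * RA (- a) (- xi) = 0.
Proof.
rewrite /R_diag /R_off (_ : - a + xi = - (a - xi)); last by ring.
by rewrite !S_odd !(invfM, invrN); ring.
Qed.

Lemma R_diag_cross a b x y : RA a x * RA b y = RA b x * RA a y.
Proof. by rewrite /R_diag !invfM; ring. Qed.

(** This entry has four terms and is not a single three-term relation.  Multiplied
    by two entries of R, its products can be replaced using [ybe32] and [ybe23], and
    the rest is the equality of the determinants at xi and at xi - p. *)
Lemma ybe22 a b xi : S (p - a) != 0 -> S (p - b) != 0 -> S (p - (a + b)) != 0 ->
  S xi != 0 -> S (p - xi) != 0 -> S a != 0 -> S (p + p - xi) != 0 ->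
  RB b (xi - p) * RB (a + b) (- xi) * RB a (xi - p) + RA b (p - xi) * RA a (xi - p)
  = RA a xi * RA b (- xi) + RB a (- xi) * RB (a + b) (xi - p) * RB b (- xi).
Proof.
move=> na nb nab nxi nxp na0 n2p.
have nA1 : RA a (- xi) != 0.
  rewrite /R_diag !(mulf_neq0, invr_eq0, oppr_eq0)//; rewrite ?S_odd ?oppr_eq0//.
have nA2 : RA a (p - xi) != 0.
  by rewrite /R_diag addrA !(mulf_neq0, invr_eq0, oppr_eq0).
have e32 := ybe32 na nb nab nxi nxp.
have e23 := ybe23 na nb nab nxi nxp.
have d1 := R_det na nxi.
have d2 : RA a (xi - p) * RA a (p - xi) - RB a (xi - p) * RB a (p - xi)
   = - S (p + a) / S (p - a).
  rewrite -[p - xi]opprB; apply: (R_det na).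
  by rewrite -opprB S_odd oppr_eq0.
have c1 := R_diag_cross a b (-xi) (p - xi).
have c2 := R_diag_cross (a+b) a (p-xi) (-xi).
apply: (mulfI nA1); apply: (mulfI nA2).
move: c1 c2 e32 e23 d1; rewrite -d2.
move: (RA a (- xi)) (RA a (p - xi)) (RB b (xi - p)) (RB (a + b) (- xi))
  (RA b (p-xi)) (RB a (p-xi)) (RB a (-xi)) (RA (a+b) (p-xi)) (RA (a+b) (-xi))
  (RB a (xi-p)) (RB a xi) (RA b (-xi)) (RB (a+b) (xi-p)) (RB b (-xi)) (RA a xi) (RA a (xi-p))
  => A' A'' B0 B1 A2 B2 B3 A4 A5 B4 B5 A6 B6 B7 A7 A8 c1 c2 e32 e23 d.
have {}e32 : B0 * B1 * A'' = B3 * A4 - A2 * B2 by rewrite -e32; ring.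
have {}e23 : A' * B6 * B7 = A5 * B4 - B5 * A6 by rewrite e23; ring.
transitivity (A' * B4 * (B0 * B1 * A'') + A' * A2 * A8 * A''); first by ring.
rewrite e32.
transitivity (A7 * A' * (A6 * A'') + A'' * B3 * (A' * B6 * B7)); last by ring.
rewrite e23.
transitivity (A' * A2 * (A8 * A'' - B4 * B2) + B3 * B4 * (A4 * A')); first by ring.
rewrite -d c1 c2; ring.
Qed.

End FixedParameter.

(** * Partial fractions and the diagonal entry of the K-matrix *)

(** The sum of the residues of an elliptic function with four poles y1, .., y4.
    Eliminating the numerator factors u3, u4 with the three-term relation reduces it
    to two instances with three poles, which are the three-term relation itself. *)
Lemma partial_fractions4 y1 y2 y3 y4 u1 u2 u3 u4 :
  y1 + y2 + y3 + y4 + u1 + u2 + u3 + u4 = 0 ->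
  S (y1 - y2) != 0 -> S (y1 + y2 + u3 + u4) != 0 ->
  let N y := S (y + u1) * S (y + u2) * S (y + u3) * S (y + u4) in
    N y1 * (S (y2 - y3) * S (y2 - y4) * S (y3 - y4))
  - N y2 * (S (y1 - y3) * S (y1 - y4) * S (y3 - y4))
  + N y3 * (S (y1 - y2) * S (y1 - y4) * S (y2 - y4))
  - N y4 * (S (y1 - y2) * S (y1 - y3) * S (y2 - y3)) = 0.
Proof.
move=> s0 n12 nc N.
have split y : S (y1 + y2 + u3 + u4) * S (y1 - y2) * (S (y + u3) * S (y + u4)) =
   S (y1 + u3) * S (y1 + u4) * (S (y - y2) * S (y + (y2 + u3 + u4)))
   - S (y2 + u3) * S (y2 + u4) * (S (y - y1) * S (y + (y1 + u3 + u4))).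
  apply: (lincomb (c := 1) (S_three y1 y2 y u3 u4)).
  by S_field.
have three y y' y'' v : v + y + y' + y'' + u1 + u2 = 0 ->
    S (y + u1) * S (y + u2) * S (y + v) * S (y' - y'')
  - S (y' + u1) * S (y' + u2) * S (y' + v) * S (y - y'')
  + S (y'' + u1) * S (y'' + u2) * S (y'' + v) * S (y - y') = 0.
  move=> e; have -> : v = - (y + y' + y'' + u1 + u2) by rewrite -(subr0 v) -e; ring.
  rewrite (_ : y - (y + y' + y'' + u1 + u2) = - (y' + y'' + u1 + u2)); last by ring.
  rewrite (_ : y' - (y + y' + y'' + u1 + u2) = - (y'' + y + u1 + u2)); last by ring.
  rewrite (_ : y'' - (y + y' + y'' + u1 + u2) = - (y + y' + u1 + u2)); last by ring.
  rewrite (_ : y - y'' = - (y'' - y)); last by ring.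
  rewrite !S_odd; apply: (lincomb (c := -1) (S_three y y' y'' u1 u2)); ring.
have t1 := three y1 y3 y4 (y2 + u3 + u4) _.
have t2 := three y2 y3 y4 (y1 + u3 + u4) _.
have {}t1 := t1 ltac:(by rewrite -s0; ring).
have {}t2 := t2 ltac:(by rewrite -s0; ring).
have n0 : S (y1 + y2 + u3 + u4) * S (y1 - y2) != 0 by rewrite mulf_neq0.
apply: (mulfI n0); rewrite mulr0.
have s3 := split y3; have s4 := split y4.
have c12 : S (y1 + (y2 + u3 + u4)) = S (y1 + y2 + u3 + u4) by congr S; ring.
have c21 : S (y2 + (y1 + u3 + u4)) = S (y1 + y2 + u3 + u4) by congr S; ring.
have Sopp y z : S (y - z) = - S (z - y) by rewrite -S_odd opprB.
rewrite (Sopp y3 y2) (Sopp y3 y1) in s3; rewrite (Sopp y4 y2) (Sopp y4 y1) in s4.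
rewrite c12 in t1; rewrite c21 in t2; rewrite /N.
move: (S (y1 + y2 + u3 + u4)) (S (y1 - y2)) (S (y1 - y3)) (S (y1 - y4)) (S (y2 - y3))
  (S (y2 - y4)) (S (y3 - y4)) (S (y1 + u3)) (S (y2 + u3)) (S (y1 + u4)) (S (y2 + u4))
  (S (y3 + (y2 + u3 + u4))) (S (y3 + (y1 + u3 + u4)))
  (S (y4 + (y2 + u3 + u4))) (S (y4 + (y1 + u3 + u4))) s3 s4 t1 t2 =>
  c d12 d13 d14 d23 d24 d34 a3 b3 a4 b4 t3 t3' t4 t4' s3 s4 t1 t2.
transitivity (d12 * d14 * d24 * (S (y3 + u1) * S (y3 + u2)) * (c * d12 * (S (y3 + u3) * S (y3 + u4)))
  - d12 * d13 * d23 * (S (y4 + u1) * S (y4 + u2)) * (c * d12 * (S (y4 + u3) * S (y4 + u4)))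
  + c * d12 * (S (y1 + u1) * S (y1 + u2) * a3 * a4 * (d23 * d24 * d34)
      - S (y2 + u1) * S (y2 + u2) * b3 * b4 * (d13 * d14 * d34))); first by ring.
rewrite s3 s4.
move: t1 t2.
set e1 := (X in X = 0 -> _); set e2 := (X in _ -> X = 0 -> _) => t1 t2.
transitivity (d12 * a3 * a4 * d23 * d24 * e1 - d12 * b3 * b4 * d13 * d14 * e2); last by rewrite t1 t2; ring.
by rewrite /e1 /e2; ring.
Qed.

(** Same reduction as for four poles: the factors with u4, u5 are eliminated in
    favour of y1 and y2, which leaves two identities with four poles. *)
Lemma partial_fractions5 y1 y2 y3 y4 y5 u1 u2 u3 u4 u5 :
  y1 + y2 + y3 + y4 + y5 + u1 + u2 + u3 + u4 + u5 = 0 ->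
  S (y1 - y2) != 0 -> S (y1 - y3) != 0 -> S (y2 - y3) != 0 ->
  S (y1 + y2 + u4 + u5) != 0 ->
  S (y1 + y3 + u2 + u3) != 0 -> S (y2 + y3 + u2 + u3) != 0 ->
  let N y := S (y + u1) * S (y + u2) * S (y + u3) * S (y + u4) * S (y + u5) in
    N y1 * (S (y2 - y3) * S (y2 - y4) * S (y2 - y5)
            * S (y3 - y4) * S (y3 - y5) * S (y4 - y5))
  - N y2 * (S (y1 - y3) * S (y1 - y4) * S (y1 - y5)
            * S (y3 - y4) * S (y3 - y5) * S (y4 - y5))
  + N y3 * (S (y1 - y2) * S (y1 - y4) * S (y1 - y5)
            * S (y2 - y4) * S (y2 - y5) * S (y4 - y5))
  - N y4 * (S (y1 - y2) * S (y1 - y3) * S (y1 - y5)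
            * S (y2 - y3) * S (y2 - y5) * S (y3 - y5))
  + N y5 * (S (y1 - y2) * S (y1 - y3) * S (y1 - y4)
            * S (y2 - y3) * S (y2 - y4) * S (y3 - y4)) = 0.
Proof.
move=> s0 n12 n13 n23 nc n1 n2 N.
have split y : S (y1 + y2 + u4 + u5) * S (y1 - y2) * (S (y + u4) * S (y + u5)) =
   S (y1 + u4) * S (y1 + u5) * (S (y - y2) * S (y + (y2 + u4 + u5)))
   - S (y2 + u4) * S (y2 + u5) * (S (y - y1) * S (y + (y1 + u4 + u5))).
  apply: (lincomb (c := 1) (S_three y1 y2 y u4 u5)).
  by S_field.
have t1 := @partial_fractions4 y1 y3 y4 y5
   u1 (y2 + u4 + u5) u2 u3 ltac:(by rewrite -s0; ring) n13 n1.
have t2 := @partial_fractions4 y2 y3 y4 y5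
   u1 (y1 + u4 + u5) u2 u3 ltac:(by rewrite -s0; ring) n23 n2.
have n0 : S (y1 + y2 + u4 + u5) * S (y1 - y2) != 0 by rewrite mulf_neq0.
apply: (mulfI n0); rewrite mulr0.
have s3 := split y3; have s4 := split y4; have s5 := split y5.
have c12 : S (y1 + (y2 + u4 + u5)) = S (y1 + y2 + u4 + u5) by congr S; ring.
have c21 : S (y2 + (y1 + u4 + u5)) = S (y1 + y2 + u4 + u5) by congr S; ring.
have Sopp y z : S (y - z) = - S (z - y) by rewrite -S_odd opprB.
rewrite (Sopp y3 y2) (Sopp y3 y1) in s3; rewrite (Sopp y4 y2) (Sopp y4 y1) in s4.
rewrite (Sopp y5 y2) (Sopp y5 y1) in s5.
rewrite /= c12 in t1; rewrite /= c21 in t2; rewrite /N.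
(* The products over u1, u2, u3 enter linearly and are abstracted. *)
have {N} G y : exists g, S (y + u1) * S (y + u2) * S (y + u3) = g by eexists.
have H y v : S (y + u1) * v * S (y + u2) * S (y + u3)
  = S (y + u1) * S (y + u2) * S (y + u3) * v by ring.
rewrite !H {H} in t1 t2.
have [g1 E1] := G y1; have [g2 E2] := G y2; have [g3 E3] := G y3.
have [g4 E4] := G y4; have [g5 E5] := G y5.
rewrite E1 E3 E4 E5 in t1; rewrite E2 E3 E4 E5 in t2; rewrite E1 E2 E3 E4 E5.
move: s3 s4 s5 t1 t2 => {G E1 E2 E3 E4 E5 split c12 c21 n0}.
move: (S (y1 + y2 + u4 + u5)) (S (y1 - y2)) (S (y1 - y3)) (S (y1 - y4)) (S (y1 - y5))
  (S (y2 - y3)) (S (y2 - y4)) (S (y2 - y5)) (S (y3 - y4)) (S (y3 - y5)) (S (y4 - y5))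
  (S (y1 + u4)) (S (y2 + u4)) (S (y1 + u5)) (S (y2 + u5))
  (S (y3 + (y2 + u4 + u5))) (S (y3 + (y1 + u4 + u5)))
  (S (y4 + (y2 + u4 + u5))) (S (y4 + (y1 + u4 + u5)))
  (S (y5 + (y2 + u4 + u5))) (S (y5 + (y1 + u4 + u5)))
  (S (y3 + u4)) (S (y3 + u5)) (S (y4 + u4)) (S (y4 + u5)) (S (y5 + u4)) (S (y5 + u5)) =>
  c d12 d13 d14 d15 d23 d24 d25 d34 d35 d45 a4 b4 a5 b5 t3 t3' t4 t4' t5 t5'
  p3 q3 p4 q4 p5 q5 s3 s4 s5 t1 t2.
transitivity (d12 * (d14 * d15 * d24 * d25 * d45 * g3 * (c * d12 * (p3 * q3))
  - d13 * d15 * d23 * d25 * d35 * g4 * (c * d12 * (p4 * q4))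
  + d13 * d14 * d23 * d24 * d34 * g5 * (c * d12 * (p5 * q5)))
  + c * d12 * (g1 * a4 * a5 * (d23 * d24 * d25 * d34 * d35 * d45)
      - g2 * b4 * b5 * (d13 * d14 * d15 * d34 * d35 * d45))); first by ring.
rewrite s3 s4 s5.
move: t1 t2.
set e1 := (X in X = 0 -> _); set e2 := (X in _ -> X = 0 -> _) => t1 t2.
transitivity (d12 * a4 * a5 * d23 * d24 * d25 * e1 - d12 * b4 * b5 * d13 * d14 * d15 * e2);
  last by rewrite t1 t2; ring.
by rewrite /e1 /e2; ring.
Qed.

Section Reflection.
Variables a b c s : F.
(** The four shifts sum to - 2 s, which balances the poles w, s - x, - w, s + x in
    the partial fraction identities for f. *)
Definition quartic y := S (y + a) * S (y + b) * S (y + c) * S (y - (a + b + c + s + s)).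
Local Notation f := quartic.
(** The diagonal entry of the K-matrix up to a scalar.  The numerator vanishes where
    s - w - x does, so this is a divided difference of f at w and s - x. *)
Definition diagK w x :=
  (f (s - x) * S (s + x - w) / S (x + x) - f w * S (s + w - x) / S (w + w)) / S (s - w - x).

(** The four poles are w, s - x, - w, s + x. *)
Lemma diagK_opp w x : S (x + x) != 0 -> S (w + w) != 0 ->
  S (s - w - x) != 0 -> S (s + w + x) != 0 ->
  S (s + x - w) != 0 ->
  S (w - s - x - a - b) != 0 ->
  diagK (- w) (- x) = - diagK w x.
Proof.
move=> nx nw n1 n2 n4 n5.
have n4' : S (w - (s - x)) != 0.
  by rewrite (_ : w - (s - x) = - (s - w - x)); [rewrite S_odd oppr_eq0|ring].
have n5' : S (w + (s - x) + c - (a + b + c + s + s)) != 0.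
  suff -> : w + (s - x) + c - (a + b + c + s + s) = w - s - x - a - b by [].
  ring.
have pf : f w * (S (s - x - - w) * S (s - x - (s + x)) * S (- w - (s + x)))
  - f (s - x) * (S (w - - w) * S (w - (s + x)) * S (- w - (s + x)))
  + f (- w) * (S (w - (s - x)) * S (w - (s + x)) * S (s - x - (s + x)))
  - f (s + x) * (S (w - (s - x)) * S (w - - w) * S (s - x - - w)) = 0.
  by apply: (partial_fractions4 _ n4' n5'); ring.
apply: (lincomb (c := - 1 / (S (w + w) * S (x + x) * S (s - w - x) * S (s + w + x))) pf).
rewrite /diagK opprK; move: nx nw n1 n2 n4; clear pf n4' n5' n5.
move: (f w) (f (- w)) (f (s - x)) (f (s + x)) => f1 f2 f3 f4.
S_field.
Qed.

(** This is [diagK_opp] multiplied by a multiple of f(w): both statements compare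
    the same values of f, at w, - w, s - x and s + x. *)
Lemma diagK_norm w x : S (x + x) != 0 -> S (w + w) != 0 ->
  S (s - w - x) != 0 -> S (s + w + x) != 0 ->
  S (s + w - x) != 0 -> S (s + x - w) != 0 ->
  S (w - s - x - a - b) != 0 ->
  diagK w x * diagK w (- x) =
   f (s - x) * f (s + x) / (S (x + x) * S (- x - x)) - f w * f (- w) / (S (w + w) * S (- w - w)).
Proof.
move=> nx nw n1 n2 n3 n4 n5.
have := diagK_opp nx nw n1 n2 n4 n5.
rewrite /diagK !opprK => E.
have nx' : S (- x - x) != 0 by rewrite -opprD S_odd oppr_eq0.
have nw' : S (- w - w) != 0 by rewrite -opprD S_odd oppr_eq0.
move: E => /eqP; rewrite -subr_eq0 => /eqP E.
apply: (lincomb (c := - f w / S (w + w) * S (s + w + x) / S (s + x - w)) E).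
move: nx nw n1 n2 n3 n4; clear E nx' nw' n5.
move: (f w) (f (- w)) (f (s - x)) (f (s + x)) => f1 f2 f3 f4.
S_field.
Qed.

(** * Linear and quadratic relations between two K-matrix entries *)

Section Linear.
Variables w1 w2 x k : F.
Local Notation RA := (R_diag (k + k)).
Local Notation RB := (R_off (k + k)).
Local Notation m := (s - x - k).
Local Notation n := (s - x + k).
Hypotheses (nx : S (x + x) != 0) (nxp : S (x + x + (k + k)) != 0) (nxm : S (x + x - (k + k)) != 0)
  (nw1 : S (w1 + w1) != 0) (nw2 : S (w2 + w2) != 0)
  (nd : S (w1 - w2) != 0) (ne : S (w1 + w2) != 0)
  (npd : S (k + k - (w1 - w2)) != 0) (npe : S (k + k - (w1 + w2)) != 0)
  (nm1 : S (w1 - m) != 0) (nm1' : S (w1 + m) != 0) (nn1 : S (w1 - n) != 0) (nn1' : S (w1 + n) != 0)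
  (nm2 : S (w2 - m) != 0) (nn2 : S (w2 - n) != 0)
  (g1 : S (w1 + w2 - a - b - s - s) != 0) (g2 : S (w1 + m + a + b) != 0)
  (g3 : S (w2 + m + a + b) != 0)
  (g4 : S (s - w1 + (x - k)) != 0) (g5 : S (s + (x - k) + w1) != 0)
  (g6 : S (- w1 - s - (x - k) - a - b) != 0).

(** Five poles: w1, w2, - w1 and the two values m, n at which the shifted dynamical
    parameter enters f.  The extra numerator factor x + x - w2 makes the shifts sum
    to zero. *)
Lemma interpolation5 :
  S (k + k) * (f w1 * S (w1 + (x + x) - w2) / (S (w1 - w2) * S (w1 - m) * S (w1 + w1) * S (w1 - n))
   - f w2 * S (x + x) / (S (w1 - w2) * S (w2 - m) * S (w1 + w2) * S (w2 - n))
   + f (- w1) * S (x + x - w1 - w2) / (S (w1 + w1) * S (w1 + w2) * S (w1 + m) * S (w1 + n)))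
  - f m * S (m + (x + x) - w2) / (S (w1 - m) * S (w2 - m) * S (w1 + m))
  + f n * S (n + (x + x) - w2) / (S (w1 - n) * S (w2 - n) * S (w1 + n)) = 0.
Proof.
have pf : f w1 * S (w1 + (x + x - w2)) * (S (w2 - m) * S (w2 - - w1) * S (w2 - n)
            * S (m - - w1) * S (m - n) * S (- w1 - n))
  - f w2 * S (w2 + (x + x - w2)) * (S (w1 - m) * S (w1 - - w1) * S (w1 - n)
            * S (m - - w1) * S (m - n) * S (- w1 - n))
  + f m * S (m + (x + x - w2)) * (S (w1 - w2) * S (w1 - - w1) * S (w1 - n)
            * S (w2 - - w1) * S (w2 - n) * S (- w1 - n))
  - f (- w1) * S (- w1 + (x + x - w2)) * (S (w1 - w2) * S (w1 - m) * S (w1 - n)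
            * S (w2 - m) * S (w2 - n) * S (m - n))
  + f n * S (n + (x + x - w2)) * (S (w1 - w2) * S (w1 - m) * S (w1 - - w1)
            * S (w2 - m) * S (w2 - - w1) * S (m - - w1)) = 0.
  have := @partial_fractions5 w1 w2 m (- w1) n (x + x - w2) a b c
    (- (a + b + c + s + s)) ltac:(by ring) nd nm1 nm2.
  have -> : w1 + w2 + c - (a + b + c + s + s) = w1 + w2 - a - b - s - s by ring.
  have H y v : v * S (y + a) * S (y + b) * S (y + c) * S (y + - (a + b + c + s + s)) = f y * v.
    by rewrite /quartic; ring.
  by move=> /(_ g1 g2 g3) /=; rewrite !H.
have mn : S (m - n) = - S (k + k) by rewrite -S_odd; congr S; ring.
apply: (lincomb (c := 1 / (S (w1 - m) * S (w1 - n) * S (w2 - m) * S (w2 - n) * S (w1 + m)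
   * S (w1 + n) * S (w1 - w2) * S (w1 + w2) * S (w1 + w1))) pf).
move: nm1 nm1' nn1 nn1' nm2 nn2 nd ne nw1; rewrite mn; clear pf.
move: (f w1) (f w2) (f (- w1)) (f m) (f n) => f1 f2 f3 f4 f5.
S_field.
Qed.

(** The coefficients of f(w1), f(w2), f(m), f(- w1), f(n) in
    [reflection_linear_cleared] are compared one at a time with those in
    [interpolation5]; those of f(w2), f(m) and f(n) consist of two terms each, which
    a three-term relation combines. *)
Lemma interp_coef1 :
  - (S (w1 + w2) * S (w1 - w2 + (x + x)) * S (k + k) * S (m + w1)
     / (S (x + x) * S (w1 + w1) * S (m - w1)))
  = S (w1 + w2) * S (w1 - w2) * S (w1 + m) * S (w1 - n) / S (x + x)
    * (S (k + k) * (S (w1 + (x + x) - w2) / (S (w1 - w2) * S (w1 - m) * S (w1 + w1) * S (w1 - n)))).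
Proof.
move: nx nw1 nd nm1 nn1; S_field.
Qed.

Lemma interp_coef2 :
  (S (k + k - (w1 - w2)) * S (w1 + w2) * S (m + w2) / S (m - w2)
   + S (w2 - w1) * S (k + k - (w1 + w2)) * S (n + w2) / S (n - w2)) / S (w2 + w2)
  = S (w1 + w2) * S (w1 - w2) * S (w1 + m) * S (w1 - n) / S (x + x)
    * (- S (k + k) * S (x + x) / (S (w1 - w2) * S (w2 - m) * S (w1 + w2) * S (w2 - n))).
Proof.
apply: (lincomb (c := - 1 / (S (w2 - m) * S (w2 - n) * S (w2 + w2)))
  (S_three (- k - s - w2 + x) (- w1 - w2) 0 (w2 + w2) (k + k))).
move: nx nd ne nm2 nn2 nw2; S_field.
Qed.

Lemma interp_coef3 :
  S (k + k - (w1 - w2)) * S (- w1 - w2) * S (s + x + k - w2) / (S (x + x + (k + k)) * S (m - w2))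
  + S (w1 + w2) * S (w1 - w2 + (x + x)) * S (k + k) * S (s + x + k - w1)
     / (S (x + x) * S (x + x + (k + k)) * S (m - w1))
  = S (w1 + w2) * S (w1 - w2) * S (w1 + m) * S (w1 - n) / S (x + x)
    * (- S (m + (x + x) - w2) / (S (w1 - m) * S (w2 - m) * S (w1 + m))).
Proof.
apply: (lincomb (c := - S (w1 + w2) / (S (w1 - m) * S (w2 - m) * S (x + x) * S (x + x + (k + k))))
  (S_three (x + x) (- (k + k)) 0 (w1 - w2) (k + s - w1 - x))).
move: nx nxp nm1 nm1' nm2; S_field.
Qed.

Lemma interp_coef4 :
  - (S (w2 - w1) * S (x + x - w1 - w2) * S (k + k) * S (n - w1)
     / (S (x + x) * S (- w1 - w1) * S (n + w1)))
  = S (w1 + w2) * S (w1 - w2) * S (w1 + m) * S (w1 - n) / S (x + x)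
    * (S (k + k) * S (x + x - w1 - w2) / (S (w1 + w1) * S (w1 + w2) * S (w1 + m) * S (w1 + n))).
Proof.
move: nx nw1 ne nm1' nn1'; S_field.
Qed.

Lemma interp_coef5 :
  - (S (w2 - w1) * S (k + k - (w1 + w2)) * S (s + x - k - w2) / (S (x + x - (k + k)) * S (n - w2)))
  + S (w2 - w1) * S (x + x - w1 - w2) * S (k + k) * S (s + x - k + w1)
     / (S (x + x) * S (x + x - (k + k)) * S (n + w1))
  = S (w1 + w2) * S (w1 - w2) * S (w1 + m) * S (w1 - n) / S (x + x)
    * (S (n + (x + x) - w2) / (S (w1 - n) * S (w2 - n) * S (w1 + n))).
Proof.
apply: (lincomb (c := - S (w1 - w2) / (S (w1 + n) * S (w2 - n) * S (x + x) * S (x + x - (k + k))))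
  (S_three (- (k + k)) (- (x + x)) 0 (w1 + w2) (k - s - w1 + x))).
move: nx nxm nn1 nn1' nm2 nn2; S_field.
Qed.

(** The symmetry [diagK_opp] turns the values of diagK at - (x - k) into values at
    x - k, so that only f at w1, w2, - w1, m, n occur. *)
Lemma reflection_linear_cleared :
  S (k + k - (w1 - w2)) * S (- w1 - w2) * diagK w2 (x + k) =
  S (w2 - w1) * S (k + k - (w1 + w2)) * diagK w2 (x - k)
  + S (w2 - w1) * S (x + x - w1 - w2) * S (k + k) / S (x + x) * diagK w1 (- (x - k))
  + S (- w1 - w2) * S (w2 - w1 - (x + x)) * S (k + k) / S (- (x + x)) * diagK w1 (x + k).
Proof.
have -> : diagK w1 (- (x - k)) = - diagK (- w1) (x - k).
  have := diagK_opp (w := - w1) (x := x - k); rewrite opprK; apply=> //.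
  - by move: nxm; S_abstract.
  - by move: nw1; S_abstract.
  - by move: nn1'; S_abstract.
apply: (lincomb (c := S (w1 + w2) * S (w1 - w2) * S (w1 + m) * S (w1 - n) / S (x + x)) interpolation5).
rewrite /diagK opprK.
have -> : s - (x + k) = m by ring.
have -> : s - (x - k) = n by ring.
move: interp_coef1 interp_coef2 interp_coef3 interp_coef4 interp_coef5.
set A1 := (X in X = _ -> _); set A2 := (X in _ -> X = _ -> _).
set A3 := (X in _ -> _ -> X = _ -> _); set A4 := (X in _ -> _ -> _ -> X = _ -> _).
set A5 := (X in _ -> _ -> _ -> _ -> X = _ -> _) => e1 e2 e3 e4 e5.
transitivity (f w1 * A1 + f w2 * A2 + f m * A3 + f (- w1) * A4 + f n * A5); last first.
  by rewrite e1 e2 e3 e4 e5; ring.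
rewrite /A1 /A2 /A3 /A4 /A5.
clear A1 A2 A3 A4 A5 e1 e2 e3 e4 e5.
move: (f w1) (f w2) (f (- w1)) (f m) (f n) => f1 f2 f3 f4 f5.
move: nx nxp nxm nw1 nw2 nn1' nn2 nm1 nm2.
S_field.
Qed.

Lemma reflection_linear :
  RA (w1 + w2) (- (x + x)) * diagK w2 (x + k) =
  RA (w1 - w2) (- (x + x)) *
    (diagK w2 (x - k) + RB (w1 + w2) (- (x + x)) * diagK w1 (- (x - k)))
  + RB (w1 - w2) (x + x) * RA (w1 + w2) (- (x + x)) * diagK w1 (x + k).
Proof.
have := reflection_linear_cleared.
move/eqP; rewrite -subr_eq0 => /eqP pf.
apply: (lincomb (c := S (k + k - (x + x)) / (S (k + k - (w1 + w2)) * S (- (x + x)) * S (k + k - (w1 - w2)))) pf).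
rewrite /R_diag /R_off; clear pf.
move: (diagK w2 (x + k)) (diagK w2 (x - k)) (diagK w1 (- (x - k))) (diagK w1 (x + k)) => *.
move: nx npd npe; S_field.
Qed.
End Linear.

(** The nonvanishing conditions are kept as lists of arguments of S, so that generic
    validity can be proved for a whole list at once. *)
Definition all_nz (l : seq F) := all (fun t => S t != 0) l.

Definition linear_forms w1 w2 x k : seq F :=
  [:: x + x; x + x + (k + k); x + x - (k + k); w1 + w1; w2 + w2; w1 - w2; w1 + w2;
      k + k - (w1 - w2); k + k - (w1 + w2);
      w1 - (s - x - k); w1 + (s - x - k); w1 - (s - x + k); w1 + (s - x + k);
      w2 - (s - x - k); w2 - (s - x + k);
      w1 + w2 - a - b - s - s; w1 + (s - x - k) + a + b; w2 + (s - x - k) + a + b;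
      s - w1 + (x - k); s + (x - k) + w1; - w1 - s - (x - k) - a - b].

Definition norm_forms w x : seq F :=
  [:: x + x; w + w; s - w - x; s + w + x; s + w - x; s + x - w; w - s - x - a - b].

Lemma reflection_linear_nz w1 w2 x k : all_nz (linear_forms w1 w2 x k) ->
  R_diag (k + k) (w1 + w2) (- (x + x)) * diagK w2 (x + k) =
  R_diag (k + k) (w1 - w2) (- (x + x)) *
    (diagK w2 (x - k) + R_off (k + k) (w1 + w2) (- (x + x)) * diagK w1 (- (x - k)))
  + R_off (k + k) (w1 - w2) (x + x) * R_diag (k + k) (w1 + w2) (- (x + x)) * diagK w1 (x + k).
Proof.
do 21?[case/andP=> ?]; move=> _.
exact: reflection_linear.
Qed.

Lemma R_diag_neq0 p z xi : S z != 0 -> S (p + xi) != 0 -> S (p - z) != 0 -> S xi != 0 ->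
  R_diag p z xi != 0.
Proof. by move=> *; rewrite /R_diag !(mulf_neq0, invr_eq0, oppr_eq0). Qed.

Section Entries.
Local Opaque R_diag R_off diagK quartic.
Variables (w1 w2 x k : F).
Local Notation RA := (R_diag (k + k)).
Local Notation RB := (R_off (k + k)).
Local Notation D1 := (diagK w1).
Local Notation D2 := (diagK w2).

(** The linear relation also holds with w1 and w2 exchanged.  Eliminating
    diagK w2 (x + k) between the two versions with the unitarity relations
    [R_unit_diag] and [R_unit_off] gives this one. *)
Lemma reflection_linear_dual :
  all_nz (linear_forms w1 w2 x k) -> all_nz (linear_forms w2 w1 x k) ->
  S (k + k + (w1 - w2)) != 0 -> S (k + k - (x + x)) != 0 ->
  D1 (x - k) + RB (w1 + w2) (- (x + x)) * D2 (- (x - k)) =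
  RA (w1 - w2) (x + x) * RA (w1 + w2) (- (x + x)) * D1 (x + k)
  + RB (w1 - w2) (- (x + x)) * (D2 (x - k) + RB (w1 + w2) (- (x + x)) * D1 (- (x - k))).
Proof.
move=> nz12 nz21 nd' nx'.
have L12 := reflection_linear_nz nz12.
have L21 := reflection_linear_nz nz21.
move: nz12; do 21?[case/andP=> ?]; move=> _.
rewrite -opprB [w2 + w1]addrC in L21.
move: L12 L21; set d := w1 - w2; set e := w1 + w2; set X := x + x => L12 L21.
have nx : S (- X) != 0 by rewrite S_odd oppr_eq0.
have := R_unit_diag (p := k + k) (a := d) (xi := - X).
rewrite opprK => /(_ _ _ _) unit.
have {}unit : RA d X * RA (- d) (- X) + RB d X * RB (- d) X = 1 by exact: unit.
have off := R_unit_off (k + k) d X.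
have nr : RA (- d) (- X) != 0.
  by apply: R_diag_neq0 => //; rewrite ?opprK // S_odd oppr_eq0.
apply: (mulfI nr).
transitivity (RA e (- X) * D1 (x + k) - RB (- d) X * (RA e (- X) * D2 (x + k))).
  by rewrite L21; ring.
rewrite L12.
transitivity ((1 - RB d X * RB (- d) X) * RA e (- X) * D1 (x + k)
  - (RA d (- X) * RB (- d) X) * (D2 (x - k) + RB e (- X) * D1 (- (x - k)))); first by ring.
rewrite -unit; move/eqP: off; rewrite addr_eq0 => /eqP ->; ring.
Qed.

(** Through [diagK_norm] h is replaced by a product of two values of diagK w2, up to
    a constant.  The linear relations at x and at - x then turn both sides into the
    same product. *)
Lemma reflection_quadratic (h : F -> F) :
  (forall t, all_nz (norm_forms w2 t) ->
     h t = f (s - t) * f (s + t) / (S (t + t) * S (- t - t))) ->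
  all_nz (linear_forms w1 w2 x k) -> all_nz (linear_forms w1 w2 (- x) k) ->
  all_nz (norm_forms w2 (x + k)) -> all_nz (norm_forms w2 (x - k)) ->
  RB (w1 + w2) (x + x) * RA (w1 - w2) (- (x + x)) * (D2 (x + k) * D1 (x + k))
  + RA (w1 + w2) (- (x + x)) * RB (w1 - w2) (- (x + x)) * (D2 (x + k) * D1 (- (x - k)))
  + RA (w1 - w2) (- (x + x)) * h (x + k)
  = RB (w1 + w2) (- (x + x)) * RA (w1 - w2) (- (x + x)) * (D2 (- (x - k)) * D1 (- (x - k)))
  + RA (w1 + w2) (- (x + x)) * RB (w1 - w2) (x + x) * (D2 (- (x - k)) * D1 (x + k))
  + RA (w1 - w2) (- (x + x)) * h (x - k).
Proof.
move=> hE nz nz' no no'.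
have norm t : all_nz (norm_forms w2 t) ->
    h t = D2 t * D2 (- t) + f w2 * f (- w2) / (S (w2 + w2) * S (- w2 - w2)).
  move=> n; rewrite hE //; move: n; do 7?[case/andP=> ?]; move=> _.
  by rewrite diagK_norm // subrK.
rewrite !norm // {norm hE no no'}.
have L := reflection_linear_nz nz.
have L' := reflection_linear_nz nz'.
have xx : - x + - x = - (x + x) by rewrite opprD.
have xk : - x + k = - (x - k) by rewrite opprB addrC.
have xk' : - x - k = - (x + k) by rewrite opprD.
rewrite xx xk xk' !opprK in L'.
have c1 := R_diag_cross (k + k) (w1 + w2) (w1 - w2) (x + x) (- (x + x)).
have nA : RA (w1 - w2) (x + x) != 0.
  move: nz; do 21?[case/andP=> ?]; move=> _.
  by apply: R_diag_neq0 => //; rewrite addrC.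
set Ae := RA (w1 + w2) (- (x + x)) in L c1 *; set Ad := RA (w1 - w2) (- (x + x)) in L c1 *.
have {}L' : Ae * D2 (- (x - k)) =
   Ad * (D2 (- (x + k)) + RB (w1 + w2) (x + x) * D1 (x + k))
  + RB (w1 - w2) (- (x + x)) * Ae * D1 (- (x - k)).
  apply: (mulfI nA); transitivity (Ad * (RA (w1 + w2) (x + x) * D2 (- (x - k)))).
    transitivity (RA (w1 + w2) (x + x) * Ad * D2 (- (x - k))); last by ring.
    by rewrite c1; ring.
  rewrite L'; transitivity (RA (w1 - w2) (x + x) * Ad *
      (D2 (- (x + k)) + RB (w1 + w2) (x + x) * D1 (x + k))
    + (RA (w1 + w2) (x + x) * Ad) * RB (w1 - w2) (- (x + x)) * D1 (- (x - k))).
    by ring.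
  by rewrite c1; ring.
transitivity (D2 (x + k) * (Ae * D2 (- (x - k)))
   + Ad * (f w2 * f (- w2) / (S (w2 + w2) * S (- w2 - w2)))); first by rewrite L'; ring.
transitivity (D2 (- (x - k)) * (Ae * D2 (x + k))
   + Ad * (f w2 * f (- w2) / (S (w2 + w2) * S (- w2 - w2)))); first by ring.
by rewrite L; ring.
Qed.
End Entries.
End Reflection.
End OddThreeTerm.

(** * Matrices given by sparse columns *)

Section SparseColumns.
Context {K : comNzRingType}.
Implicit Types (c : nat -> seq (K * nat)).

(** A matrix whose columns are lists of (coefficient, row) pairs.  The factors of
    the equations have at most two nonzero entries per column, so that their
    products can be computed by evaluation. *)
Definition colmx n c : 'M[K]_n := \matrix_(i, j) \sum_(t <- c j) t.1 *+ (t.2 == i :> nat).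

Definition cols_below n c := forall j, (j < n)%N -> all (fun t => (t.2 < n)%N) (c j).

Definition colmul c c' j := flatten [seq [seq (u.1 * t.1, u.2) | u <- c t.2] | t <- c' j].

Lemma colmx_mul n c c' : cols_below n c' -> colmx n c *m colmx n c' = colmx n (colmul c c').
Proof.
move=> lt; apply/matrixP=> i j; rewrite !mxE /colmul big_flatten big_map /=.
transitivity (\sum_(k < n) colmx n c i k * \sum_(t <- c' j) t.1 *+ (t.2 == k :> nat)).
  by apply: eq_bigr => k _; rewrite [X in _ * X]mxE.
have {lt} := lt j (ltn_ord j).
elim: (c' j) => [_|t s IH /andP[t_lt /IH {IH} e]].
  by rewrite big_nil big1 // => k _; rewrite big_nil mulr0.
rewrite big_cons -{}e big_map /=.
transitivity (\sum_(k < n) (colmx n c i k * t.1 *+ (t.2 == k :> nat)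
    + colmx n c i k * \sum_(u <- s) u.1 *+ (u.2 == k :> nat))).
  by apply: eq_bigr => k _; rewrite big_cons mulrDr mulrnAr.
rewrite big_split /=; congr (_ + _).
rewrite (bigD1 (Ordinal t_lt)) //= eqxx big1 ?addr0 => [|k nk].
  by rewrite mxE mulr_suml; apply: eq_bigr => u _; rewrite mulrnAl.
by rewrite (_ : t.2 == k = false) //; apply: contraNF nk => /eqP e; apply/eqP/val_inj.
Qed.

Definition cols_left n c j := [seq (t.1, (t.2 * n + j %% n)%N) | t <- c (j %/ n)%N].
Definition cols_right n c j := [seq (t.1, (j %/ n * n + t.2)%N) | t <- c (j %% n)%N].

Lemma colmx_tensl m n c : colmx m c *t (1%:M : 'M[K]_n) = colmx (m * n) (cols_left n c).
Proof.
apply/matrixP=> i j; case: (mxtens_indexP i) => i1 i2; case: (mxtens_indexP j) => j1 j2.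
have n_gt0 : (0 < n)%N by exact: leq_ltn_trans (leq0n i2) (ltn_ord i2).
rewrite tensmxE !mxE /cols_left /= divnMDl // modnMDl modn_small // divn_small // addn0.
rewrite big_map mulr_suml; apply: eq_bigr => t _ /=.
rewrite mulr_natr -mulrnA mulnb; congr (_ *+ _); congr nat_of_bool.
apply/andP/eqP=> [[/eqP-> /eqP->]//|e].
have := congr1 (fun k => k %/ n)%N e; rewrite !divnMDl // !divn_small // !addn0 => ->.
have := congr1 (fun k => k %% n)%N e; rewrite !modnMDl // !modn_small // => /val_inj ->.
by split.
Qed.

Lemma colmx_tensr m n c : cols_below n c ->
  (1%:M : 'M[K]_m) *t colmx n c = colmx (m * n) (cols_right n c).
Proof.
move=> lt; apply/matrixP=> i j; case: (mxtens_indexP i) => i1 i2; case: (mxtens_indexP j) => j1 j2.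
have n_gt0 : (0 < n)%N by exact: leq_ltn_trans (leq0n i2) (ltn_ord i2).
rewrite tensmxE !mxE /cols_right /= divnMDl // modnMDl modn_small // divn_small // addn0.
rewrite big_map mulr_sumr !big_seq; apply: eq_bigr => t /(allP (lt j2 (ltn_ord j2))) t_lt /=.
rewrite mulr_natl -mulrnA mulnb; congr (_ *+ _); congr nat_of_bool.
apply/andP/eqP=> [[/eqP-> /eqP->]//|e].
have := congr1 (fun k => k %/ n)%N e; rewrite !divnMDl // !divn_small // !addn0 => /val_inj ->.
have := congr1 (fun k => k %% n)%N e; rewrite !modnMDl // !modn_small // => ->.
by split.
Qed.

(** Index arithmetic of tensor products with an identity matrix, with [half] and
    [odd] instead of division because these compute on numerals. *)
Definition left2 c j := [seq (t.1, (t.2.*2 + odd j)%N) | t <- c j./2].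
Definition right2 c j := [seq (t.1, (j./2.*2 + t.2)%N) | t <- c (odd j)].
Definition right4 c j :=
  [seq (t.1, (j./2./2.*2.*2 + t.2)%N) | t <- c ((odd j./2).*2 + odd j)%N].

Lemma eq_colmx n c c' :
  (forall i j, (i < n)%N -> (j < n)%N ->
     \sum_(t <- c j) t.1 *+ (t.2 == i :> nat) = \sum_(t <- c' j) t.1 *+ (t.2 == i :> nat)) ->
  colmx n c = colmx n c'.
Proof. by move=> e; apply/matrixP=> i j; rewrite !mxE e. Qed.

Lemma colmx_left2 m c : colmx m c *t (1%:M : 'M[K]_2) = colmx (m * 2) (left2 c).
Proof.
rewrite colmx_tensl; apply: eq_colmx => i j _ _; congr (\sum_(t <- _) _).
by rewrite /cols_left divn2 modn2; apply: eq_map => t; rewrite muln2.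
Qed.

Lemma colmx_right2 m c : cols_below 2 c ->
  (1%:M : 'M[K]_m) *t colmx 2 c = colmx (m * 2) (right2 c).
Proof.
move=> lt; rewrite colmx_tensr //; apply: eq_colmx => i j _ _; congr (\sum_(t <- _) _).
by rewrite /cols_right divn2 modn2; apply: eq_map => t; rewrite muln2.
Qed.

Lemma colmx_right4 m c : cols_below 4 c ->
  (1%:M : 'M[K]_m) *t colmx 4 c = colmx (m * 4) (right4 c).
Proof.
move=> lt; rewrite colmx_tensr //; apply: eq_colmx => i j _ _; congr (\sum_(t <- _) _).
have e : (j %% 4 = (odd j./2).*2 + odd j)%N.
  by rewrite -{1}(odd_double_half j) -{1}(odd_double_half j./2) doubleD -!muln2 -mulnA addnA addnC modnMDl modn_small addnC //; do 2!case: odd.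
rewrite /cols_right e; apply: eq_map => t; rewrite (divnMA j 2 2) !divn2.
by rewrite (mulnA _ 2 2) !muln2.
Qed.

Lemma left2_below n c : cols_below n c -> cols_below (n * 2) (left2 c).
Proof.
move=> lt j jn; rewrite all_map; apply/allP => t.
have jn' : (j./2 < n)%N by rewrite -divn2 ltn_divLR.
move/(allP (lt _ jn')) => /= tn.
by have := leq_b1 (odd j); lia.
Qed.

Lemma right2_below n c : cols_below 2 c -> cols_below (n * 2) (right2 c).
Proof.
move=> lt j jn; rewrite all_map; apply/allP => t.
have o2 : (odd j < 2)%N by case: odd.
move/(allP (lt _ o2)) => /= tn.
have jn' : (j./2 < n)%N by rewrite -divn2 ltn_divLR.
lia.
Qed.

Lemma right4_below n c : cols_below 4 c -> cols_below (n * 4) (right4 c).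
Proof.
move=> lt j jn; rewrite all_map; apply/allP => t.
have o2 : ((odd j./2).*2 + odd j < 4)%N by do 2!case: odd.
move/(allP (lt _ o2)) => /= tn.
have jn' : (j./2./2 < n)%N by rewrite -!divn2 -divnMA ltn_divLR.
lia.
Qed.

Lemma colmul_below n c c' : cols_below n c -> cols_below n c' -> cols_below n (colmul c c').
Proof.
move=> lt lt' j jn; apply/allP => _ /flattenP[_ /mapP[t tj ->] /mapP[u uj ->]] /=.
exact: (allP (lt _ (allP (lt' _ jn) _ tj)) _ uj).
Qed.

End SparseColumns.

Section Legs.
Context {R : realType}.
Local Notation C := R[i].
Implicit Types (c : nat -> seq (C * nat)).

Definition sgn n : C := if odd n then -1 else 1.

Lemma h_opE (i : 'I_2) : h_op i i = sgn i :> C.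
Proof. by rewrite mxE eqxx; case: i => [[|[|//]]] hi. Qed.

Lemma leg1_hE (j : 'I_(2 * 2)) : leg1 h_op j j = sgn j./2 :> C.
Proof. by rewrite mxE [X in _ * X]mxE eqxx mulr1 h_opE /= divn2. Qed.

Lemma leg2_hE (j : 'I_(2 * 2)) : leg2 h_op j j = sgn j :> C.
Proof. by rewrite mxE [X in X * _]mxE eqxx mul1r h_opE /sgn /= modn2 oddb. Qed.

Lemma h1_3E (j : 'I_(2 * 2 * 2)) : h1_3 j j = sgn j./2./2 :> C.
Proof. by rewrite mxE [X in _ * X]mxE eqxx mulr1 leg1_hE /= divn2. Qed.

Lemma h2_3E (j : 'I_(2 * 2 * 2)) : h2_3 j j = sgn j./2 :> C.
Proof. by rewrite mxE [X in _ * X]mxE eqxx mulr1 leg2_hE /= divn2. Qed.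

Lemma h3_3E (j : 'I_(2 * 2 * 2)) : h3_3 j j = sgn j :> C.
Proof.
rewrite mxE [X in X * _]mxE eqxx mul1r leg2_hE /sgn /=; congr (if _ then _ else _).
by rewrite {2}(divn_eq j 4) oddD oddM andbF.
Qed.

Lemma dyn_shift_colmx n (T : C -> 'M[C]_n) (cols : C -> nat -> seq (C * nat)) xi al
    (h : 'M[C]_n) (e : nat -> C) :
  (forall x, T x = colmx n (cols x)) -> (forall j, h j j = e j) ->
  dyn_shift T xi al h = colmx n (fun j => cols (xi + al * e j) j).
Proof. by move=> TE hE; apply/matrixP=> i j; rewrite !mxE TE hE mxE. Qed.

Definition flip_cols : nat -> seq (C * nat) :=
  nth [::] [:: [:: (1, 0%N)]; [:: (1, 2%N)]; [:: (1, 1%N)]; [:: (1, 3%N)]].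

Lemma flipE : flip = colmx (2 * 2) flip_cols :> 'M[C]_(2 * 2).
Proof.
apply/matrixP=> i j; rewrite !mxE.
case: (mxtens_indexP i) => i1 i2; case: (mxtens_indexP j) => j1 j2.
rewrite !mxtens_indexK /=.
by case: i1 i2 j1 j2 => [[|[|//]] ?] [[|[|//]] ?] [[|[|//]] ?] [[|[|//]] ?];
  rewrite /= big_cons big_nil addr0.
Qed.
End Legs.

(** * Matrix equations from entries *)

Section SixVertex.
Context {R : realType}.
Local Notation C := R[i].
Variables A B : C -> C -> C.
Implicit Types (c : nat -> seq (C * nat)).

Definition six_cols z x : nat -> seq (C * nat) :=
  nth [::] [:: [:: (1, 0%N)]; [:: (A z x, 1%N); (B z (- x), 2%N)];
               [:: (B z x, 1%N); (A z (- x), 2%N)]; [:: (1, 3%N)]].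

Lemma six_cols_below z x : cols_below 4 (six_cols z x).
Proof. by do 4?case. Qed.

Lemma flip_cols_below : cols_below 4 (@flip_cols R).
Proof. by do 4?case. Qed.

Variable Rm : C -> C -> 'M[C]_(2 * 2).
Hypothesis RmE : forall z x, Rm z x = colmx (2 * 2) (six_cols z x).

Lemma leg12_six z x : leg12_3 (Rm z x) = colmx (2 * 2 * 2) (left2 (six_cols z x)).
Proof. by rewrite RmE /leg12_3 colmx_left2. Qed.

Lemma leg23_six z x : leg23_3 (Rm z x) = colmx (2 * 2 * 2) (right4 (six_cols z x)).
Proof. by rewrite RmE /leg23_3 (@colmx_right4 _ 2) //; exact: six_cols_below. Qed.

Definition cols13 c :=
  colmul (right4 (@flip_cols R)) (colmul (left2 c) (right4 (@flip_cols R))).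

Lemma leg13_six z x : leg13_3 (Rm z x) = colmx (2 * 2 * 2) (cols13 (six_cols z x)).
Proof.
rewrite /leg13_3 leg12_six flipE /leg23_3 (@colmx_right4 _ 2); last exact: flip_cols_below.
rewrite -mulmxA !colmx_mul //.
  exact/colmul_below/(right4_below (n := 2))/flip_cols_below/(left2_below (n := 4))/six_cols_below.
exact/(right4_below (n := 2))/flip_cols_below.
Qed.

(** The entries of the equation that do not hold trivially, on the weight space with
    one v_-; the weight space with two of them has the same entries at - x. *)
Definition ybe_entries p a b x : Prop :=
  [/\ B b (x - p) * B (a + b) (- x) * A a (- (x - p)) + A b (- (x - p)) * B a (- (x - p))
        = B a (- x) * A (a + b) (- (x - p)),
      B (a + b) x = B a x * B b x + A a (- x) * B (a + b) (x - p) * A b x,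
      A (a + b) (- x) * B a (x - p) = B a x * A b (- x) + A a (- x) * B (a + b) (x - p) * B b (- x) &
      B b (x - p) * B (a + b) (- x) * B a (x - p) + A b (- (x - p)) * A a (x - p)
        = A a x * A b (- x) + B a (- x) * B (a + b) (x - p) * B b (- x)] /\
  [/\ A b (x - p) * B (a + b) (- x) * A a (- (x - p)) + B b (- (x - p)) * B a (- (x - p))
        = B (a + b) (- (x - p)),
      A b (x - p) * B (a + b) (- x) * B a (x - p) + B b (- (x - p)) * A a (x - p)
        = A (a + b) (x - p) * B b (- x) &
      B b (x - p) * A (a + b) x = A a x * B b x + B a (- x) * B (a + b) (x - p) * A b x].

Hypothesis A_cross : forall z z' x y, A z x * A z' y = A z' x * A z y.

(** The matrix products are evaluated symbolically, entry by entry; A_cross covers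
    the diagonal entries in which only A occurs. *)
Lemma dynamical_YBE_six p a b xi :
  ybe_entries p a b xi -> ybe_entries p a b (- xi) ->
  dyn_shift (fun x => leg12_3 (Rm a x)) xi (- p) h3_3
       *m leg13_3 (Rm (a + b) xi)
       *m dyn_shift (fun x => leg23_3 (Rm b x)) xi (- p) h1_3
  = leg23_3 (Rm b xi)
       *m dyn_shift (fun x => leg13_3 (Rm (a + b) x)) xi (- p) h2_3
       *m leg12_3 (Rm a xi).
Proof.
move=> ent ent'.
rewrite (dyn_shift_colmx _ _ (e := fun j => sgn j) (leg12_six a) h3_3E) (dyn_shift_colmx _ _ (e := fun j => sgn j./2./2) (leg23_six b) h1_3E).
rewrite (dyn_shift_colmx _ _ (e := fun j => sgn j./2) (leg13_six (a + b)) h2_3E) leg13_six leg23_six leg12_six.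
have l8 c : cols_below 4 c -> cols_below 8 (left2 c) by exact: (left2_below (n := 4)).
have r8 c : cols_below 4 c -> cols_below 8 (right4 c) by exact: (right4_below (n := 2)).
have m8 z x : cols_below 8 (cols13 (six_cols z x)).
  by apply: colmul_below; [|apply: colmul_below]; apply: r8 || apply: l8;
   apply: flip_cols_below || apply: six_cols_below.
rewrite -!mulmxA.
have l8' z x : cols_below 8 (left2 (six_cols z x)) by apply/l8/six_cols_below.
have r8' z x : cols_below 8 (right4 (six_cols z x)) by apply/r8/six_cols_below.
have s8 (e : nat -> C) z : cols_below 8 (fun j => right4 (six_cols z (e j)) j).
  by move=> j; exact: r8'.
have s8' (e : nat -> C) z : cols_below 8 (fun j => cols13 (six_cols z (e j)) j).
  by move=> j; exact: m8.
have S1 := s8 (fun j => xi + - p * sgn j./2./2) b.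
have S2 := s8' (fun j => xi + - p * sgn j./2) (a + b).
rewrite !colmx_mul; do ?[exact: m8 | exact: S1 | exact: S2 | exact: l8' | exact: r8' | apply: colmul_below].
apply: eq_colmx => i j i8 j8.
clear - ent ent' A_cross i8 j8.
case: ent ent' => [[e32 e13 e23 e22] [e31 e21 e12]] [[f32 f13 f23 f22] [f31 f21 f12]].
have e11 := A_cross b (a + b) (xi - p) xi.
have e33 := A_cross (a + b) a (- xi) (- (xi - p)).
have f11 := A_cross b (a + b) (- xi - p) (- xi).
have f33 := A_cross (a + b) a (- - xi) (- (- xi - p)).
move: e32 e13 e23 e22 e31 e21 e12 e11 e33 f32 f13 f23 f22 f31 f21 f12 f11 f33.
rewrite !(opprD, opprK) => e32 e13 e23 e22 e31 e21 e12 e11 e33 f32 f13 f23 f22 f31 f21 f12 f11 f33.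
case: j j8 => [|[|[|[|[|[|[|[|//]]]]]]]] _;
cbv [colmul left2 right4 cols13 six_cols flip_cols map flatten foldr cat nth fst snd addn addn_rec Nat.add double double_rec half uphalf odd nat_of_bool negb sgn];
rewrite ?(mulr1, mul1r, mulrN1, opprD, opprK) !big_cons !big_nil.
all: case: i i8 => [|[|[|[|[|[|[|[|//]]]]]]]] _ /=; rewrite ?(mulr0n, mulr1n, addr0, add0r).
all: try by [].
all: try (first [exact: e11|exact: e33|exact: f11|exact: f33]).
all: first [ by apply: (etrans _ (etrans e31 _)); ring | by apply: (etrans _ (etrans e21 _)); ring
| by apply: (etrans _ (etrans e12 _)); ring
| by apply: (etrans _ (etrans e22 _)); ring
| by apply: (etrans _ (etrans e32 _)); ring
| by apply: (etrans _ (etrans e13 _)); ring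
| by apply: (etrans _ (etrans e23 _)); ring
| by apply: (etrans _ (etrans f31 _)); ring | by apply: (etrans _ (etrans f21 _)); ring
| by apply: (etrans _ (etrans f12 _)); ring
| by apply: (etrans _ (etrans f22 _)); ring
| by apply: (etrans _ (etrans f32 _)); ring
| by apply: (etrans _ (etrans f13 _)); ring
| by apply: (etrans _ (etrans f23 _)); ring ].
Qed.
End SixVertex.

Section ReflectionMatrix.
Context {R : realType}.
Local Notation C := R[i].
Variables A B : C -> C -> C.
Variables u v : C -> C.
Hypothesis AE : forall z x, A z x = u z * v x.
Variable Rm : C -> C -> 'M[C]_(2 * 2).
Hypothesis RmE : forall z x, Rm z x = colmx (2 * 2) (six_cols A B z x).

Definition cols21 c := colmul (@flip_cols R) (colmul c (@flip_cols R)).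

Lemma leg21_six z x : leg21 (Rm z x) = colmx (2 * 2) (cols21 (six_cols A B z x)).
Proof.
have f4 := @flip_cols_below R; have c4 := six_cols_below A B z x.
by rewrite /leg21 RmE flipE -mulmxA !colmx_mul //; exact: colmul_below.
Qed.

Definition two_cols (al be : C -> C) x : nat -> seq (C * nat) :=
  nth [::] [:: [:: (al x, 0%N); (be (- x), 1%N)]; [:: (be x, 0%N); (al (- x), 1%N)]].

Lemma two_cols_below al be x : cols_below 2 (two_cols al be x).
Proof. by do 2?case. Qed.

Lemma leg1_two (K : C -> 'M[C]_2) al be : (forall x, K x = colmx 2 (two_cols al be x)) ->
  forall x, leg1 (K x) = colmx (2 * 2) (left2 (two_cols al be x)).
Proof. by move=> KE x; rewrite /leg1 KE colmx_left2. Qed.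

Lemma leg2_two (K : C -> 'M[C]_2) al be : (forall x, K x = colmx 2 (two_cols al be x)) ->
  forall x, leg2 (K x) = colmx (2 * 2) (right2 (two_cols al be x)).
Proof. by move=> KE x; rewrite /leg2 KE colmx_right2 //; exact: two_cols_below. Qed.

Lemma unitary_R_six z x :
  A z (- x) * A (- z) x + B z (- x) * B (- z) (- x) = 1 ->
  A z x * A (- z) (- x) + B z x * B (- z) x = 1 ->
  A z (- x) * B (- z) x + B z (- x) * A (- z) (- x) = 0 ->
  A z x * B (- z) (- x) + B z x * A (- z) x = 0 ->
  leg21 (Rm z x) *m Rm (- z) x = 1%:M.
Proof.
move=> u1 u2 o1 o2; rewrite leg21_six RmE colmx_mul; last exact: six_cols_below.
have -> : 1%:M = colmx 4 (fun j => [:: (1 : C, j)]).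
  by apply/matrixP=> i j; rewrite !mxE big_seq1 eq_sym.
apply: eq_colmx => i j i4 j4.
case: j j4 => [|[|[|[|//]]]] _;
cbv [colmul cols21 six_cols flip_cols map flatten foldr cat nth fst snd];
rewrite ?(mulr1, mul1r, mulrN1, opprK) !big_cons !big_nil.
all: case: i i4 => [|[|[|[|//]]]] _ /=; rewrite ?(mulr0n, mulr1n, addr0, add0r) //.
all: by [apply: (etrans _ u1); ring | apply: (etrans _ u2); ring
        | apply: (etrans _ o1); ring | apply: (etrans _ o2); ring].
Qed.

(** Here D1, D2 and g stand for the entries of the K-matrices up to scalars.  Since
    A z x = u z * v x, the last two relations are stated after division by v. *)
Definition re_entries k x e d (D1 D2 g : C -> C) : Prop :=
  let X := x + x in let y := x - k in let y' := x + k in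
  [/\ D1 y + B e (- X) * D2 (- y)
        = A d X * A e (- X) * D1 y' + B d (- X) * (D2 y + B e (- X) * D1 (- y)),
      u e * D2 y' = u d * (D2 y + B e (- X) * D1 (- y)) + B d X * u e * D1 y' &
      B e X * u d * (D2 y' * D1 y') + u e * B d (- X) * (D2 y' * D1 (- y))
        + u d * (g y' * g (- y'))
      = B e (- X) * u d * (D2 (- y) * D1 (- y)) + u e * B d X * (D2 (- y) * D1 y')
        + u d * (g y * g (- y))].

Variables (K1 K2 : C -> 'M[C]_2) (n1 n2 : C) (D1 D2 g : C -> C).
Hypothesis K1E : forall x, K1 x = colmx 2 (two_cols (fun t => n1 * D1 t) (fun t => n1 * g t) x).
Hypothesis K2E : forall x, K2 x = colmx 2 (two_cols (fun t => n2 * D2 t) (fun t => n2 * g t) x).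

(** Every term of the equation contains one entry of K1 and one of K2, so that the
    scalars n1 and n2 factor out and are absent from [re_entries]. *)
Lemma reflection_six k x e d :
  re_entries k x e d D1 D2 g -> re_entries k (- x) e d D1 D2 g ->
  leg21 (Rm d (x + x)) *m dyn_shift (fun x => leg1 (K1 x)) x (- k) (leg2 h_op)
    *m Rm e (x + x) *m dyn_shift (fun x => leg2 (K2 x)) x (- k) (leg1 h_op)
  = dyn_shift (fun x => leg2 (K2 x)) x (- k) (leg1 h_op) *m leg21 (Rm e (x + x))
    *m dyn_shift (fun x => leg1 (K1 x)) x (- k) (leg2 h_op) *m Rm d (x + x).
Proof.
move=> ent ent'.
rewrite (dyn_shift_colmx _ _ (e := fun j => sgn j) (leg1_two K1E) leg2_hE).
rewrite (dyn_shift_colmx _ _ (e := fun j => sgn j./2) (leg2_two K2E) leg1_hE).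
rewrite !leg21_six !RmE.
have c4 z y : cols_below 4 (six_cols A B z y) := six_cols_below A B z y.
have c4' z y : cols_below 4 (cols21 (six_cols A B z y)).
  by apply: colmul_below (@flip_cols_below R) (colmul_below _ (@flip_cols_below R)).
have k4 al be (e' : nat -> C) : cols_below 4 (fun j => left2 (two_cols al be (e' j)) j).
  by move=> j; apply: (left2_below (n := 2)); exact: two_cols_below.
have k4' al be (e' : nat -> C) : cols_below 4 (fun j => right2 (two_cols al be (e' j)) j).
  by move=> j; apply: (right2_below (n := 2)); exact: two_cols_below.
have S1 := k4 (fun t => n1 * D1 t) (fun t => n1 * g t) (fun j => x + - k * sgn j).
have S2 := k4' (fun t => n2 * D2 t) (fun t => n2 * g t) (fun j => x + - k * sgn j./2).
rewrite -!mulmxA !colmx_mul; do ?[exact: c4 | exact: c4' | exact: S1 | exact: S2 | apply: colmul_below].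
apply: eq_colmx => i j i4 j4.
clear - ent ent' AE i4 j4.
case: ent ent' => [L1 L2 Q] [L1' L2' Q'].
move: L1 L2 Q L1' L2' Q'; rewrite !AE !(opprD, opprK) => L1 L2 Q L1' L2' Q'.
case: j j4 => [|[|[|[|//]]]] _;
cbv [colmul left2 right2 cols21 six_cols two_cols flip_cols map flatten foldr cat nth fst snd addn addn_rec Nat.add double double_rec half uphalf odd nat_of_bool negb sgn];
rewrite ?(mulr1, mul1r, mulrN1, opprD, opprK) !big_cons !big_nil.
all: case: i i4 => [|[|[|[|//]]]] _ /=; rewrite ?(mulr0n, mulr1n, addr0, add0r).
all: rewrite ?AE; try by ring.
- by apply: (lincomb_eq (c := - n1 * n2 * g (- x + k)) L1); ring.
- by apply: (lincomb_eq (c := - v (x + x) * n1 * n2 * g (- x + k)) L2); ring.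
- by apply: (lincomb_eq (c := n1 * n2 * g (x - k)) L1); ring.
- by apply: (lincomb_eq (c := v (x + x) * n1 * n2) Q'); ring.
- by apply: (lincomb_eq (c := v (x + x) * n1 * n2 * g (- x - k)) L2'); ring.
- by apply: (lincomb_eq (c := v (- x - x) * n1 * n2 * g (x - k)) L2); ring.
- by apply: (lincomb_eq (c := v (- x - x) * n1 * n2) Q); ring.
- by apply: (lincomb_eq (c := n1 * n2 * g (- x - k)) L1'); ring.
- by apply: (lincomb_eq (c := - v (- x - x) * n1 * n2 * g (x + k)) L2'); ring.
- by apply: (lincomb_eq (c := - n1 * n2 * g (x + k)) L1'); ring.
Qed.
End ReflectionMatrix.

(** * Unconditional summation *)

Section UnconditionalSums.
Context {R : realType}.
Local Notation C := R[i].

Section OneIndex.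
Context {I : choiceType}.
Implicit Types (a b : I -> C) (F G : {fset I}).

(** Summation over finite subsets is used instead of ordered series because sums
    over Z and Z * Z have to be reindexed and split. *)
Definition has_sum a (s : C) := forall e : C, 0 < e ->
  exists F0 : {fset I}, forall F, (F0 `<=` F)%fset -> `|\sum_(i <- F) a i - s| <= e.

Definition abs_bounded a := exists M : R, forall F, \sum_(i <- F) `|a i| <= M%:C.

Lemma has_sum_unique a s t : has_sum a s -> has_sum a t -> s = t.
Proof.
move=> sa ta; apply/eqP; rewrite -subr_eq0 -normr_le0; apply/ler_addgt0Pr => e e0.
have e2 : 0 < e / 2 by rewrite divr_gt0.
have [F1 H1] := sa _ e2; have [F2 H2] := ta _ e2.
have := lerD (H1 (F1 `|` F2)%fset (fsubsetUl _ _)) (H2 (F1 `|` F2)%fset (fsubsetUr _ _)).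
rewrite -splitr add0r; apply: le_trans.
set A := \sum_(i <- _) _; have -> : s - t = (A - t) - (A - s) by rewrite opprB [RHS]addrC addrA subrK.
by apply: le_trans (ler_normB _ _) _; rewrite [leLHS]addrC.
Qed.

Lemma has_sumD a b s t : has_sum a s -> has_sum b t -> has_sum (fun i => a i + b i) (s + t).
Proof.
move=> sa tb e e0; have e2 : 0 < e / 2 by rewrite divr_gt0.
have [F1 H1] := sa _ e2; have [F2 H2] := tb _ e2.
exists (F1 `|` F2)%fset => F; rewrite fsubUset => /andP[/H1 h1 /H2 h2].
rewrite big_split /= (splitr e); apply: le_trans (lerD h1 h2).
by rewrite opprD addrACA ler_normD.
Qed.

Lemma has_sumZ (k : C) a s : has_sum a s -> has_sum (fun i => k * a i) (k * s).
Proof.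
move=> sa e e0; have k0 : 0 < `|k| + 1 by rewrite ltr_wpDl.
have [F0 H] := sa _ (divr_gt0 e0 k0); exists F0 => F /H {}H.
rewrite -mulr_sumr -mulrBr normrM; apply: le_trans (ler_wpM2l (normr_ge0 k) H) _.
by rewrite mulrCA ler_piMr ?(ltW e0) // ler_pdivrMr // mul1r lerDl.
Qed.

Lemma eq_has_sum a b s : a =1 b -> has_sum a s -> has_sum b s.
Proof. by move=> /funext ->. Qed.

Lemma sum_norm_subset a F G : (F `<=` G)%fset -> \sum_(i <- F) `|a i| <= \sum_(i <- G) `|a i|.
Proof.
move=> FG; rewrite (big_fsetID _ (mem F) G) /=.
have -> : [fset x in G | x \in F]%fset = F.
  by apply/fsetP => x; rewrite !inE /=; case: (boolP (x \in F)) => [/(fsubsetP FG) ->|]; rewrite ?andbF.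
by rewrite lerDl sumr_ge0.
Qed.

Lemma has_sum_nonneg (r : I -> R) : (forall i, 0 <= r i) -> abs_bounded (fun i => (r i)%:C) ->
  exists s, has_sum (fun i => (r i)%:C) s.
Proof.
move=> r0 [M HM].
have sumC F : \sum_(i <- F) `|(r i)%:C| = (\sum_(i <- F) r i)%:C.
  by rewrite rmorph_sum; apply: eq_bigr => i _; rewrite ger0_norm // lecR.
pose E := [set x : R | exists F : {fset I}, x = \sum_(i <- F) r i]%classic.
have E0 : (E !=set0)%classic by exists 0, fset0; rewrite big_seq_fset0.
have EM : ubound E M by move=> _ [F ->]; rewrite -lecR -sumC.
have supE : has_sup E by split=> //; exists M.
exists (sup E)%:C => e e0.
have [e' eE] : exists e', e = e'%:C by exists (complex.Re e); rewrite RRe_real ?gtr0_real.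
rewrite {}eE in e0 *; rewrite ltcR in e0.
have [_ [F0 ->] F0e] := sup_adherent e0 supE.
exists F0 => F F0F; rewrite -rmorph_sum -rmorphB.
have := sum_norm_subset (fun i => (r i)%:C) F0F; rewrite !sumC lecR => le.
have : \sum_(i <- F) r i <= sup E by apply: sup_upper_bound => //; exists F.
rewrite -subr_le0 => /ler0_norm le'.
have -> : `|(\sum_(i <- F) r i - sup E)%:C| = `|\sum_(i <- F) r i - sup E|%:C.
  by rewrite normc_def /= expr0n addr0 sqrtr_sqr.
rewrite lecR le'; lra.
Qed.

Lemma abs_bounded_le a b : (forall i, `|a i| <= `|b i|) -> abs_bounded b -> abs_bounded a.
Proof. by move=> le [M HM]; exists M => F; apply: le_trans (HM F); apply: ler_sum. Qed.

(** Real and imaginary parts are split into positive and negative parts, and a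
    bounded family of nonnegative reals has its supremum as sum. *)
Lemma has_sum_exists a : abs_bounded a -> exists s, has_sum a s.
Proof.
move=> ba.
have pos (p : C -> R) : (forall z, 0 <= p z) -> (forall z, (p z)%:C <= `|z|) ->
    exists s, has_sum (fun i => (p (a i))%:C) s.
  move=> p0 pl; apply: has_sum_nonneg => // ; apply: abs_bounded_le ba => i.
  by rewrite ger0_norm // lecR.
have Rel (z : C) : (`|complex.Re z|)%:C <= `|z| by rewrite normc_ge_Re.
have Iml (z : C) : (`|complex.Im z|)%:C <= `|z|.
  by rewrite normc_def lecR -sqrtr_sqr ler_wsqrtr // lerDr sqr_ge0.
have maxl (x : R) : Num.max x 0 <= `|x| by rewrite ge_max ler_norm normr_ge0.
have max0 (x : R) : 0 <= Num.max x 0 by rewrite le_max lexx orbT.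
have maxlN (x : R) : Num.max (- x) 0 <= `|x| by rewrite -normrN.
have tr (x y : R) (z : C) : x <= y -> y%:C <= `|z| -> x%:C <= `|z|.
  by rewrite -lecR; apply: le_trans.
have [s1 H1] := pos (fun z => Num.max (complex.Re z) 0) (fun z => max0 _)
  (fun z => tr _ _ _ (maxl _) (Rel z)).
have [s2 H2] := pos (fun z => Num.max (- complex.Re z) 0) (fun z => max0 _)
  (fun z => tr _ _ _ (maxlN _) (Rel z)).
have [s3 H3] := pos (fun z => Num.max (complex.Im z) 0) (fun z => max0 _)
  (fun z => tr _ _ _ (maxl _) (Iml z)).
have [s4 H4] := pos (fun z => Num.max (- complex.Im z) 0) (fun z => max0 _)
  (fun z => tr _ _ _ (maxlN _) (Iml z)).
exists ((s1 + -1 * s2) + 'i%C * (s3 + -1 * s4)).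
have := has_sumD (has_sumD H1 (has_sumZ (-1) H2)) (has_sumZ 'i%C (has_sumD H3 (has_sumZ (-1) H4))).
apply: eq_has_sum => i /=; rewrite !mulN1r -!rmorphB.
have split (x : R) : Num.max x 0 - Num.max (- x) 0 = x.
  have [x0|/ltW x0] := lerP 0 x.
    by rewrite ?(max_l x0) max_r ?oppr_le0 // subr0.
  by rewrite max_l ?oppr_ge0 // sub0r opprK.
by rewrite !split -complexE.
Qed.

Lemma abs_bounded_tail a : abs_bounded a -> forall e : C, 0 < e ->
  exists F0, forall F, (F `&` F0 = fset0)%fset -> \sum_(i <- F) `|a i| <= e.
Proof.
move=> ba e e0.
have [s H] : exists s, has_sum (fun i => `|a i|) s.
  apply: has_sum_exists; apply: abs_bounded_le ba => i; by rewrite normr_id.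
have e2 : 0 < e / 2 by rewrite divr_gt0.
have [F0 H0] := H _ e2; exists F0 => F dF.
have E : \sum_(i <- F) `|a i| = (\sum_(i <- (F `|` F0)%fset) `|a i| - s) - (\sum_(i <- F0) `|a i| - s).
  rewrite (big_fsetID _ (mem F) (F `|` F0)%fset) /=.
  have -> : [fset x in (F `|` F0)%fset | x \in F]%fset = F.
    by apply/fsetP => x; rewrite !inE /=; case: (x \in F); rewrite ?andbF.
  have -> : [fset x in (F `|` F0)%fset | x \notin F]%fset = F0.
    apply/fsetP => x; rewrite !inE /=; have /fsetP/(_ x) := dF; rewrite !inE.
    by case: (x \in F); case: (x \in F0).
  ring.
rewrite -[leLHS]ger0_norm ?sumr_ge0 // E [leRHS]splitr.
apply: le_trans (ler_normB _ _) _; apply: lerD; first exact: H0 (fsubsetUr _ _).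
exact: H0 (fsubset_refl _).
Qed.

End OneIndex.

Section Reindex.
Context {I J : choiceType}.

Lemma has_sum_reindex (g : J -> I) (h : I -> J) (a : I -> C) s :
  cancel g h -> cancel h g -> has_sum a s -> has_sum (a \o g) s.
Proof.
move=> gK hK sa e /sa[F0 H]; exists (h @` F0)%fset => F F0F.
have -> : \sum_(j <- F) (a \o g) j = \sum_(i <- (g @` F)%fset) a i.
  by rewrite big_imfset //= => x y _ _ /(can_inj gK).
apply: H; apply/fsubsetP => x xF0; apply/imfsetP; exists (h x) => //=.
by apply: (fsubsetP F0F); apply/imfsetP; exists x.
Qed.

Lemma has_sum_split (a : I -> C) (b : J -> C) s t :
  has_sum a s -> has_sum b t ->
  has_sum (fun x : I + J => match x with inl i => a i | inr j => b j end) (s + t).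
Proof.
move=> sa tb e e0; have e2 : 0 < e / 2 by rewrite divr_gt0.
have [F1 H1] := sa _ e2; have [F2 H2] := tb _ e2.
exists ((@inl I J) @` F1 `|` (@inr I J) @` F2)%fset => F; rewrite fsubUset => /andP[F1F F2F].
have [G1 mem1] : exists G1 : {fset I}, forall i, (i \in G1) = (inl i \in F).
  exists [fset x in pmap (fun y : I + J => if y is inl i then Some i else None) F]%fset => i.
  rewrite !inE /=; apply/idP/idP; rewrite mem_pmap.
    by move=> /mapP[[i'|//] xF [->]].
  by move=> xF; apply/mapP; exists (inl i).
have [G2 mem2] : exists G2 : {fset J}, forall i, (i \in G2) = (inr i \in F).
  exists [fset x in pmap (fun y : I + J => if y is inr j then Some j else None) F]%fset => i.
  rewrite !inE /=; apply/idP/idP; rewrite mem_pmap.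
    by move=> /mapP[[//|i'] xF [->]].
  by move=> xF; apply/mapP; exists (inr i).
rewrite (big_fsetID _ (fun x : I + J => if x is inl _ then true else false)) /=.
have -> : [fset x in F | if x is inl _ then true else false]%fset = ((@inl I J) @` G1)%fset.
  apply/fsetP => -[i|j]; rewrite !inE ?andbT ?andbF; apply/idP/imfsetP => //=.
  - by move=> xF; exists i; rewrite //= mem1.
  - by case=> x /=; rewrite mem1 => xF -[->].
  - by case.
have -> : [fset x in F | ~~ (if x is inl _ then true else false)]%fset = ((@inr I J) @` G2)%fset.
  apply/fsetP => -[i|j]; rewrite !inE ?andbT ?andbF; apply/idP/imfsetP => //=.
  - by case.
  - by move=> xF; exists j; rewrite //= mem2.
  - by case=> x /=; rewrite mem2 => xF -[->].
rewrite !big_imfset /=; try by move=> x y _ _ [].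
rewrite opprD addrACA [leRHS]splitr; apply: le_trans (ler_normD _ _) _; apply: lerD.
  apply: H1; apply/fsubsetP => i iF; rewrite mem1; apply: (fsubsetP F1F).
  by apply/imfsetP; exists i.
apply: H2; apply/fsubsetP => i iF; rewrite mem2; apply: (fsubsetP F2F).
by apply/imfsetP; exists i.
Qed.

Lemma sum_fsetX (A : {fset I}) (B : {fset J}) (f : I * J -> C) :
  \sum_(x <- (A `*` B)%fset) f x = \sum_(i <- A) \sum_(j <- B) f (i, j).
Proof. by rewrite big_imfset2 //= => -[? ?] [? ?] _ _ /= [-> ->]. Qed.

Lemma abs_bounded_inj (g : J -> I) (a : I -> C) :
  injective g -> abs_bounded a -> abs_bounded (a \o g).
Proof.
move=> gI [M HM]; exists M => F; apply: le_trans (HM (g @` F)%fset).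
by rewrite big_imfset //= => x y _ _ /gI.
Qed.

Lemma abs_bounded_prod (a : I -> C) (b : J -> C) :
  abs_bounded a -> abs_bounded b -> abs_bounded (fun x : I * J => a x.1 * b x.2).
Proof.
move=> [Ma Ba] [Mb Bb].
have sub (F : {fset I * J}) : (F `<=` [fset x.1 | x in F] `*` [fset x.2 | x in F])%fset.
  apply/fsubsetP => -[i j] xF; rewrite in_fsetM /=.
  by apply/andP; split; apply/imfsetP; exists (i, j).
exists (Ma * Mb) => F; apply: le_trans (sum_norm_subset _ (sub F)) _.
under eq_bigr do rewrite normrM.
rewrite sum_fsetX (eq_bigr (fun i => `|a i| * \sum_(j <- [fset x.2 | x in F]%fset) `|b j|)).
  by rewrite -mulr_suml rmorphM; apply: ler_pM => //; apply: sumr_ge0.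
by move=> i _; rewrite mulr_sumr.
Qed.

(** The double sum exists by absolute boundedness, and rectangles are cofinal among
    finite sets of pairs. *)
Lemma has_sum_prod (a : I -> C) (b : J -> C) s t :
  abs_bounded a -> abs_bounded b -> has_sum a s -> has_sum b t ->
  has_sum (fun x : I * J => a x.1 * b x.2) (s * t).
Proof.
move=> [Ma Ba] [Mb Bb] sa tb.
have rect A B : \sum_(x <- (A `*` B)%fset) a x.1 * b x.2 = (\sum_(i <- A) a i) * \sum_(j <- B) b j.
  by rewrite sum_fsetX mulr_suml; apply: eq_bigr => i _; rewrite mulr_sumr.
have sub (F : {fset I * J}) : (F `<=` [fset x.1 | x in F] `*` [fset x.2 | x in F])%fset.
  apply/fsubsetP => -[i j] xF; rewrite in_fsetM /=.
  by apply/andP; split; apply/imfsetP; exists (i, j).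
have [u su] := has_sum_exists (abs_bounded_prod (ex_intro _ Ma Ba) (ex_intro _ Mb Bb)).
suff -> : s * t = u by [].
apply/eqP; rewrite -subr_eq0 -normr_le0; apply/ler_addgt0Pr => e e0; rewrite add0r.
(* d <= 1 and d (|s| + |t| + 2) <= e bound the three error terms below. *)
pose d := e / (e + (`|s| + `|t| + 2)).
have K0 : 0 < `|s| + `|t| + 2 by rewrite ltr_wpDl ?addr_ge0.
have eK0 : 0 < e + (`|s| + `|t| + 2) by rewrite addr_gt0.
have d0 : 0 < d by rewrite divr_gt0.
have d1 : d <= 1 by rewrite ler_pdivrMr // mul1r lerDl ltW.
have dK : d * (`|s| + `|t| + 2) <= e.
  by rewrite mulrAC ler_pdivrMr // ler_wpM2l ?(ltW e0) // lerDr ltW.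
have [FA HA] := sa _ d0; have [FB HB] := tb _ d0; have [F0 H0] := su _ d0.
pose A := (FA `|` [fset x.1 | x in F0])%fset; pose B := (FB `|` [fset x.2 | x in F0])%fset.
have F0AB : (F0 `<=` A `*` B)%fset.
  apply: fsubset_trans (sub F0) _; apply/fsubsetP => -[i j].
  by rewrite !in_fsetM /= !inE => /andP[-> ->]; rewrite !orbT.
move: (HA _ (fsubsetUl _ _ : (FA `<=` A)%fset)) (HB _ (fsubsetUl _ _ : (FB `<=` B)%fset)) (H0 _ F0AB).
rewrite rect; set SA := \sum_(i <- A) _; set SB := \sum_(i <- B) _ => hA hB hu.
have -> : s * t - u = (SA * SB - u) - (SA - s) * SB - s * (SB - t) by ring.
apply: le_trans dK; rewrite (_ : d * _ = d + d * (`|t| + 1) + `|s| * d); last by ring.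
apply: le_trans (ler_normB _ _) _; apply: lerD; last by rewrite normrM ler_wpM2l.
apply: le_trans (ler_normB _ _) _; apply: lerD => //; rewrite normrM; apply: ler_pM => //.
rewrite -(subrK t SB) addrC; apply: le_trans (ler_normD _ _) _.
by apply: lerD => //; apply: le_trans hB d1.
Qed.
End Reindex.
End UnconditionalSums.

Section Tannery.
Context {R : realType} {I : choiceType}.
Local Notation C := R[i].
Implicit Types (t : I -> C) (F : {fset I}).

Lemma eventually_all (P : nat -> I -> Prop) (s : seq I) :
  (forall i, exists N0, forall N, (N0 <= N)%N -> P N i) ->
  exists N0, forall N, (N0 <= N)%N -> {in s, forall i, P N i}.
Proof.
move=> ev; elim: s => [|i s [N1 H1]]; first by exists 0%N.
have [N2 H2] := ev i; exists (maxn N1 N2) => N; rewrite geq_max => /andP[n1 n2] j.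
by rewrite inE => /orP[/eqP->|]; [exact: H2|exact: H1].
Qed.

(** Outside a finite set the terms contribute little, uniformly in N; on the finite
    set the coefficients converge. *)
Lemma tannery t s (c : nat -> I -> R) (c0 K : R) (FN : nat -> {fset I}) :
  abs_bounded t -> has_sum t s ->
  (forall N i, `|c N i| <= K) -> `|c0| <= K -> (forall i, c ^~ i @ \oo --> c0) ->
  (forall i, exists N0, forall N, (N0 <= N)%N -> i \in FN N) ->
  forall e : C, 0 < e -> exists N0, forall N, (N0 <= N)%N ->
    `|\sum_(i <- FN N) (c N i)%:C * t i - c0%:C * s| <= e.
Proof.
move=> bt st cK c0K cc FNi e; have [M HM] := bt.
have normR (x : R) : `|x%:C| = `|x|%:C by rewrite normc_def /= expr0n addr0 sqrtr_sqr.
move=> e0; have [e' eE] : exists e', e = e'%:C.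
  by exists (complex.Re e); rewrite RRe_real ?gtr0_real.
rewrite {}eE in e0 *; rewrite ltcR in e0.
have K0 : 0 <= K by apply: le_trans c0K.
have M0 : 0 <= M by have := HM fset0; rewrite big_seq_fset0 lecR.
pose k := e' / (4 * (K + 1)); pose m := e' / (4 * (M + 1)).
have k0 : 0 < k by rewrite divr_gt0 // mulr_gt0 // ltr_wpDl.
have m0 : 0 < m by rewrite divr_gt0 // mulr_gt0 // ltr_wpDl.
have four (x : R) : 0 <= x -> e' / 4 = e' / (4 * (x + 1)) * (x + 1).
  by move=> x0; rewrite invfM mulrA -mulrA mulVf ?mulr1 // gt_eqF // ltr_wpDl.
have kK : K * k <= e' / 4 by rewrite (four K) // mulrDr mulr1 mulrC lerDl ltW.
have mM : m * M <= e' / 4 by rewrite (four M) // mulrDr mulr1 lerDl ltW.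
have [F0 H0] := abs_bounded_tail bt (ltac:(by rewrite ltcR) : 0 < k%:C).
have [F1 H1] := st k%:C (ltac:(by rewrite ltcR)).
have [N1 HN1] := @eventually_all (fun N i => `|c N i - c0| <= m) F0 (fun i =>
  ltac:(by have /cvgrPdist_le/(_ _ m0)[N0 _ HN0] := cc i;
        exists N0 => N /HN0; rewrite distrC)).
have [N2 HN2] := @eventually_all (fun N i => i \in FN N) (F0 `|` F1)%fset FNi.
exists (maxn N1 N2) => N; rewrite geq_max => /andP[/HN1 {}HN1 /HN2 {}HN2].
have sub0 : (F0 `<=` FN N)%fset by apply/fsubsetP => i iF; apply: HN2; rewrite inE iF.
have sub1 : (F1 `<=` FN N)%fset by apply/fsubsetP => i iF; apply: HN2; rewrite inE iF orbT.
have -> : \sum_(i <- FN N) (c N i)%:C * t i - c0%:C * s =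
   \sum_(i <- FN N) (c N i - c0)%:C * t i + c0%:C * (\sum_(i <- FN N) t i - s).
  rewrite mulrBr mulr_sumr addrA; congr (_ - _); rewrite -big_split /=.
  by apply: eq_bigr => i _; rewrite rmorphB mulrBl subrK.
apply: le_trans (ler_normD _ _) _.
have -> : e' = (e' / 4 + (K * k + K * k) + K * k) + (e' - e' / 4 - K * k - K * k - K * k) by ring.
rewrite rmorphD; apply: ler_wpDr; first by rewrite lecR; lra.
rewrite [leRHS]rmorphD; apply: lerD; last first.
  rewrite normrM normR rmorphM; apply: ler_pM => //; [by rewrite lecR|by rewrite lecR|exact: (H1 _ sub1)].
rewrite [leRHS]rmorphD.
apply: le_trans (ler_norm_sum _ _ _) _.
rewrite (big_fsetID _ (mem F0) (FN N)) /=; apply: lerD.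
  have -> : [fset x in FN N | x \in F0]%fset = F0.
    by apply/fsetP => x; rewrite !inE /=; case: (boolP (x \in F0)) => [/(fsubsetP sub0) ->|]; rewrite ?andbF.
  apply: (@le_trans _ _ ((m * M)%:C)); last by rewrite lecR.
  rewrite rmorphM; apply: le_trans (ler_wpM2l _ (HM F0)); last by rewrite lecR ltW.
  rewrite mulr_sumr big_seq [leRHS]big_seq; apply: ler_sum => i iF.
  by rewrite normrM ler_wpM2r // normR lecR HN1.
set G := [fset x in FN N | x \notin F0]%fset.
have dG : (G `&` F0 = fset0)%fset.
  by apply/fsetP => x; rewrite !inE /=; case: (x \in F0); rewrite ?andbF.
apply: (@le_trans _ _ ((K + K)%:C * \sum_(i <- G) `|t i|)).
  rewrite mulr_sumr; apply: ler_sum => i _; rewrite normrM ler_wpM2r // normR lecR.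
  by apply: le_trans (ler_normB _ _) _; apply: lerD.
rewrite -mulrDl rmorphM; apply: ler_wpM2l; last exact: H0.
by rewrite lecR addr_ge0.
Qed.
End Tannery.

(** * Jacobi's triple product *)

Section QBinomial.
Context {F : fieldType} (Q : F).
Definition qfac n := \prod_(j < n) (1 - Q ^+ j.+1).
(** The Gaussian binomial coefficient, extended by zero. *)
Definition gbin M i :=
  if (i <= M)%N then qfac M / (qfac i * qfac (M - i)) else 0.
Hypothesis Q_nz : forall n, 1 - Q ^+ n.+1 != 0.

Lemma qfac_neq0 n : qfac n != 0.
Proof. by apply/prodf_neq0 => j _. Qed.

Lemma qfacS n : qfac n.+1 = qfac n * (1 - Q ^+ n.+1).
Proof. by rewrite /qfac big_ord_recr. Qed.

Lemma gbin0 M : gbin M 0 = 1.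
Proof. by rewrite /gbin subn0 {2}/qfac big_ord0 mul1r divff // qfac_neq0. Qed.

Lemma gbin_pascal M i : (i <= M)%N ->
  gbin M.+1 i.+1 = gbin M i.+1 + Q ^+ (M - i) * gbin M i.
Proof.
move=> iM; rewrite /gbin ltnS iM; case: ltnP => [{}iM|Mi]; last first.
  have -> : i = M by apply/eqP; rewrite eqn_leq iM.
  have q0 : qfac 0 = 1 by rewrite /qfac big_ord0.
  rewrite !subnn q0 expr0 !mulr1 mul1r add0r.
  by rewrite !divff ?qfac_neq0.
rewrite subSS; have e1 : (M - i = (M - i.+1).+1)%N by lia.
have -> : Q ^+ (M - i) = Q ^+ (M - i.+1).+1 by rewrite -e1.
rewrite e1 !qfacS.
have -> : Q ^+ M.+1 = Q ^+ (M - i.+1).+1 * Q ^+ i.+1 by rewrite -exprD; congr (_ ^+ _); lia.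
have := Q_nz i; have := Q_nz (M - i.+1); have := qfac_neq0 i; have := qfac_neq0 (M - i.+1).
move: (qfac M) (qfac i) (qfac (M - i.+1)) (Q ^+ i.+1) (Q ^+ (M - i.+1).+1) => a b c d e *.
by field; repeat (apply/andP; split).
Qed.

(** The q-binomial theorem; recentring an even number of factors turns it into the
    finite form of the triple product. *)
Lemma q_binomial M y :
  \prod_(j < M) (1 - Q ^+ j * y)
  = \sum_(i < M.+1) (-1) ^+ i * Q ^+ 'C(i, 2) * gbin M i * y ^+ i.
Proof.
elim: M => [|M IH]; first by rewrite big_ord0 big_ord1 gbin0 !mulr1.
rewrite big_ord_recr /= IH mulrBr mulr1.
pose a i := (-1) ^+ i * Q ^+ 'C(i, 2) * y ^+ i.
have aS i : (i <= M)%N -> a i.+1 * Q ^+ (M - i) = - (Q ^+ M * y) * a i.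
  move=> iM; have -> : Q ^+ M = Q ^+ i * Q ^+ (M - i) by rewrite -exprD subnKC.
  by rewrite /a binS bin1 exprD !exprS; ring.
transitivity (\sum_(i < M.+2) a i * gbin M i + \sum_(i < M.+1) a i.+1 * (Q ^+ (M - i) * gbin M i)).
  have gz : gbin M M.+1 = 0 by rewrite /gbin ltnn.
  rewrite [X in _ = X + _]big_ord_recr /= gz mulr0 addr0; congr (_ + _).
    by apply: eq_bigr => i _; rewrite /a; ring.
  rewrite mulr_suml -sumrN; apply: eq_bigr => i _.
  transitivity (a i.+1 * Q ^+ (M - i) * gbin M i); last by rewrite mulrA.
  by rewrite aS ?leq_ord // /a; ring.
rewrite big_ord_recl -addrA -big_split /= [RHS]big_ord_recl !gbin0 /a /=; congr (_ + _).
apply: eq_bigr => i _; rewrite /bump leq0n add1n gbin_pascal ?leq_ord //; ring.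
Qed.
End QBinomial.

Definition tri (n : int) : int := (n * (n - 1) %/ 2)%Z.

Lemma triE n : tri n * 2 = n * (n - 1).
Proof.
rewrite /tri divzK //; apply/dvdzP.
have [e|e] : n = (n %/ 2)%Z * 2 \/ n = (n %/ 2)%Z * 2 + 1 by lia.
  by exists ((n %/ 2)%Z * (n - 1)); rewrite {1}e; ring.
by exists ((n %/ 2)%Z * n); rewrite {2}e; ring.
Qed.

Lemma triP n : tri (Posz n) = 'C(n, 2).
Proof. by have := triE n; have := bin2 n; have := mul_bin_diag n 1; rewrite bin1; nia. Qed.

Lemma triN n : tri (Negz n) = 'C(n.+2, 2).
Proof. by have := triE (Negz n); have := mul_bin_diag n.+2 1; rewrite bin1; nia. Qed.

Section ThetaSeries.
Context {R : realType} (q : R).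
Hypothesis hq : 0 < q < 1.
Local Notation C := R[i].
Local Notation Q := (q%:C).

Let q0 : 0 < q. Proof. by case/andP: hq. Qed.
Let q1 : q < 1. Proof. by case/andP: hq. Qed.
Let Q0 : Q != 0. Proof. by rewrite -(rmorph0 (real_complex R)) (inj_eq (fmorph_inj _)) gt_eqF. Qed.

(** The ratio of consecutive terms is q^n rho, eventually at most 1. *)
Lemma superexponential (rho : R) : 0 <= rho ->
  exists M : R, forall n, q ^+ 'C(n, 2) * rho ^+ n <= M.
Proof.
move=> r0; pose u n := q ^+ 'C(n, 2) * rho ^+ n.
have u0 n : 0 <= u n by rewrite mulr_ge0 // exprn_ge0 // ltW.
have uS n : u n.+1 = u n * (q ^+ n * rho) by rewrite /u binS bin1 exprD exprS; ring.
have [m Hm] : exists m, forall n, (m <= n)%N -> q ^+ n * rho <= 1.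
  have : (fun n => q ^+ n * rho) @ \oo --> 0 * rho.
    by apply: cvgMl; apply: cvg_expr; rewrite gtr0_norm.
  rewrite mul0r => /cvgrPdist_le/(_ _ ltr01)[m _ H]; exists m => n /H /=.
  by rewrite sub0r normrN; apply: le_trans; apply: ler_norm.
exists (\sum_(k < m.+1) u k) => n; rewrite -/(u n).
have le_sum k : (k <= m)%N -> u k <= \sum_(k < m.+1) u k.
  move=> km; rewrite (bigD1 (Ordinal (km : (k < m.+1)%N))) //= lerDl.
  by apply: sumr_ge0 => i _; apply: u0.
have [nm|/ltnW mn] := leqP n m; first exact: le_sum.
rewrite -(subnK mn); elim: (n - m)%N => [|k IH]; first exact: le_sum.
by rewrite addSn uS; apply: le_trans IH; rewrite ler_piMr // Hm // leq_addl.
Qed.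

Lemma sum_sub_seq (T : eqType) (f : T -> C) (s t : seq T) : (forall x, 0 <= f x) ->
  uniq s -> {subset s <= t} -> \sum_(x <- s) f x <= \sum_(x <- t) f x.
Proof.
move=> f0; elim: s t => [|x s IH] t /=; first by move=> _ _; rewrite big_nil sumr_ge0.
case/andP=> xs us sub; rewrite big_cons.
have xt : x \in t by apply: sub; rewrite inE eqxx.
rewrite (perm_big _ (perm_to_rem xt)) big_cons lerD2l; apply: IH => // y ys.
have : y \in t by apply: sub; rewrite inE ys orbT.
rewrite (perm_mem (perm_to_rem xt)) inE => /orP[/eqP yx|//].
by rewrite -yx ys in xs.
Qed.

Lemma geometric_half n : \sum_(k < n) 2^-1 ^+ k <= 2 :> R.
Proof.
suff -> : \sum_(k < n) 2^-1 ^+ k = 2 - 2 * 2^-1 ^+ n :> R.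
  by rewrite gerBl mulr_ge0 // exprn_ge0 // invr_ge0.
elim: n => [|n IH]; first by rewrite big_ord0 expr0; ring.
by rewrite big_ord_recr /= IH exprS; field.
Qed.

Lemma abs_bounded_nat (a : nat -> C) (M : R) :
  (forall n, `|a n| <= (M * 2^-1 ^+ n)%:C) -> abs_bounded a.
Proof.
move=> aM; exists (M * 2) => F.
have M0 : 0 <= M by have := le_trans (normr_ge0 _) (aM 0%N); rewrite expr0 mulr1 lecR.
pose N := (\max_(n <- F) n).+1.
apply: le_trans (sum_sub_seq (t := iota 0 N) (fun x => normr_ge0 (a x)) (fset_uniq F) _) _.
  by move=> n nF; rewrite mem_iota /= /N ltnS; apply: leq_bigmax_seq.
rewrite -[iota 0 N]/(index_iota 0 N) big_mkord.
apply: (@le_trans _ _ (\sum_(k < N) (M * 2^-1 ^+ k)%:C)); first by apply: ler_sum.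
by rewrite -rmorph_sum lecR -mulr_sumr ler_wpM2l // geometric_half.
Qed.

Lemma abs_bounded_int (a : int -> C) :
  abs_bounded (a \o Posz) -> abs_bounded (a \o Negz) -> abs_bounded a.
Proof.
move=> [M HM] [M' HM']; exists (M + M') => F.
rewrite (big_fsetID _ (fun n : int => 0 <= n)) rmorphD /=; apply: lerD.
- apply: le_trans (HM ([fset absz n | n in F]%fset)).
  apply: le_trans (sum_sub_seq (t := [seq Posz n | n <- [fset absz n | n in F]%fset]) (fun x => normr_ge0 (a x)) (fset_uniq _) _) _.
    move=> n; rewrite !inE /= => /andP[nF n0]; apply/mapP; exists (absz n); last by rewrite gez0_abs.
    by apply/imfsetP; exists n.
  by rewrite big_map.
- apply: le_trans (HM' ([fset (absz n).-1 | n in F]%fset)).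
  apply: le_trans (sum_sub_seq (t := [seq Negz n | n <- [fset (absz n).-1 | n in F]%fset]) (fun x => normr_ge0 (a x)) (fset_uniq _) _) _.
    move=> n; rewrite !inE /= => /andP[nF n0]; apply/mapP; exists (absz n).-1; last by lia.
    by apply/imfsetP; exists n.
  by rewrite big_map.
Qed.

Definition theta_term (x : C) (n : int) : C := (-1) ^ n * Q ^ tri n * x ^ n.

Lemma norm_realC (x : R) : `|x%:C| = `|x|%:C.
Proof. by rewrite normc_def /= expr0n addr0 sqrtr_sqr. Qed.

Lemma abs_bounded_theta x : x != 0 -> abs_bounded (theta_term x).
Proof.
move=> x0; have [r r0 xr] : exists2 r : R, 0 < r & `|x| = r%:C.
  by exists (Normc.normc x) => //; rewrite -ltcR -[X in _ < X]/( `|x| ) normr_gt0.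
apply: abs_bounded_int.
(* The factor 2 leaves room for a geometric majorant. *)
- have [M HM] := superexponential (ltac:(by rewrite mulr_ge0 // ltW) : 0 <= 2 * r).
  apply: (@abs_bounded_nat _ M) => n; rewrite /theta_term /= triP -!exprnP.
  rewrite !normrM !normrX normrN1 expr1n mul1r norm_realC (gtr0_norm q0) xr.
  rewrite -!rmorphXn -rmorphM lecR -ler_pdivrMr ?exprn_gt0 // exprVn invrK.
  by rewrite -mulrA -exprMn [r * 2]mulrC.
- have [M HM] := superexponential (ltac:(by rewrite mulr_ge0 // divr_ge0 // ltW) : 0 <= 2 * (q / r)).
  apply: (@abs_bounded_nat _ M) => n; rewrite /theta_term /= triN !NegzE -exprnP -!exprnN.
  rewrite !normrM !normfV !normrX normrN1 expr1n invr1 mul1r norm_realC (gtr0_norm q0) xr.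
  rewrite -!rmorphXn -fmorphV -rmorphM lecR -ler_pdivrMr ?exprn_gt0 // exprVn invrK.
  apply: le_trans (HM n.+1).
  have -> : q ^+ 'C(n.+1, 2) * (2 * (q / r)) ^+ n.+1 = q ^+ 'C(n.+2, 2) * (r ^+ n.+1)^-1 * 2 ^+ n * 2.
    by rewrite (binS n.+1) bin1 exprD !exprMn exprVn [2 ^+ n.+1]exprSr; ring.
  by rewrite ler_peMr ?ler1n // !mulr_ge0 ?invr_ge0 ?exprn_ge0 // ltW.
Qed.

Definition theta_partial N (x : C) : C :=
  \prod_(0 <= j < N) ((1 - (q ^+ j)%:C * x) * (1 - (q ^+ j.+1)%:C / x)).

(** The coefficient of the n-th theta term in the N-th partial product; it converges
    to the inverse of (q; q)_oo for each fixed n. *)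
Definition theta_coef N (n : int) : R :=
  if (absz n <= N)%N then gbin q (2 * N) (absz (n + Posz N)) else 0.

Definition window N : {fset int} := [fset Posz (nat_of_ord i) - Posz N | i in 'I_(2 * N).+1]%fset.

Lemma Q_nz n : 1 - Q ^+ n.+1 != 0.
Proof.
rewrite -rmorphXn -(rmorph1 (real_complex R)) -rmorphB fmorph_eq0 subr_eq0 eq_sym.
by rewrite lt_eqF // exprn_ilt1 // ltW.
Qed.

Lemma gbin_rmorph M i : (gbin q M i)%:C = gbin Q M i.
Proof.
have qf n : (qfac q n)%:C = qfac Q n.
  by rewrite /qfac rmorph_prod; apply: eq_bigr => j _; rewrite rmorphB rmorphXn.
by rewrite /gbin; case: ifP => // _; rewrite -!qf -rmorphM -fmorph_div.
Qed.

(** Multiplied by P N, the partial product becomes the product of 2 N consecutive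
    factors 1 - q^j y with y = x / q^N, to which the q-binomial theorem applies. *)
Lemma theta_partial_expansion N x : x != 0 ->
  theta_partial N x = \sum_(n <- window N) (theta_coef N n)%:C * theta_term x n.
Proof.
move=> x0.
have QN n : Q ^+ n != 0 by rewrite expf_neq0.
(* P N turns the factors 1 - q^(j+1) / x into 1 - x / q^(j+1). *)
pose P M := \prod_(j < M) (- (x / Q ^+ j.+1)).
have PE M : P M = (-1) ^+ M * x ^+ M / Q ^+ 'C(M.+1, 2).
  rewrite /P; elim: M => [|M IH]; first by rewrite big_ord0 !expr0; field.
  rewrite big_ord_recr /= IH (binS M.+1) bin1 exprD !exprS.
  by field; rewrite ?Q0 ?QN.
have P0 M : P M != 0.
  rewrite PE; apply: mulf_neq0; last by rewrite invr_eq0.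
  by apply: mulf_neq0; apply: expf_neq0; rewrite ?oppr_eq0 ?oner_neq0.
have key : P N * theta_partial N x = \prod_(j < N + N) (1 - Q ^+ j * (x / Q ^+ N)).
  rewrite big_split_ord /= /theta_partial big_split /= !big_mkord mulrCA; rewrite mulrC.
  congr (_ * _); last first.
    by apply: eq_bigr => j _; rewrite exprD rmorphXn; field; rewrite expf_neq0.
  rewrite [RHS](reindex_inj rev_ord_inj) /= /P -big_split /=; apply: eq_bigr => j _.
  have -> : Q ^+ N = Q ^+ (N - j.+1) * Q ^+ j.+1 by rewrite -exprD subnK.
  by rewrite rmorphXn; field; rewrite x0 !QN.
apply: (mulfI (P0 N)); rewrite key (q_binomial Q_nz).
rewrite /window big_imfset /=; last by move=> i j _ _ /addIr[] /val_inj.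
rewrite big_enum /= addnn -mul2n mulr_sumr.
apply: eq_bigr => i _.
have iN : (i <= 2 * N)%N := leq_ord i.
have -> : theta_coef N (Posz i - Posz N) = gbin q (2 * N) i.
  by rewrite /theta_coef subrK ifT //; lia.
rewrite gbin_rmorph PE /theta_term expr_div_n -exprM.
have eN : (-1) ^+ i = (-1) ^+ N * (-1) ^ (Posz i - Posz N) :> C.
  by rewrite !exprnP -expfzDr ?oppr_eq0 ?oner_eq0 // addrC subrK.
have ex : x ^+ i = x ^+ N * x ^ (Posz i - Posz N).
  by rewrite !exprnP -expfzDr // addrC subrK.
have eQ : Q ^+ 'C(i, 2) * Q ^+ 'C(N.+1, 2) = Q ^ tri (Posz i - Posz N) * Q ^+ (N * i).
  rewrite !exprnP -!triP -!expfzDr //; congr (_ ^ _); apply: (@mulIf _ 2) => //.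
  by rewrite !mulrDl !triE PoszM intS; ring.
have [eQ'] : Q ^+ 'C(i, 2) = Q ^ tri (Posz i - Posz N) * Q ^+ (N * i) / Q ^+ 'C(N.+1, 2).
  by rewrite -eQ mulfK.
by rewrite eN ex eQ'; field; rewrite ?QN.
Qed.

Lemma qfac_pos n : 0 < qfac q n.
Proof. by apply: prodr_gt0 => j _; rewrite subr_gt0 exprn_ilt1 // ltW. Qed.

Lemma geometric_bound n : (\sum_(j < n) q ^+ j) * (1 - q) <= 1.
Proof.
have -> : (\sum_(j < n) q ^+ j) * (1 - q) = 1 - q ^+ n.
  by elim: n => [|n IH]; rewrite ?big_ord0 ?big_ord_recr ?mulrDl ?IH ?exprS ?expr0; ring.
by rewrite gerBl exprn_ge0 // ltW.
Qed.

(** After finitely many factors, which are nonzero, the remaining ones have product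
    at least 1 - a (1 + q + q^2 + ..) with a small. *)
Lemma prod_lower_bound (rho : R) : 0 <= rho -> (forall j, q ^+ j * rho != 1) ->
  exists2 d : R, 0 < d & exists N0, forall N, (N0 <= N)%N ->
    d <= \prod_(j < N) `|1 - q ^+ j * rho|.
Proof.
move=> r0 rho_nz.
have q1_gt0 : 0 < (1 - q) / 2 by rewrite divr_gt0 // subr_gt0.
have [m Hm] : exists m, q ^+ m * rho <= (1 - q) / 2.
  have : (fun n => q ^+ n * rho) @ \oo --> 0 * rho.
    by apply: cvgMl; apply: cvg_expr; rewrite gtr0_norm.
  rewrite mul0r => /cvgrPdist_le/(_ _ q1_gt0)[m _ H]; exists m.
  have /= := H m (leqnn _); rewrite sub0r normrN; apply: le_trans; exact: ler_norm.
have a0 : 0 <= q ^+ m * rho by rewrite mulr_ge0 // exprn_ge0 // ltW.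
set a := q ^+ m * rho in Hm a0.
have small n : a * \sum_(j < n) q ^+ j <= 2^-1.
  have S0 : 0 <= \sum_(j < n) q ^+ j by apply: sumr_ge0 => j _; rewrite exprn_ge0 // ltW.
  have := geometric_bound n; have := ler_wpM2r S0 Hm; move: (\sum_(j < n) q ^+ j) => s; lra.
have tail n : 1 - a * \sum_(j < n) q ^+ j <= \prod_(j < n) `|1 - a * q ^+ j|.
  elim: n => [|n IH]; first by rewrite !big_ord0 mulr0 subr0.
  rewrite !big_ord_recr /= mulrDr.
  have := small n; have := small n.+1; rewrite big_ord_recr /= mulrDr.
  have b0 : 0 <= a * q ^+ n by rewrite mulr_ge0 // exprn_ge0 // ltW.
  have s0 : 0 <= a * \sum_(j < n) q ^+ j.
    by rewrite mulr_ge0 // sumr_ge0 // => j _; rewrite exprn_ge0 // ltW.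
  move: IH b0 s0; move: (a * \sum_(j < n) q ^+ j) (a * q ^+ n) => s b IH b0 s0 h1 h2.
  rewrite [X in _ * X]ger0_norm; last by lra.
  have b1 : 0 <= 1 - b by lra.
  by apply: le_trans (ler_wpM2r b1 IH); nra.
exists (2^-1 * \prod_(j < m) `|1 - q ^+ j * rho|).
  rewrite mulr_gt0 ?invr_gt0 // prodr_gt0 // => j _.
  by rewrite normr_gt0 subr_eq0 eq_sym.
exists m => N /subnKC <-; rewrite big_split_ord /= mulrC ler_wpM2l ?prodr_ge0 //.
have e j : `|1 - q ^+ (m + j) * rho| = `|1 - a * q ^+ j| by rewrite /a exprD mulrAC.
rewrite (eq_bigr _ (fun (j : 'I_(N - m)) _ => e j)); apply: le_trans (tail _).
by have := small (N - m)%N; lra.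
Qed.

(** Jacobi's triple product, together with convergence of the product defining
    theta1; L is the limit of (1 - q) .. (1 - q^n). *)
Lemma theta_limit : exists2 L : R, 0 < L & forall x : C, x != 0 ->
  (theta_partial ^~ x @ \oo --> theta1 q x) /\ has_sum (theta_term x) (L%:C * theta1 q x).
Proof.
have qfS n : qfac q n.+1 = qfac q n * (1 - q ^+ n.+1) by exact: qfacS.
have dec : {homo qfac q : n m / (n <= m)%N >-> m <= n}.
  apply/nonincreasing_seqP => n; rewrite qfS; apply: ler_piMr; first exact/ltW/qfac_pos.
  by rewrite gerBl exprn_ge0 // ltW.
have q1' j : q ^+ j * q != 1 by rewrite -exprSr lt_eqF // exprn_ilt1 // ltW.
have [d d0 [N0 HN0]] := prod_lower_bound (ltW q0) q1'.
have dq n : d <= qfac q n.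
  apply: (@le_trans _ _ (qfac q (maxn N0 n))); last by apply: dec; rewrite leq_maxr.
  apply: le_trans (HN0 _ (leq_maxl _ _)) _; rewrite le_eqVlt; apply/orP; left; apply/eqP.
  apply: eq_bigr => j _; rewrite -exprSr ger0_norm // subr_ge0 exprn_ile1 // ltW //.
have qcv : qfac q @ \oo --> limn (qfac q).
  by apply: nonincreasing_is_cvgn => //; exists d => _ [n _ <-].
set L := limn (qfac q) in qcv.
have L0 : 0 < L by apply: lt_le_trans d0 _; apply: limr_ge => //; apply: nearW.
exists L => // x x0.
have qle1 n : qfac q n <= 1.
  by have := dec 0%N n (leq0n _); rewrite {2}/qfac big_ord0.
have window_mem (n : int) : exists N0, forall N, (N0 <= N)%N -> n \in window N.
  exists (absz n) => N nN; apply/imfsetP.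
  have lt : (absz (n + Posz N)%R < (2 * N).+1)%N by lia.
  by exists (Ordinal lt) => //=; rewrite gez0_abs ?addrK //; lia.
have coef_bound N n : `|theta_coef N n| <= (d * d)^-1.
  rewrite /theta_coef; case: ifP => _; last by rewrite normr0 invr_ge0 mulr_ge0 ?ltW.
  rewrite /gbin; case: ifP => _; last by rewrite normr0 invr_ge0 mulr_ge0 ?ltW.
  rewrite ger0_norm; last by apply: divr_ge0; [|apply: mulr_ge0]; exact/ltW/qfac_pos.
  rewrite ler_pdivrMr ?mulr_gt0 ?qfac_pos //; apply: le_trans (qle1 _) _.
  by rewrite ler_pdivlMl ?mulr_gt0 // mulr1; apply: ler_pM => //; exact: ltW.
have q_sub (f : nat -> nat) (k : nat) : (forall N, (N <= f N + k)%N) -> (qfac q \o f) @ \oo --> L.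
  move=> fN; apply: cvg_comp qcv; apply/cvgnyPge => A; exists (A + k)%N => // N /=.
  by move=> AN; rewrite -(leq_add2r k); apply: leq_trans AN (fN N).
have coef_cvg n : theta_coef ^~ n @ \oo --> L^-1.
  have -> : L^-1 = L / (L * L) by field; rewrite gt_eqF.
  have cv : (fun N => qfac q (2 * N)%N / (qfac q (absz (n + Posz N)) * qfac q (2 * N - absz (n + Posz N)%R)%N)) @ \oo
      --> L / (L * L).
    apply: cvgM; first by apply: (q_sub _ 0%N) => N; lia.
    apply: cvgV; first by rewrite mulf_neq0 ?gt_eqF.
    by apply: cvgM; apply: (q_sub _ (absz n)) => N; lia.
  apply: cvg_trans cv; apply: near_eq_cvg; exists (absz n) => // N /= nN.
  by rewrite /theta_coef nN /gbin ifT //; lia.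
have [s sE] := has_sum_exists (abs_bounded_theta x0).
have LV : `|L^-1| <= (d * d)^-1.
  rewrite ger0_norm; last by rewrite invr_ge0 ltW.
  rewrite lef_pV2 ?posrE ?mulr_gt0 //.
  have dL : d <= L by apply: limr_ge => //; apply: nearW.
  have L1 : L <= 1 by apply: limr_le => //; apply: nearW.
  apply: (le_trans _ dL); apply: ler_piMr; [exact: ltW|exact: (le_trans dL L1)].
have cv : theta_partial ^~ x @ \oo --> L^-1%:C * s.
  apply/cvgrPdist_le => e e0.
  have [N0' H] := tannery (abs_bounded_theta x0) sE coef_bound LV coef_cvg window_mem e0.
  by exists N0' => // N /= /H; rewrite -theta_partial_expansion // distrC.
have lim_eq : theta1 q x = L^-1%:C * s by apply: cvg_lim cv.
split; first by rewrite lim_eq.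
by rewrite lim_eq mulrA -rmorphM mulfV ?gt_eqF // mul1r.
Qed.
End ThetaSeries.

(** * Theta function identities *)

Section ThetaIdentities.
Context {R : realType} (q : R).
Hypothesis hq : 0 < q < 1.
Local Notation C := R[i].
Local Notation Q := (q%:C).
Local Notation qp := (qpow q).

Let q0 : 0 < q. Proof. by case/andP: hq. Qed.
Let Q0 : Q != 0. Proof. by rewrite -(rmorph0 (real_complex R)) (inj_eq (fmorph_inj _)) gt_eqF. Qed.

(** The absolute value of the partial products is bounded below by two products to
    which [prod_lower_bound] applies. *)
Lemma theta1_neq0 (x : C) (r : R) : 0 < r -> `|x| = r%:C ->
  (forall j, q ^+ j * r != 1) -> (forall j, q ^+ j * (q / r) != 1) -> theta1 q x != 0.
Proof.
move=> r0 xr h1 h2; have x0 : x != 0 by rewrite -normr_eq0 xr (inj_eq (fmorph_inj _)) gt_eqF.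
have [d1 d1_gt0 [N1 H1]] := prod_lower_bound hq (ltW r0) h1.
have [d2 d2_gt0 [N2 H2]] := prod_lower_bound hq (ltac:(by rewrite divr_ge0 // ltW) : 0 <= q / r) h2.
have [L _ /(_ x x0)[cv _]] := theta_limit hq.
apply/eqP => t0; rewrite t0 in cv.
have d0 : 0 < (d1 * d2 / 2)%:C by rewrite ltcR divr_gt0 // mulr_gt0.
move/cvgrPdist_le: cv => /(_ _ d0)[N3 _ /(_ (maxn (maxn N1 N2) N3) (leq_maxr _ _))] /=.
set N := maxn _ _; rewrite sub0r normrN.
have le1 : (N1 <= N)%N by rewrite /N -maxnA leq_maxl.
have le2 : (N2 <= N)%N by rewrite /N (maxnC N1) -maxnA leq_maxl.
have dist (z : C) (s : R) : `|z| = s%:C -> `|1 - s|%:C <= `|1 - z|.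
  by move=> zs; have := ler_dist_dist 1 z; rewrite zs normr1 -rmorphB norm_realC.
rewrite /theta_partial normr_prod; apply/negP; rewrite -real_ltNge ?ger0_real ?prodr_ge0 ?(ltW d0) //.
have : (d1 * d2)%:C <= \prod_(0 <= j < N) `|(1 - (q ^+ j)%:C * x) * (1 - (q ^+ j.+1)%:C / x)|.
  apply: (@le_trans _ _ ((\prod_(j < N) `|1 - q ^+ j * r|) * \prod_(j < N) `|1 - q ^+ j * (q / r)|)%:C).
    by rewrite lecR; apply: ler_pM; rewrite ?(ltW d1_gt0) ?(ltW d2_gt0) ?H1 ?H2.
  rewrite big_mkord -big_split /= rmorph_prod; apply: ler_prod => j _.
  rewrite lecR mulr_ge0 //= rmorphM normrM; apply: ler_pM; [by rewrite lecR|by rewrite lecR|apply: dist|apply: dist].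
    by rewrite normrM norm_realC (ger0_norm (exprn_ge0 _ (ltW q0))) xr -rmorphM.
  rewrite normrM normfV norm_realC (ger0_norm (exprn_ge0 _ (ltW q0))) xr -fmorphV -rmorphM.
  by rewrite exprSr mulrA.
by apply: lt_le_trans; rewrite ltcR ltr_pdivrMr // ltr_pMr ?mulr_gt0 // ltr1n.
Qed.

(** The substitution n -> 1 - n in the Laurent series. *)
Lemma theta1_inv (x : C) : x != 0 -> theta1 q x^-1 = - theta1 q x / x.
Proof.
move=> x0; have [L L0 H] := theta_limit hq.
have L0' : L%:C != 0 by rewrite (inj_eq (fmorph_inj _)) gt_eqF.
have [_ sx] := H x x0; have [_ sV] := H x^-1 (ltac:(by rewrite invr_eq0)).
have fK : cancel (fun n : int => 1 - n) (fun n : int => 1 - n) by move=> n; rewrite subKr.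
have := has_sum_reindex fK fK sV.
have : has_sum (theta_term q x^-1 \o (fun n => 1 - n)) (- x^-1 * (L%:C * theta1 q x)).
  apply: eq_has_sum (has_sumZ (- x^-1) sx) => n /=; rewrite /theta_term.
  have -> : tri (1 - n) = tri n.
    by apply: (@mulIf _ 2) => //; rewrite !triE; ring.
  have nz1 : -1 != 0 :> C by rewrite oppr_eq0 oner_eq0.
  have -> : (-1) ^ (1 - n) = - (-1) ^ n :> C.
    rewrite expfzDr // expr1z mulN1r; congr (- _).
    by rewrite -exprz_inv invrN1.
  by rewrite exprz_inv opprB expfzDr // exprN1; ring.
move=> s1 s2; apply: (mulfI L0'); rewrite (has_sum_unique s2 s1); ring.
Qed.

Lemma exprz_mul_div (F : fieldType) (x y : F) (m n : int) : x != 0 -> y != 0 ->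
  (x * y) ^ m * (x / y) ^ n = x ^ (m + n) * y ^ (m - n).
Proof. by move=> x0 y0; rewrite !expfzMl exprz_inv mulrACA -!expfzDr. Qed.

(** The pairs (m, n) with m + n even are (a + b, a - b), those with m + n odd are (a
    + b + 1, a - b).  In both cases the terms of theta1(x y) theta1(x / y) separate
    into a factor in x and a and a factor in y and b. *)
Definition even_x (x : C) (a : int) : C := Q ^ (a * a - a) * x ^ (a + a).
Definition even_y (y : C) (b : int) : C := Q ^ (b * b) * y ^ (b + b).
Definition odd_x (x : C) (a : int) : C := Q ^ (a * a) * x ^ (a + a + 1).
Definition odd_y (y : C) (b : int) : C := Q ^ (b * b + b) * y ^ (b + b + 1).

Lemma theta_term_even x y a b : x != 0 -> y != 0 ->
  theta_term q (x * y) (a + b) * theta_term q (x / y) (a - b) = even_x x a * even_y y b.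
Proof.
move=> x0 y0; rewrite /theta_term /even_x /even_y.
have nz1 : -1 != 0 :> C by rewrite oppr_eq0 oner_eq0.
have e1 : (-1) ^ (a + b) * (-1) ^ (a - b) = 1 :> C.
  by rewrite -expfzDr // addrACA subrr addr0 expfzDr // -exprzMl ?unitfE // mulrNN mulr1 exp1rz.
have eQ : Q ^ tri (a + b) * Q ^ tri (a - b) = Q ^ (a * a - a) * Q ^ (b * b).
  rewrite -!expfzDr //; congr (_ ^ _); apply: (@mulIf _ 2) => //.
  by rewrite [LHS]mulrDl !triE; ring.
have ex : (x * y) ^ (a + b) * (x / y) ^ (a - b) = x ^ (a + a) * y ^ (b + b).
  have sx : a + b + (a - b) = a + a by ring.
  have sy : a + b - (a - b) = b + b by ring.
  by rewrite exprz_mul_div // sx sy.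
by rewrite mulrACA [X in X * _]mulrACA e1 eQ ex mul1r mulrACA.
Qed.

Lemma theta_term_odd x y a b : x != 0 -> y != 0 ->
  theta_term q (x * y) (a + b + 1) * theta_term q (x / y) (a - b) = - (odd_x x a * odd_y y b).
Proof.
move=> x0 y0; rewrite /theta_term /odd_x /odd_y.
have nz1 : -1 != 0 :> C by rewrite oppr_eq0 oner_eq0.
have e1 : (-1) ^ (a + b + 1) * (-1) ^ (a - b) = -1 :> C.
  rewrite -expfzDr // (_ : a + b + 1 + (a - b) = a + a + 1); last by ring.
  by rewrite expfzDr // expfzDr // -exprzMl ?unitfE // mulrNN mulr1 exp1rz mul1r expr1z.
have eQ : Q ^ tri (a + b + 1) * Q ^ tri (a - b) = Q ^ (a * a) * Q ^ (b * b + b).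
  rewrite -!expfzDr //; congr (_ ^ _); apply: (@mulIf _ 2) => //.
  by rewrite [LHS]mulrDl !triE; ring.
have ex : (x * y) ^ (a + b + 1) * (x / y) ^ (a - b) = x ^ (a + a + 1) * y ^ (b + b + 1).
  have sx : a + b + 1 + (a - b) = a + a + 1 by ring.
  have sy : a + b + 1 - (a - b) = b + b + 1 by ring.
  by rewrite exprz_mul_div // sx sy.
by rewrite mulrACA [X in X * _]mulrACA e1 eQ ex mulN1r mulNr mulrACA.
Qed.
End ThetaIdentities.

Section ThreeTerm.
Context {R : realType} (q : R).
Hypothesis hq : 0 < q < 1.
Local Notation C := R[i].
Local Notation Q := (q%:C).
Local Notation qp := (qpow q).

Definition even_odd (s : (int * int) + (int * int)) : int * int :=
  match s with inl (a, b) => (a + b, a - b) | inr (a, b) => (a + b + 1, a - b) end.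
Definition even_odd_inv (n : int * int) : (int * int) + (int * int) :=
  if ((n.1 + n.2) %% 2 == 0)%Z
  then inl (((n.1 + n.2) %/ 2)%Z, ((n.1 - n.2) %/ 2)%Z)
  else inr (((n.1 + n.2) %/ 2)%Z, ((n.1 - n.2) %/ 2)%Z).

Lemma even_oddK : cancel even_odd even_odd_inv.
Proof.
case=> -[a b]; rewrite /even_odd_inv /=.
  have -> : a + b + (a - b) = a * 2 by ring.
  have -> : a + b - (a - b) = b * 2 by ring.
  by rewrite modzMl !mulzK.
have -> : a + b + 1 + (a - b) = a * 2 + 1 by ring.
have -> : a + b + 1 - (a - b) = b * 2 + 1 by ring.
by rewrite modzMDl /= !divzMDl // !divz_small ?addr0.
Qed.

Lemma even_odd_invK : cancel even_odd_inv even_odd.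
Proof.
case=> m n; rewrite /even_odd_inv /even_odd /=; case: eqP => h; congr pair; lia.
Qed.

Lemma theta_rank2 : exists G0 G1 H0 H1 : C -> C, forall x y, x != 0 -> y != 0 ->
  theta1 q (x * y) * theta1 q (x / y) = G0 x * H0 y - G1 x * H1 y.
Proof.
have [L L0 H] := theta_limit hq.
have L0' : L%:C != 0 by rewrite (inj_eq (fmorph_inj _)) gt_eqF.
have bP x y : x != 0 -> y != 0 ->
    abs_bounded (fun n : int * int => theta_term q (x * y) n.1 * theta_term q (x / y) n.2).
  move=> x0 y0; apply: abs_bounded_prod; apply: (abs_bounded_theta hq).
    by rewrite mulf_neq0.
  by rewrite mulf_neq0 ?invr_eq0.
have n1 : 1 != 0 :> C by rewrite oner_eq0.
have b_ex x : x != 0 -> abs_bounded (even_x q x).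
  move=> x0; have := abs_bounded_inj (g := fun a : int => (a + 0, a - 0)) _ (bP x 1 x0 n1).
  move=> /(_ (fun a b e => addIr 0 (congr1 fst e))); congr abs_bounded.
  by apply/funext => a /=; rewrite (theta_term_even hq) // /even_y !addr0 expr0z mulr0 !expr0z !mulr1.
have b_ey y : y != 0 -> abs_bounded (even_y q y).
  move=> y0; have := abs_bounded_inj (g := fun b : int => (0 + b, 0 - b)) _ (bP 1 y n1 y0).
  move=> /(_ (fun a b e => addrI 0 (congr1 fst e))); congr abs_bounded.
  apply/funext => b; rewrite [LHS](_ : _ = theta_term q (1 * y) (0 + b) * theta_term q (1 / y) (0 - b)) //.
  by rewrite (theta_term_even hq) // /even_x mulr0 subrr !expr0z !mul1r.
have b_ox x : x != 0 -> abs_bounded (odd_x q x).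
  move=> x0; have := abs_bounded_inj (g := fun a : int => (a + 0 + 1, a - 0)) _ (bP x 1 x0 n1).
  move=> /(_ (fun a b e => addIr 0 (addIr 1 (congr1 fst e)))).
  apply: abs_bounded_le => a /=.
  by rewrite (theta_term_odd hq) // /odd_y !addr0 mulr0 expr0z add0r expr1z !mulr1 normrN.
have b_oy y : y != 0 -> abs_bounded (odd_y q y).
  move=> y0; have := abs_bounded_inj (g := fun b : int => (0 + b + 1, 0 - b)) _ (bP 1 y n1 y0).
  move=> /(_ (fun a b e => addrI 0 (addIr 1 (congr1 fst e)))).
  apply: abs_bounded_le => b; rewrite [X in _ <= `|X|](_ : _ = theta_term q (1 * y) (0 + b + 1) * theta_term q (1 / y) (0 - b)) //.
  by rewrite (theta_term_odd hq) // /odd_x mulr0 !add0r expr0z expr1z !mul1r normrN.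
have sumP (f : C -> int -> C) : exists s : C -> C, forall x, abs_bounded (f x) -> has_sum (f x) (s x).
  exists (fun x => xget 0 [set s | has_sum (f x) s]) => x /has_sum_exists[s sE].
  by have := xgetPex (0 : C) (ex_intro (fun s => [set s | has_sum (f x) s] s) s sE).
have [G0 G0E] := sumP (even_x q); have [H0 H0E] := sumP (even_y q).
have [G1 G1E] := sumP (odd_x q); have [H1 H1E] := sumP (odd_y q).
exists (fun x => (L%:C ^+ 2)^-1 * G0 x), (fun x => (L%:C ^+ 2)^-1 * G1 x), H0, H1 => x y x0 y0.
have xy0 : x * y != 0 by rewrite mulf_neq0.
have xy0' : x / y != 0 by rewrite mulf_neq0 ?invr_eq0.
have s1 := has_sum_prod (abs_bounded_theta hq xy0) (abs_bounded_theta hq xy0') (H _ xy0).2 (H _ xy0').2.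
have s2 := has_sum_reindex even_oddK even_odd_invK s1.
have s3 := has_sum_split (has_sum_prod (b_ex x x0) (b_ey y y0) (G0E _ (b_ex _ x0)) (H0E _ (b_ey _ y0)))
  (has_sumZ (-1) (has_sum_prod (b_ox x x0) (b_oy y y0) (G1E _ (b_ox _ x0)) (H1E _ (b_oy _ y0)))).
have eq : L%:C * theta1 q (x * y) * (L%:C * theta1 q (x / y)) = G0 x * H0 y + -1 * (G1 x * H1 y).
  apply: has_sum_unique s2 _; apply: eq_has_sum s3 => -[[a b]|[a b]] /=.
    by rewrite (theta_term_even hq).
  by rewrite (theta_term_odd hq) // mulN1r.
apply: (mulfI (expf_neq0 2 L0')); rewrite mulrBr !mulrA mulfV ?expf_neq0 // !mul1r.
by rewrite -mulN1r -mulrA -eq; ring.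
Qed.

Lemma cexpD (z w : C) : cexp (z + w) = cexp z * cexp w.
Proof.
case: z w => [x y] [x' y']; rewrite /cexp /= expRD cosD sinD.
by apply/eqP; rewrite eq_complex /=; apply/andP; split; apply/eqP; ring.
Qed.

Lemma cexp0 : cexp 0 = 1 :> C.
Proof. by rewrite /cexp /= expR0 cos0 sin0 mulr1 mulr0. Qed.

Lemma qpowD z w : qp (z + w) = qp z * qp w.
Proof. by rewrite /qpow mulrDl cexpD. Qed.

Lemma qpow0 : qp 0 = 1.
Proof. by rewrite /qpow mul0r cexp0. Qed.

Lemma qpow_neq0 z : qp z != 0.
Proof.
apply/eqP => e; have := qpowD z (- z); rewrite subrr qpow0 e mul0r => /eqP.
by rewrite oner_eq0.
Qed.

Lemma qpowN z : qp (- z) = (qp z)^-1.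
Proof.
by apply: (mulfI (qpow_neq0 z)); rewrite -qpowD subrr qpow0 mulfV ?qpow_neq0.
Qed.

Lemma qpow1 : qp 1 = Q.
Proof.
have q0 : 0 < q by case/andP: hq.
by rewrite /qpow mul1r /cexp /= cos0 sin0 mulr1 mulr0 lnK.
Qed.

(** With this exponent -1 becomes a power of q, so that the minus signs in b, d and
    their tilde versions are shifts of exponents. *)
Definition half_period : C := (0 +i* (pi / ln q)).

Lemma qpow_half_period : qp half_period = -1.
Proof.
have lnq : ln q != 0 by rewrite lt_eqF // ln_lt0 // ; case/andP: hq => -> ->.
rewrite /qpow (_ : half_period * _ = 0 +i* pi); last first.
  by apply/eqP; rewrite eq_complex /= !(mulr0, mul0r) subrr add0r divfK // !eqxx.
rewrite /cexp expR0 cospi sinpi !mul1r.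
by apply/eqP; rewrite eq_complex /= oppr0 !eqxx.
Qed.

(** The factor q^(-z/2) makes theta1(q^z) odd. *)
Definition sigma (z : C) : C := qp (- (z / 2)) * theta1 q (qp z).

Lemma sigma_odd z : sigma (- z) = - sigma z.
Proof.
rewrite /sigma [in theta1 q _]qpowN (theta1_inv hq) ?qpow_neq0 //.
have e : qp z = qp (z / 2) * qp (z / 2) by rewrite -qpowD -splitr.
rewrite mulNr opprK qpowN; move: e (qpow_neq0 (z / 2)) (qpow_neq0 z).
move: (qp (z / 2)) (qp z) (theta1 q (qp z)) => a b t -> a0 b0.
by field; rewrite a0.
Qed.

(** Every 4 x 4 minor of a function of rank two vanishes.  For an antisymmetric
    function that minor is the square of the Pfaffian. *)
Lemma pfaffian_rank2 (K : idomainType) (T : Type) (a b c d : T -> K) (f : T -> T -> K) :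
  (forall x y, f x y = a x * c y - b x * d y) -> (forall x y, f y x = - f x y) ->
  2 != 0 :> K ->
  forall x y z w, f x y * f z w - f x z * f y w + f x w * f y z = 0.
Proof.
move=> fE fN two x y z w.
have fxx t : f t t = 0.
  apply/eqP; have := fN t t => /eqP; rewrite -subr_eq0 opprK -mulr2n -mulr_natl mulf_eq0.
  by rewrite (negPf two).
pose minor m n := f x m * f y n - f x n * f y m.
pose minor' m n := f z m * f w n - f z n * f w m.
have det0 : minor x y * minor' z w - minor x z * minor' y w + minor x w * minor' y z
   + minor y z * minor' x w - minor y w * minor' x z + minor z w * minor' x y = 0.
  by rewrite /minor /minor' !fE; ring.
apply/eqP; rewrite -sqrf_eq0; apply/eqP; rewrite -det0 /minor /minor' !fxx.
rewrite (fN x y) (fN x z) (fN x w) (fN y z) (fN y w) (fN z w); ring.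
Qed.

(** Four arguments k, y1 + h, y2 + h, y3 + h in the antisymmetric function sigma(x +
    y) sigma(x - y), with h = (u + v)/2 and k = (u - v)/2. *)
Lemma sigma_three (y1 y2 y3 u v : C) :
  sigma (y1 + u) * sigma (y1 + v) * sigma (y2 + y3 + u + v) * sigma (y2 - y3)
  + sigma (y2 + u) * sigma (y2 + v) * sigma (y3 + y1 + u + v) * sigma (y3 - y1)
  + sigma (y3 + u) * sigma (y3 + v) * sigma (y1 + y2 + u + v) * sigma (y1 - y2) = 0.
Proof.
have [G0 [G1 [H0 [H1 rk]]]] := theta_rank2.
pose f x y := sigma (x + y) * sigma (x - y).
have fE x y : f x y = (qp (- x) * G0 (qp x)) * H0 (qp y) - (qp (- x) * G1 (qp x)) * H1 (qp y).
  have -> : f x y = qp (- x) * (theta1 q (qp x * qp y) * theta1 q (qp x / qp y)).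
    rewrite -qpowD -qpowN -qpowD /f /sigma mulrACA -qpowD; congr (qp _ * _).
    by rewrite -opprD -mulrDl addrACA subrr addr0 mulrDl -splitr.
  by rewrite rk ?qpow_neq0 //; ring.
have fN x y : f y x = - f x y by rewrite /f [y + x]addrC -(opprB x y) sigma_odd mulrN.
pose h := (u + v) / 2; pose k := (u - v) / 2.
have two : 2 != 0 :> C by rewrite pnatr_eq0.
have := pfaffian_rank2 fE fN two k (y1 + h) (y2 + h) (y3 + h).
have f1 y : f k (y + h) = - (sigma (y + u) * sigma (y + v)).
  by rewrite fN /f; congr (- (sigma _ * sigma _)); rewrite /h /k; field.
have f2 y z : f (y + h) (z + h) = sigma (y + z + u + v) * sigma (y - z).
  by rewrite /f; congr (sigma _ * sigma _); rewrite /h; field.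
rewrite !f1 !f2 => e.
have s31 : sigma (y3 - y1) = - sigma (y1 - y3) by rewrite -sigma_odd opprB.
rewrite s31 (addrC y3 y1).
by apply: (lincomb (c := -1) e); ring.
Qed.

(** The zeros of theta1 have absolute value an integer power of q, and |q^z| = q^(Re
    z). *)
Lemma sigma_neq0 (z : C) : (forall n : int, complex.Re z != n%:~R) -> sigma z != 0.
Proof.
move=> zn; have q0 : 0 < q by case/andP: hq.
have lnq : ln q != 0 by rewrite lt_eqF // ln_lt0 // ; case/andP: hq => -> ->.
rewrite /sigma mulf_neq0 ?qpow_neq0 //.
have power n : q ^+ n = expR (ln q * n%:R) by rewrite expRM_natr lnK.
have normz : `|qp z| = (expR (ln q * complex.Re z))%:C.
  case: z {zn} => a b; rewrite /qpow normc_def /cexp /=; congr (_%:C).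
  rewrite !exprMn -mulrDr cos2Dsin2 mulr1 sqrtr_sqr ger0_norm ?expR_ge0 //.
  by rewrite mulr0 subr0 mulrC.
apply: (theta1_neq0 hq (expR_gt0 _) normz) => j.
  rewrite power -expRD -mulrDr -[X in _ != X]expR0 (inj_eq (@expR_inj R)) mulf_eq0 (negPf lnq) /=.
  have := zn (- Posz j); rewrite mulrNz; apply: contraNneq => e.
  by rewrite -addr_eq0 addrC -pmulrn e.
rewrite -expRN mulrA -exprSr power -expRD -mulrBr -[X in _ != X]expR0 (inj_eq (@expR_inj R)).
by rewrite mulf_eq0 (negPf lnq) /= subr_eq0 eq_sym pmulrn; apply: zn.
Qed.
End ThreeTerm.

(** * Differentiability *)

Section Differentiability.
Context {R : realType}.
Local Notation C := R[i].

(** A quadratic bound on the remainder is a convenient way to reach complex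
    differentiability from explicit estimates. *)
Lemma quadratic_differentiable (f : C -> C) (x d M r : C) : 0 <= M -> 0 < r ->
  (forall h, `|h| <= r -> `|f (x + h) - f x - h * d| <= M * `|h| ^+ 2) -> differentiable f x.
Proof.
move=> M0 r0 H; apply/derivable1_diffP; apply/cvg_ex; exists d.
have M1 : 0 < M + 1 by rewrite ltr_wpDl.
apply/cvgrPdist_le => e e0; near=> h.
have h0 : h != 0 by near: h; exact: nbhs_dnbhs_neq.
have hr : `|h| <= r by near: h; exact: dnbhs0_le.
have he : `|h| <= e / (M + 1) by near: h; apply: dnbhs0_le; rewrite divr_gt0.
have nh : `|h| != 0 by rewrite normr_eq0.
rewrite /= -[h *: 1]/(h * 1) mulr1 [h + x]addrC -[_ *: _]/(h^-1 * _).
have -> : d - h^-1 * (f (x + h) - f x) = - (h^-1 * (f (x + h) - f x - h * d)).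
  by rewrite [in RHS]mulrBr mulKf // opprB.
rewrite normrN normrM normfV ler_pdivrMl ?normr_gt0 //.
apply: le_trans (H _ hr) _; rewrite expr2 mulrCA; apply: ler_wpM2l => //.
apply: (@le_trans _ _ ((M + 1) * `|h|)); first by rewrite ler_wpM2r // lerDl.
by rewrite mulrC -ler_pdivlMr.
Unshelve. all: by end_near. Qed.

Lemma sum_norm_bound (I : choiceType) (a : I -> C) s B :
  has_sum a s -> (forall F : {fset I}, \sum_(i <- F) `|a i| <= B) -> `|s| <= B.
Proof.
move=> sa HB; apply/ler_addgt0Pr => e e0; have [F0 H] := sa e e0.
have := H F0 (fsubset_refl _); rewrite distrC => h.
rewrite -(subrK (\sum_(i <- F0) a i) s) addrC; apply: le_trans (ler_normD _ _) _.
by apply: lerD => //; apply: le_trans (ler_norm_sum _ _ _) (HB F0).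
Qed.

Lemma norm_exp_le (x : C) (rho : R) n : 0 <= rho -> `|x| <= rho%:C -> `|x ^+ n| <= (rho ^+ n)%:C.
Proof. by move=> r0 xr; rewrite normrX rmorphXn lerXn2r // nnegrE lecR. Qed.

(** The weights n and n^2 are crude but can be absorbed in a larger radius: n^2
    rho^n <= (4 rho)^n. *)
Lemma power_increment (x h : C) (rho : R) n : 1 <= rho -> `|x| <= rho%:C -> `|x + h| <= rho%:C ->
  `|(x + h) ^+ n - x ^+ n| <= `|h| * (n%:R * rho ^+ n)%:C /\
  `|(x + h) ^+ n - x ^+ n - h * (n%:R * x ^+ n.-1)| <= `|h| ^+ 2 * (n%:R ^+ 2 * rho ^+ n)%:C.
Proof.
move=> r1 xr xhr; have r0 : 0 <= rho by apply: le_trans r1.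
have powr k : `|x ^+ k| <= (rho ^+ k)%:C by exact: norm_exp_le.
have powS k : rho ^+ k <= rho ^+ k.+1 by rewrite exprS ler_peMl // exprn_ge0.
elim: n => [|n [IH1 IH2]].
  by rewrite !expr0 subrr (expr2 (0 : R)) !mul0r mulr0 subr0 normr0 rmorph0 !mulr0.
split.
  have -> : (x + h) ^+ n.+1 - x ^+ n.+1 = (x + h) * ((x + h) ^+ n - x ^+ n) + h * x ^+ n.
    by rewrite !exprS; ring.
  apply: le_trans (ler_normD _ _) _; rewrite !normrM.
  have -> : (n.+1%:R * rho ^+ n.+1) = rho * (n%:R * rho ^+ n) + rho ^+ n.+1.
    by rewrite -natr1 exprS; ring.
  rewrite rmorphD mulrDr; apply: lerD; last first.
    by apply: ler_wpM2l => //; apply: le_trans (powr n) _; rewrite lecR.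
  by rewrite rmorphM [leRHS]mulrCA; apply: ler_pM.
have -> : (x + h) ^+ n.+1 - x ^+ n.+1 - h * (n.+1%:R * x ^+ n) =
   x * ((x + h) ^+ n - x ^+ n - h * (n%:R * x ^+ n.-1)) + h * ((x + h) ^+ n - x ^+ n).
  case: n {IH1 IH2} => [|n] /=; first by rewrite !expr1 !expr0; ring.
  by rewrite -[n.+2%:R]natr1 !exprS; ring.
apply: le_trans (ler_normD _ _) _; rewrite !normrM.
apply: (@le_trans _ _ (`|h| ^+ 2 * (rho * (n%:R ^+ 2 * rho ^+ n) + n%:R * rho ^+ n)%:C)).
  rewrite rmorphD mulrDr; apply: lerD.
    by rewrite rmorphM [leRHS]mulrCA; apply: ler_pM.
  by rewrite expr2 -mulrA; apply: ler_wpM2l.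
apply: ler_wpM2l; first by rewrite exprn_ge0.
rewrite lecR -natr1 [rho ^+ n.+1]exprS.
have p0 : 0 <= rho ^+ n by rewrite exprn_ge0.
have : n%:R * rho ^+ n <= n%:R * (rho * rho ^+ n) by rewrite ler_wpM2l // -exprS.
have : 0 <= n%:R * (rho * rho ^+ n) by rewrite mulr_ge0 // mulr_ge0.
have : 0 <= rho * rho ^+ n by rewrite mulr_ge0.
move: (rho ^+ n) (n%:R : R) => p m P0 mP0 mp.
have -> : rho * (m ^+ 2 * p) = m ^+ 2 * (rho * p) by ring.
have -> : (m + 1) ^+ 2 * (rho * p) = m ^+ 2 * (rho * p) + 2 * (m * (rho * p)) + rho * p by ring.
lra.
Qed.

(** By [power_increment] the quadratic remainders of the terms are summable. *)
Lemma power_series_differentiable (c : nat -> C) :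
  (forall rho : R, abs_bounded (fun n => c n * (rho ^+ n)%:C)) ->
  exists G : C -> C, (forall x, has_sum (fun n => c n * x ^+ n) (G x)) /\
    forall x, differentiable G x.
Proof.
move=> cb.
have bx (x : C) : exists2 rho : R, 1 <= rho & `|x| + 1 <= rho%:C.
  exists (Normc.normc x + 1); first by case: x => a b; rewrite lerDr sqrtr_ge0.
  by rewrite rmorphD rmorph1.
have two_pow n : n%:R <= 2 ^+ n :> R.
  by rewrite -natrX ler_nat ltnW // ltn_expl.
have bounded x : abs_bounded (fun n => c n * x ^+ n).
  have [rho r1 xr] := bx x; apply: abs_bounded_le (cb rho) => n.
  have r0 : 0 <= rho by apply: le_trans r1.
  rewrite !normrM ler_wpM2l // norm_realC (ger0_norm (exprn_ge0 n r0)).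
  by apply: norm_exp_le => //; apply: le_trans xr; rewrite lerDl.
have [G GE] : exists G : C -> C, forall x, has_sum (fun n => c n * x ^+ n) (G x).
  exists (fun x => xget 0 [set s | has_sum (fun n => c n * x ^+ n) s]) => x.
  have [s sE] := has_sum_exists (bounded x).
  by have := xgetPex (0 : C) (ex_intro (fun s => [set s | has_sum (fun n => c n * x ^+ n) s] s) s sE).
exists G; split => // x; have [rho r1 xr] := bx x.
have r0 : 0 <= rho by apply: le_trans r1.
have powr n : `|x ^+ n| <= (rho ^+ n)%:C.
  by apply: norm_exp_le => //; apply: le_trans xr; rewrite lerDl.
have bd : abs_bounded (fun n => c n * (n%:R * x ^+ n.-1)).
  apply: abs_bounded_le (cb (2 * rho)) => n.
  have r2 : 0 <= 2 * rho by rewrite mulr_ge0.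
  rewrite !normrM ler_wpM2l // norm_realC (ger0_norm (exprn_ge0 n r2)).
  rewrite exprMn rmorphM normr_nat; apply: ler_pM => //.
    by rewrite -[n%:R](rmorph_nat (real_complex R)) lecR.
  apply: le_trans (powr _) _; rewrite lecR; case: n => // n /=.
  by rewrite exprS ler_peMl // exprn_ge0.
have [d dE] := has_sum_exists bd.
have [M HM] := cb (4 * rho).
have M0 : 0 <= M by have := HM fset0; rewrite big_seq_fset0 lecR.
apply: (@quadratic_differentiable G x d M%:C 1) => //; first by rewrite lecR.
move=> h h1.
have sE := has_sumD (has_sumD (GE (x + h)) (has_sumZ (-1) (GE x))) (has_sumZ (- h) dE).
have {}sE : has_sum (fun n => c n * ((x + h) ^+ n - x ^+ n - h * (n%:R * x ^+ n.-1))) (G (x + h) - G x - h * d).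
  have -> : G (x + h) - G x - h * d = G (x + h) + -1 * G x + - h * d by ring.
  by apply: eq_has_sum sE => n; ring.
apply: (sum_norm_bound sE) => F.
have xhr : `|x + h| <= rho%:C.
  by apply: le_trans (ler_normD _ _) _; apply: le_trans xr; rewrite lerD2l.
have xr' : `|x| <= rho%:C by apply: le_trans xr; rewrite lerDl.
apply: le_trans (ler_wpM2r _ (HM F)); last by rewrite exprn_ge0.
rewrite mulr_suml; apply: ler_sum => n _; rewrite !normrM -mulrA ler_wpM2l //.
have [_ le] := power_increment n r1 xr' xhr; apply: le_trans le _; rewrite [leLHS]mulrC.
have r4 : 0 <= 4 * rho by rewrite mulr_ge0.
rewrite ler_wpM2r ?exprn_ge0 // norm_realC lecR (ger0_norm (exprn_ge0 n r4)).
have -> : (4 * rho) ^+ n = (2 ^+ n) ^+ 2 * rho ^+ n.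
  by rewrite exprAC -exprMn; congr (_ ^+ _); ring.
apply: ler_wpM2r; first exact: exprn_ge0.
by apply: lerXn2r; rewrite ?nnegrE ?exprn_ge0.
Qed.

Lemma sin_le (x : R) : `|sin x| <= `|x|.
Proof.
wlog x0 : x / 0 <= x.
  by move=> H; have [/H//|/ltW x0] := lerP 0 x; rewrite -normrN -sinN -(normrN x) H // oppr_ge0.
have ds c : c \in `]0, x[%R -> is_derive c 1 sin (cos c) by move=> _; exact: is_derive_sin.
have cs : {within `[0, x], continuous (@sin R)}.
  by apply: continuous_subspaceT; exact: continuous_sin.
have [c _] := MVT_segment x0 ds cs; rewrite sin0 !subr0 => ->; rewrite normrM ler_piMl // ler_norml cos_geN1 cos_le1 //.
Qed.

Lemma cos_sub1 (x : R) : `|cos x - 1| <= `|x| ^+ 2.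
Proof.
have -> : cos x - 1 = - (2 * sin (x / 2) ^+ 2).
  by rewrite {1}(splitr x) cosD -!expr2 cos2sin2; ring.
rewrite normrN normrM normrX ger0_norm //.
have := sin_le (x / 2); rewrite normf_div (ger0_norm (_ : 0 <= 2)) //.
have := normr_ge0 (sin (x / 2)); have := normr_ge0 x; nra.
Qed.

Lemma sin_sub (x : R) : `|x| <= 1 -> `|sin x - x| <= `|x| ^+ 2.
Proof.
wlog x0 : x / 0 <= x.
  move=> H; have [/H//|/ltW x0 x1] := lerP 0 x.
  by have := H (- x); rewrite oppr_ge0 sinN -opprD !normrN => ->.
rewrite ger0_norm // => x1.
have ds c : c \in `]0, x[%R -> is_derive c 1 (fun t => sin t - t : R) (cos c - 1).
  by move=> _; exact: is_deriveB.
have cs : {within `[0, x], continuous (fun t => sin t - t : R)}.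
  apply: continuous_subspaceT => t; apply: continuousB; last exact: cvg_id.
  exact: continuous_sin.
have [c cx] := MVT_segment x0 ds cs; rewrite sin0 !subr0 => ->; rewrite normrM.
have := cos_sub1 c; have : `|c| <= x.
  by move: cx; rewrite in_itv /= => /andP[c0 cx]; rewrite ger0_norm.
rewrite (ger0_norm x0); have := normr_ge0 c; have := normr_ge0 (cos c - 1); nra.
Qed.

Lemma expR_sub (x : R) : `|x| <= 2^-1 -> `|expR x - 1 - x| <= 2 * `|x| ^+ 2.
Proof.
rewrite ler_norml => /andP[x1 x2]; have g1 := expR_ge1Dx x; have g2 := expR_ge1Dx (- x).
rewrite ger0_norm; last by rewrite -addrA -opprD subr_ge0.
rewrite real_normK ?num_real //.
have e0 := expR_gt0 x; rewrite expRN in g2.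
have : (1 - x) * expR x <= 1 by rewrite -ler_pdivlMr // mul1r.
nra.
Qed.

Lemma norm_le_Re_Im (a b : R) : `|a +i* b| <= (`|a| + `|b|)%:C.
Proof.
have ge0 : 0 <= `|a| + `|b| by rewrite addr_ge0.
rewrite normc_def lecR /= -(ger0_norm ge0) -sqrtr_sqr ler_wsqrtr //.
have := real_normK (num_real a); have := real_normK (num_real b) => <- <-.
have := mulr_ge0 (normr_ge0 a) (normr_ge0 b); nra.
Qed.

(** With h = a + i b, the real part is (e^a - 1 - a) cos b + (1 + a) (cos b - 1) and
    the imaginary part (e^a - 1) sin b + (sin b - b). *)
Lemma cexp_sub1 (h : C) : `|h| <= (2^-1)%:C -> `|cexp h - 1 - h| <= (7 : R)%:C * `|h| ^+ 2.
Proof.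
case: h => a b.
have an : `|a| <= Num.sqrt (a ^+ 2 + b ^+ 2).
  by rewrite -sqrtr_sqr ler_wsqrtr // lerDl sqr_ge0.
have bn : `|b| <= Num.sqrt (a ^+ 2 + b ^+ 2).
  by rewrite -sqrtr_sqr ler_wsqrtr // lerDr sqr_ge0.
rewrite normc_def lecR /= => n2; move: (Num.sqrt _) an bn n2 => n an bn n2.
have a2 := le_trans an n2; have b2 := le_trans bn n2.
rewrite -rmorphXn -rmorphM.
have -> : cexp (a +i* b) - 1 - (a +i* b) = ((expR a - 1 - a) * cos b + (1 + a) * (cos b - 1))
    +i* ((expR a - 1) * sin b + (sin b - b)).
  by apply/eqP; rewrite eq_complex /=; apply/andP; split; apply/eqP; ring.
apply: le_trans (norm_le_Re_Im _ _) _; rewrite lecR.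
have b1 : `|b| <= 1 by apply: le_trans b2 _; lra.
have e1 := expR_sub a2; have s1 := sin_sub b1; have s2 := sin_le b; have c1 := cos_sub1 b.
have c2 : `|cos b| <= 1 by rewrite ler_norml cos_geN1 cos_le1.
have sq (x : R) : `|x| <= n -> `|x| ^+ 2 <= n ^+ 2.
  by move=> xn; apply: lerXn2r; rewrite // nnegrE // (le_trans _ xn).
have a3 := sq _ an; have b3 := sq _ bn.
have n0 : 0 <= n by apply: le_trans an.
have p1 : `|(expR a - 1 - a) * cos b| <= 2 * n ^+ 2.
  rewrite normrM -[leRHS]mulr1; apply: ler_pM => //; apply: le_trans e1 _; lra.
have p2 : `|(1 + a) * (cos b - 1)| <= (1 + 2^-1) * n ^+ 2.
  rewrite normrM; apply: ler_pM => //; last exact: le_trans b3.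
  by apply: le_trans (ler_normD _ _) _; rewrite normr1 lerD2l.
have p3 : `|(expR a - 1) * sin b| <= (2 * n) * n.
  rewrite normrM; apply: ler_pM => //; last exact: le_trans bn.
  rewrite -(subrK a (expR a - 1)); apply: le_trans (ler_normD _ _) _.
  have : n ^+ 2 <= n * 2^-1 by rewrite expr2 ler_wpM2l.
  lra.
have t1 := ler_normD ((expR a - 1 - a) * cos b) ((1 + a) * (cos b - 1)).
have t2 := ler_normD ((expR a - 1) * sin b) (sin b - b).
have : 2 * n * n = 2 * n ^+ 2 by ring.
have := sqr_ge0 n; lra.
Qed.

Lemma cexp_differentiable (z : C) : differentiable (@cexp R) z.
Proof.
have h0 : (0 : C) < (2^-1 : R)%:C by rewrite ltcR invr_gt0.
have M0 : 0 <= `|cexp z| * (7 : R)%:C by rewrite mulr_ge0 // lecR.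
apply: (quadratic_differentiable (d := cexp z) M0 h0) => h hh.
have -> : cexp (z + h) - cexp z - h * cexp z = cexp z * (cexp h - 1 - h).
  by rewrite cexpD; ring.
by rewrite normrM -mulrA ler_wpM2l // cexp_sub1.
Qed.
End Differentiability.

Section Differentiable.
Context {R : realType} {V : normedModType R[i]}.
Local Notation C := R[i].
Implicit Types (f g : V -> C) (p : V).

Lemma differentiable_add f g p :
  differentiable f p -> differentiable g p -> differentiable (fun p => f p + g p) p.
Proof. by move=> df dg; exact: (differentiableD df dg). Qed.

Lemma differentiable_mul f g p :
  differentiable f p -> differentiable g p -> differentiable (fun p => f p * g p) p.
Proof. by move=> df dg; exact: (differentiableM df dg). Qed.

Lemma differentiable_opp f p : differentiable f p -> differentiable (fun p => - f p) p.
Proof. by move=> df; exact: (differentiableN df). Qed.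

Lemma differentiable_subst (g : C -> C) f p :
  differentiable f p -> differentiable g (f p) -> differentiable (fun p => g (f p)) p.
Proof. by move=> df dg; exact: (differentiable_comp df dg). Qed.

Lemma differentiable_const (c : C) p : differentiable (fun _ : V => c) p.
Proof. exact: differentiable_cst. Qed.
End Differentiable.

Section Coordinates.
Context {R : realType}.
Local Notation C := R[i].
Implicit Types V W : normedModType C.

Lemma differentiable_id V (p : V) : differentiable (fun x : V => x) p.
Proof. by apply: (@linear_differentiable _ _ _ idfun) => ? //. Qed.

Lemma differentiable_fst V W (p : V * W) : differentiable fst p.
Proof. by apply: (linear_differentiable (f := fst)) => x; exact: cvg_fst. Qed.

Lemma differentiable_snd V W (p : V * W) : differentiable snd p.
Proof. by apply: (linear_differentiable (f := snd)) => x; exact: cvg_snd. Qed.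
End Coordinates.

Section Holomorphy.
Context {R : realType} (q : R).
Hypothesis hq : 0 < q < 1.
Local Notation C := R[i].
Local Notation Q := (q%:C).
Local Notation qp := (qpow q).

Let theta_bounded (rho : R) : abs_bounded (theta_term q (`|rho| + 1)%:C) /\
  abs_bounded (theta_term q (`|rho| + 1)^-1%:C).
Proof.
have p : `|rho| + 1 != 0 by rewrite gt_eqF // ltr_wpDl.
by split; apply: (abs_bounded_theta hq); rewrite fmorph_eq0 ?invr_eq0.
Qed.

(** The Laurent series is split at n >= 0 and n < 0 into a power series in x and one
    in 1/x; both converge everywhere. *)
Lemma theta1_laurent : exists G H : C -> C, [/\ forall x, differentiable G x,
  forall x, differentiable H x & forall x, x != 0 -> theta1 q x = G x + x^-1 * H x^-1].
Proof.
have [L L0 tE] := theta_limit hq.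
have L0' : L%:C != 0 by rewrite fmorph_eq0 gt_eqF.
pose c n : C := (-1) ^+ n * Q ^+ 'C(n, 2).
pose c' n : C := (-1) ^+ n.+1 * Q ^+ 'C(n.+2, 2).
have termP x n : theta_term q x (Posz n) = c n * x ^+ n by rewrite /theta_term triP -!exprnP.
have termN x n : theta_term q x (Negz n) = x^-1 * (c' n * x^-1 ^+ n).
  rewrite /theta_term triN !NegzE -!exprnN -exprnP /c' -!exprVn invrN invr1.
  by rewrite [x^-1 ^+ n.+1]exprS; ring.
have le_rho (rho : R) n : `|(rho ^+ n)%:C| <= `|(`|rho| + 1)%:C ^+ n|.
  have p : 0 <= `|rho| + 1 by rewrite addr_ge0.
  rewrite -rmorphXn !norm_realC lecR (ger0_norm (exprn_ge0 n p)) normrX.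
  by apply: lerXn2r; rewrite ?nnegrE // lerDl.
have [G [GE dG]] : exists G : C -> C, (forall x, has_sum (fun n => c n * x ^+ n) (G x)) /\
    forall x, differentiable G x.
  apply: power_series_differentiable => rho.
  have [b _] := theta_bounded rho.
  apply: abs_bounded_le (abs_bounded_inj (g := Posz) _ b) => [n|m n [] //].
  by rewrite /= termP !normrM ler_wpM2l ?mulr_ge0.
have [H [HE dH]] : exists G : C -> C, (forall x, has_sum (fun n => c' n * x ^+ n) (G x)) /\
    forall x, differentiable G x.
  apply: power_series_differentiable => rho.
  have [_ b] := theta_bounded rho.
  apply: abs_bounded_le (abs_bounded_inj (g := Negz) _ b) => [n|m n [] //].
  have p : 0 <= `|rho| + 1 by rewrite addr_ge0.
  rewrite /= termN fmorphV invrK normrM [leRHS]normrM -[leLHS]mul1r; apply: ler_pM => //.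
    by rewrite norm_realC lecR (ger0_norm p) lerDr.
  by rewrite !normrM ler_wpM2l ?mulr_ge0.
exists (fun x => L%:C^-1 * G x), (fun x => L%:C^-1 * H x); split.
- by move=> x; exact: differentiable_mul (differentiable_const _ _) (dG x).
- by move=> x; exact: differentiable_mul (differentiable_const _ _) (dH x).
move=> x x0; apply: (mulfI L0'); rewrite mulrDr [x^-1 * _]mulrCA !mulVKf //.
pose g (s : nat + nat) : int := match s with inl n => Posz n | inr n => Negz n end.
pose g' (n : int) : nat + nat := match n with Posz n => inl n | Negz n => inr n end.
apply: (has_sum_unique (has_sum_reindex (g := g) (h := g') _ _ (tE x x0).2)).
- by case.
- by case.
apply: eq_has_sum (has_sum_split (GE x) (has_sumZ x^-1 (HE x^-1))).
by case=> n /=; rewrite ?termP ?termN.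
Qed.

Lemma qpow_differentiable (z : C) : differentiable qp z.
Proof.
apply: (@differentiable_subst _ _ (@cexp R) (fun x : C => x * (ln q)%:C)).
  exact: differentiable_mul (differentiable_id _) (differentiable_const _ _).
exact: cexp_differentiable.
Qed.

Lemma theta1_qpow_differentiable (z : C) : differentiable (fun z => theta1 q (qp z)) z.
Proof.
have [G [H [dG dH E]]] := theta1_laurent.
have -> : (fun z => theta1 q (qp z)) = (fun z => G (qp z) + qp (- z) * H (qp (- z))).
  by apply/funext => t; rewrite E ?qpow_neq0 // qpowN.
have dn : differentiable (fun z => qp (- z)) z.
  exact: differentiable_subst (differentiable_opp (differentiable_id _)) (qpow_differentiable _).
exact: differentiable_add (differentiable_subst (qpow_differentiable _) (dG _))
  (differentiable_mul dn (differentiable_subst dn (dH _))).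
Qed.

Lemma sigma_differentiable (z : C) : differentiable (sigma q) z.
Proof.
have dn : differentiable (fun z : C => - (z / 2)) z.
  exact: differentiable_opp (differentiable_mul (differentiable_id _) (differentiable_const _ _)).
exact: differentiable_mul (differentiable_subst dn (qpow_differentiable _))
  (theta1_qpow_differentiable z).
Qed.
End Holomorphy.

(** * Generic points *)

Definition generic {V : topologicalType} (P : V -> Prop) : Prop :=
  exists D : set V, [/\ open D, dense D & forall x, D x -> P x].

Section Generic.
Context {V : topologicalType}.
Implicit Types P Q : V -> Prop.

Lemma generic_and P Q : generic P -> generic Q -> generic (fun x => P x /\ Q x).
Proof.
move=> [D [oD dD DP]] [E [oE dE EQ]]; exists (D `&` E); split; first exact: openI.
  exact: denseI.
by move=> x [/DP Px /EQ Qx].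
Qed.

Lemma generic_imply P Q : (forall x, P x -> Q x) -> generic P -> generic Q.
Proof. by move=> PQ [D [oD dD DP]]; exists D; split=> // x /DP /PQ. Qed.

Lemma generic_always P : (forall x, P x) -> generic P.
Proof. by move=> H; exists setT; split=> //; [exact: openT | move=> O [x Ox] _; exists x]. Qed.

Lemma generic_closure P : generic P -> closure [set x | P x] = setT.
Proof.
move=> [D [_ dD DP]]; apply/seteqP; split=> // x _ B Bx.
have [y [yB yD]] := dD B^° (ex_intro _ x Bx) (open_interior B).
by exists y; split; [exact: DP | exact: interior_subset].
Qed.
End Generic.

Section GenericForms.
Context {R : realType} (q : R).
Hypothesis hq : 0 < q < 1.
Local Notation C := R[i].
Context {V : normedModType C}.
Implicit Types l : V -> C.

(** For the forms below this says affine and not constant; the direction is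
    normalised so that the form grows with slope one along it. *)
Definition unit_slope l : Prop :=
  (forall p, differentiable l p) /\ exists v : V, forall p t, l (p + t *: v) = l p + t.

Lemma not_integer_nearby (x e : R) : 0 < e ->
  exists t : R, 0 <= t < e /\ forall n : int, x + t != n%:~R.
Proof.
move=> e0; case: (pselect (exists n : int, x = n%:~R)) => [[n ->]|xn]; last first.
  exists 0; rewrite lexx e0; split=> // n; rewrite addr0.
  by apply/eqP => xE; apply: xn; exists n.
(* Here x is an integer, and a shift strictly between 0 and 1 leaves the integers. *)
exists (Num.min e 1 / 2); have m0 : 0 < Num.min e 1 by rewrite lt_min e0 ltr01.
have m1 : Num.min e 1 <= 1 by rewrite ge_min lexx orbT.
have me : Num.min e 1 <= e by rewrite ge_min lexx.
split; first by apply/andP; split; lra.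
move=> m; apply/eqP => E.
have : (m - n)%:~R = Num.min e 1 / 2 :> R by rewrite rmorphB /= -E; ring.
move=> {}E; have : 0 < m - n by rewrite -(ltr0z R) E; lra.
have : m - n < 1 by rewrite -(ltrz1 R) E; lra.
lia.
Qed.

(** Density: moving by a small real amount along the direction moves Re(l p) away
    from the integers. *)
Lemma generic_sigma l : unit_slope l -> generic (fun p => sigma q (l p) != 0).
Proof.
move=> [dl [v lv]]; exists [set p | sigma q (l p) != 0]; split=> //.
  rewrite openE => p np.
  have c : {for p, continuous (fun p => sigma q (l p))}.
    apply: differentiable_continuous.
    exact: differentiable_subst (dl p) (sigma_differentiable hq _).
  have near_p : \forall t \near p, sigma q (l t) != 0 by exact: (cvgr_neq0 _ c np).
  exact: near_p.
move=> O [p Op] oO.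
have /nbhs_ballP[e0 e0_gt0 He] := open_nbhs_nbhs (conj oO Op).
have v1 : 0 < `|v| + 1 by rewrite ltr_wpDl.
have e_gt0 : 0 < e0 / (`|v| + 1) by rewrite divr_gt0.
have e_gt0' : 0 < complex.Re (e0 / (`|v| + 1)) by move: e_gt0; rewrite ltcE => /andP[].
have [t [/andP[t0 te] nt]] := not_integer_nearby (complex.Re (l p)) e_gt0'.
exists (p + t%:C *: v); split.
  apply: He; rewrite -ball_normE /= opprD addNKr normrN normrZ norm_realC ger0_norm //.
  have te' : t%:C < e0 / (`|v| + 1).
    by move: e_gt0; rewrite !ltcE /= => /andP[-> _].
  apply: (@le_lt_trans _ _ (t%:C * (`|v| + 1))); last by rewrite -ltr_pdivlMr.
  by rewrite ler_wpM2l ?lecR // lerDl.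
rewrite /= lv; apply: (sigma_neq0 hq) => n.
by case: (l p) nt => a b /= nt; exact: nt.
Qed.

End GenericForms.

Section AffineForms.
Context {R : realType}.
Local Notation C := R[i].

Lemma unit_slope_affine (V : normedModType C) (l lin : V -> C) (c : C) :
  (forall p, differentiable lin p) -> (forall p w t, lin (p + t *: w) = lin p + t * lin w) ->
  (exists v, lin v = 1) -> (forall p, l p = lin p + c) -> unit_slope l.
Proof.
move=> dlin linD [v lv] lE; split=> [p|].
  have -> : l = (fun p => lin p + c) by apply/funext.
  exact: differentiable_add (dlin p) (differentiable_const _ _).
by exists v => p t; rewrite !lE linD lv mulr1 addrAC.
Qed.

Lemma line_fst (V W : normedModType C) (p w : V * W) (t : C) : (p + t *: w).1 = p.1 + t *: w.1.
Proof. by []. Qed.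

Lemma line_snd (V W : normedModType C) (p w : V * W) (t : C) : (p + t *: w).2 = p.2 + t *: w.2.
Proof. by []. Qed.

Lemma scaleCE (x t : C) : t *: x = t * x.
Proof. by []. Qed.

Local Notation dc := (differentiable_const _ _).
Local Notation fst' := (differentiable_comp (differentiable_fst _)).

(** The hypotheses compute the coefficients as differences of values, so that for an
    explicit l they can be discharged by [ring]. *)
Lemma unit_slope2 (l : C * C -> C) :
  (forall p, l p = (l (1, 0) - l (0, 0)) * p.1 + (l (0, 1) - l (0, 0)) * p.2 + l (0, 0)) ->
  (l (1, 0) - l (0, 0) != 0) || (l (0, 1) - l (0, 0) != 0) -> unit_slope l.
Proof.
move: (l (0, 0)) => e; move: (_ - e) (_ - e) => b a lE ab.
apply: unit_slope_affine lE => [p|p w t|].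
- exact: differentiable_add (differentiable_mul dc (differentiable_fst _))
    (differentiable_mul dc (differentiable_snd _)).
- by rewrite !(line_fst, line_snd, scaleCE); ring.
- by case/orP: ab => n; [exists (a^-1, 0) | exists (0, b^-1)];
    rewrite /= mulr0 ?addr0 ?add0r mulfV.
Qed.

Lemma unit_slope3 (l : C * C * C -> C) :
  (forall p, l p = (l (1, 0, 0) - l (0, 0, 0)) * p.1.1 + (l (0, 1, 0) - l (0, 0, 0)) * p.1.2
     + (l (0, 0, 1) - l (0, 0, 0)) * p.2 + l (0, 0, 0)) ->
  [|| l (1, 0, 0) - l (0, 0, 0) != 0, l (0, 1, 0) - l (0, 0, 0) != 0
    | l (0, 0, 1) - l (0, 0, 0) != 0] -> unit_slope l.
Proof.
move: (l (0, 0, 0)) => e; move: (_ - e) (_ - e) (_ - e) => c b a lE abc.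
apply: unit_slope_affine lE => [p|p w t|].
- exact: differentiable_add (differentiable_add
    (differentiable_mul dc (fst' (differentiable_fst _)))
    (differentiable_mul dc (fst' (differentiable_snd _)))) (differentiable_mul dc (differentiable_snd _)).
- by rewrite !(line_fst, line_snd, scaleCE); ring.
- by case/or3P: abc => n; [exists (a^-1, 0, 0) | exists (0, b^-1, 0) | exists (0, 0, c^-1)];
    rewrite /= !mulr0 !(addr0, add0r) mulfV.
Qed.

Lemma unit_slope4 (l : C * C * C * C -> C) :
  (forall p, l p = (l (1, 0, 0, 0) - l (0, 0, 0, 0)) * p.1.1.1 + (l (0, 1, 0, 0) - l (0, 0, 0, 0)) * p.1.1.2
     + (l (0, 0, 1, 0) - l (0, 0, 0, 0)) * p.1.2 + (l (0, 0, 0, 1) - l (0, 0, 0, 0)) * p.2 + l (0, 0, 0, 0)) ->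
  [|| l (1, 0, 0, 0) - l (0, 0, 0, 0) != 0, l (0, 1, 0, 0) - l (0, 0, 0, 0) != 0,
     l (0, 0, 1, 0) - l (0, 0, 0, 0) != 0 | l (0, 0, 0, 1) - l (0, 0, 0, 0) != 0] -> unit_slope l.
Proof.
move: (l (0, 0, 0, 0)) => e; move: (_ - e) (_ - e) (_ - e) (_ - e) => d c b a lE abcd.
apply: unit_slope_affine lE => [p|p w t|].
- exact: differentiable_add (differentiable_add (differentiable_add
    (differentiable_mul dc (fst' (fst' (differentiable_fst _))))
    (differentiable_mul dc (fst' (fst' (differentiable_snd _)))))
    (differentiable_mul dc (fst' (differentiable_snd _)))) (differentiable_mul dc (differentiable_snd _)).
- by rewrite !(line_fst, line_snd, scaleCE); ring.
- by case/or4P: abcd => n; [exists (a^-1, 0, 0, 0) | exists (0, b^-1, 0, 0)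
    | exists (0, 0, c^-1, 0) | exists (0, 0, 0, d^-1)];
    rewrite /= !mulr0 !(addr0, add0r) mulfV.
Qed.

Lemma coefficient_neq0 (x : C) : (x = 1 \/ x = -1) \/ (x = 2 \/ x = - 2) -> x != 0.
Proof. by case=> [[]|[]] ->; rewrite ?oppr_eq0 ?oner_eq0 ?pnatr_eq0. Qed.

Lemma skip_zero_coefficient (x : C) (b : bool) : x = 0 -> b -> (x != 0) || b.
Proof. by move=> _ ->; rewrite orbT. Qed.
End AffineForms.

(* In every form that occurs below, the first nonzero coefficient is 1, -1, 2 or -2. *)
Ltac coordinate_coefficient := apply: coefficient_neq0;
  first [ left; left; by ring | left; right; by ring | right; left; by ring | right; right; by ring ].
Ltac affine_form :=
  (apply: unit_slope2 || apply: unit_slope3 || apply: unit_slope4);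
  [move=> p /=; ring | rewrite /=;
   repeat (apply: skip_zero_coefficient; [by ring |]);
   first [apply/orP; left | idtac]; coordinate_coefficient].

(** * Theta function form of the R- and K-matrices *)

Section Baxter.
Context {R : realType} (q : R).
Hypothesis hq : 0 < q < 1.
Local Notation C := R[i].
Local Notation qp := (qpow q).
Local Notation S := (sigma q).

(** The substitution n -> n + 1 in the Laurent series. *)
Lemma theta1_shift (x : C) : x != 0 -> theta1 q (q%:C * x) = - theta1 q x / x.
Proof.
move=> x0; have q0 : q%:C != 0 by rewrite fmorph_eq0 gt_eqF //; case/andP: hq.
have [L L0 H] := theta_limit hq.
have L0' : L%:C != 0 by rewrite fmorph_eq0 gt_eqF.
have [_ sx] := H x x0; have [_ sq] := H _ (mulf_neq0 q0 x0).
have s1 := has_sum_reindex (addrK (1 : int)) (subrK (1 : int)) sx.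
have : has_sum (theta_term q (q%:C * x)) (- x^-1 * (L%:C * theta1 q x)).
  apply: eq_has_sum (has_sumZ (- x^-1) s1) => n /=; rewrite /theta_term.
  have -> : tri (n + 1) = tri n + n.
    by apply: (@mulIf _ 2) => //; rewrite mulrDl !triE; ring.
  rewrite exprzMl ?unitfE // !expfzDr ?oppr_eq0 ?oner_eq0 // !expr1z.
  move: ((-1) ^ n) (q%:C ^ tri n) (q%:C ^ n) (x ^ n) => e b c d.
  by move: x0; clear; move=> x0; field.
move=> s2; apply: (mulfI L0'); rewrite (has_sum_unique sq s2); ring.
Qed.

Lemma theta1_qpow z : theta1 q (qp z) = qp (z / 2) * S z.
Proof. by rewrite /sigma mulrA -qpowD subrr qpow0 mul1r. Qed.

Lemma sigma_shift z : S (z + 1) = - qp (- (z + 2^-1)) * S z.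
Proof.
rewrite {1}/sigma [qp (z + 1)]qpowD qpow1 // mulrC [qp z * _]mulrC.
rewrite theta1_shift ?qpow_neq0 // theta1_qpow mulrC -qpowN.
have -> : - (z + 2^-1) = - ((z + 1) / 2) + z / 2 - z by field.
by rewrite !qpowD; ring.
Qed.

Lemma qpowNhalf : qp (- half_period q) = -1.
Proof. by rewrite qpowN qpow_half_period // invrN1. Qed.

Lemma quotient_split (a b c d a' b' c' d' : C) :
  (a * a') * (b * b') / ((c * c') * (d * d')) = (a * b / (c * d)) * (a' * b' / (c' * d')).
Proof. by rewrite !invfM; ring. Qed.

Lemma A_BaE kappa z xi : A_Ba q kappa z xi = R_diag S (kappa + kappa) z xi.
Proof.
rewrite /A_Ba /theta !big_cons !big_nil !mulr1 !theta1_qpow /R_diag -sigma_odd //.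
rewrite [2 * kappa](mulrDl 1 1) mul1r quotient_split.
rewrite -!qpowD -qpowN -qpowD [X in qp X](_ : _ = 0); last by ring.
by rewrite qpow0 mul1r.
Qed.

Lemma B_BaE kappa z xi : B_Ba q kappa z xi = R_off S (kappa + kappa) z xi.
Proof.
rewrite /B_Ba /theta !big_cons !big_nil !mulr1 !theta1_qpow /R_off.
rewrite [2 * kappa](mulrDl 1 1) mul1r quotient_split.
rewrite -!qpowD -qpowN -qpowD [X in qp X](_ : _ = 0); last by ring.
rewrite qpow0 mul1r -[- z - xi]opprD !sigma_odd //.
by rewrite mulrN mulNr invrN mulrNN.
Qed.

Lemma R_BaE kappa z xi :
  R_Ba q kappa z xi = colmx (2 * 2) (six_cols (R_diag S (kappa + kappa)) (R_off S (kappa + kappa)) z xi).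
Proof.
apply/matrixP => i j; rewrite !mxE !A_BaE !B_BaE.
case: i j => [[|[|[|[|//]]]] ?] [[|[|[|[|//]]]] ?];
  rewrite /= ?big_cons ?big_nil ?(mulr0n, mulr1n) ?(addr0, add0r) //.
Qed.
End Baxter.

Section ReflectionParameters.
Context {R : realType} (q : R).
Hypothesis hq : 0 < q < 1.
Local Notation C := R[i].
Local Notation qp := (qpow q).
Local Notation S := (sigma q).
Local Notation om := (half_period q).

Lemma qpow_opp z : - qp z = qp (z + om).
Proof. by rewrite qpowD qpow_half_period // mulrN1. Qed.

Lemma qpow_opp' z : - qp z = qp (z - om).
Proof. by rewrite qpowD qpowNhalf // mulrN1. Qed.

Lemma quotient_split4 (a b c d e g a' b' c' d' e' g' m : C) :
  (a * a') * ((b * b') * ((c * c') * (d * d'))) / ((e * e') * (g * g')) * m =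
  (a * b * c * d / (e * g) * m) * (a' * b' * c' * d' / (e' * g')).
Proof. by rewrite !invfM; ring. Qed.

(** With the exponents of the parameters, d_par / a_tilde = q^s.  The same formula
    covers calCt, which is calC with zeta' and upsilon exchanged. *)
Lemma calC_sigma (ze ze' up up' z x : C) :
  let s := 2^-1 - ze - up' - om in
  calC q ze ze' up up' z x =
  qp ((ze - ze' + om + (2^-1 + up + up')) / 2 + x - (ze + up - z) * (ze + ze' - x)) *
  (S (ze + ze' + x) * S (ze - ze' + om + x) * S (2^-1 + up + up' + x) * S (s + x - z)
   / (S (x + x) * S (2^-1 + ze' - up' - om - z))).
Proof.
move=> s; rewrite /calC /theta !big_cons !big_nil !mulr1 /a_tilde /b_tilde /c_tilde /d_par.
rewrite qpow_opp qpow_opp' -qpowN -!qpowD !theta1_qpow quotient_split4.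
rewrite -!qpowD -qpowN -!qpowD [2 * x](mulrDl 1 1) mul1r.
have -> : 2^-1 + ze' - up' - om + (x - z) - (ze + ze') = s + x - z by rewrite /s; ring.
congr (qp _ * _).
by rewrite /s; field.
Qed.

Lemma sigma_reflect y : S (1 - y) = qp (y - 2^-1) * S y.
Proof. by rewrite addrC sigma_shift // sigma_odd // mulrNN; congr (qp _ * _); ring. Qed.

Lemma sigma_unshift y : S (- y - 1) = qp (- (y + 2^-1)) * S y.
Proof. by rewrite -opprD sigma_odd // sigma_shift // mulNr opprK. Qed.

Lemma scaled_difference (T e1 P X1 x2 V e2 Q X2 z2 W E A U m n : C) :
  W != 0 -> V != 0 -> T != 0 -> E != 0 ->
  (T * e1 * (P * X1 / (x2 * V)) - T * e2 * (Q * X2 / (z2 * W))) / (E * (A * U / (m * W))) * (n / T * E)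
  = n * (m / (A * V)) * ((e1 * (P * W) * X1 / x2 - e2 * (Q * V) * X2 / z2) / U).
Proof.
rewrite !invfM !invrK.
move: (x2^-1) (z2^-1) (U^-1) (A^-1) => xi zi Ui Ai nW nV nT nE.
by field; rewrite nW nV nT nE.
Qed.

Lemma cancel_common (P X x2 V A m W : C) : X != 0 ->
  (P * X / (x2 * V)) / (A * X / (m * W)) = m / (A * V) * (P * W / x2).
Proof.
rewrite !invfM !invrK; move: (x2^-1) (V^-1) (A^-1) => xi Vi Ai nX.
by field.
Qed.

Lemma regroup_norm (e1 e2 e3 e4 X X' y1 y2 y3 y4 z1 z2 z3 z4 : C) : e1 * e2 = e3 * e4 ->
  e1 * (y1 * y2 * y3 * y4 / X) * (e2 * (z1 * z2 * z3 * z4 / X'))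
  = e3 * (y1 * y2 * y3 * z4) * (e4 * (z1 * z2 * z3 * y4)) / (X * X').
Proof.
move=> e; rewrite invfM; transitivity (e1 * e2 * (y1 * y2 * y3 * y4 * z1 * z2 * z3 * z4 / X / X')).
  by ring.
by rewrite e; ring.
Qed.

Lemma regroup_scale (e1 e2 g1 g2 m m' x1 x2 x3 x4 y1 y2 y3 y4 : C) : e1 * e2 = (g1 * g2)^-1 ->
  e1 * (m / (x1 * x2 * x3 * x4)) * (e2 * (m' / (y1 * y2 * y3 * y4)))
  = m' * m / (g1 * (y1 * y2 * y3 * x4) * (g2 * (x1 * x2 * x3 * y4))).
Proof.
move=> e; rewrite !invfM in e *.
transitivity (e1 * e2 * (m * m' * x1^-1 * x2^-1 * x3^-1 * x4^-1 * y1^-1 * y2^-1 * y3^-1 * y4^-1)).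
  by ring.
by rewrite e; ring.
Qed.

Section Exponents.
Variables ze ze' up up' : C.
Let a : C := ze + up.
Let b : C := ze - up + om.
Let c : C := 2^-1 + ze' + up'.
Let d : C := 2^-1 + ze' - up' - om.
Let a' : C := ze + ze'.
Let b' : C := ze - ze' + om.
Let c' : C := 2^-1 + up + up'.
Let d' : C := 2^-1 + up - up' - om.
Let s : C := 2^-1 - ze - up' - om.
Local Notation f := (quartic S a b c s).
Local Notation dK := (diagK S a b c s).

(** Exchanging zeta' and upsilon exchanges the parameters with their tilde versions;
    up to a power of q, f(s - x) is the quartic of the tilde parameters at x. *)
Lemma quartic_dual x :
  f (s - x) = qp (b' + c' - a' + x - (1 + 2^-1)) * (S (a' + x) * S (b' + x) * S (c' + x) * S (d' - x)).
Proof.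
rewrite /quartic.
have -> : s - x + a = d' - x by rewrite /s /a /d'; ring.
have -> : s - x + b = 1 - (c' + x) by rewrite /s /b /c'; field.
have -> : s - x + c = 1 - (b' + x) by rewrite /s /b' /c; field.
have -> : s - x - (a + b + c + s + s) = - (a' + x) - 1 by rewrite /s /a /b /c /a'; field.
rewrite !sigma_reflect sigma_unshift.
have -> : b' + c' - a' + x - (1 + 2^-1) = (c' + x - 2^-1) + (b' + x - 2^-1) - (a' + x + 2^-1).
  by field.
by rewrite !qpowD; ring.
Qed.

Lemma quartic_shift z :
  f z = qp (z - d - 2^-1) * (S (a + z) * S (b + z) * S (c + z) * S (d - z)).
Proof.
rewrite /quartic.
have -> : z - (a + b + c + s + s) = - (d - z) - 1 by rewrite /s /a /b /c /d; field.
rewrite sigma_unshift [z + a]addrC [z + b]addrC [z + c]addrC.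
have -> : - (d - z + 2^-1) = z - d - 2^-1 by ring.
by ring.
Qed.

Definition K_scale z := qp (2^-1 + d + z + (z + z) * a') *
  (S (- z - z) / (S (a - z) * S (b - z) * S (c - z) * S (d - z))).

Definition K_off x := qp (up - ze' - 2^-1 - d + x + (x + x) * a) *
  (S (a' + x) * S (b' + x) * S (c' + x) * S (d' + x) / S (x + x)).

(** The difference C(z, xi) - Ct(xi, z) is a multiple of the numerator of diagK(z,
    xi), because both terms carry the same power of q once f is expressed by
    [quartic_dual] and [quartic_shift]. *)
Lemma alpha_BaE (z x : C) : S (d' - x) != 0 -> S (d - z) != 0 ->
  alpha_Ba q ze ze' up up' z x = K_scale z * dK z x.
Proof.
move=> nd' nd; rewrite /alpha_Ba.
rewrite -[calCt q ze ze' up up' x z]/(calC q ze up ze' up' x z).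
rewrite -[calCt q ze ze' up up' x (- z)]/(calC q ze up ze' up' x (- z)).
rewrite !calC_sigma -/a -/b -/c -/d -/a' -/b' -/c' -/d' -/s.
set E1 : C := (b' + c') / 2 + x - (a - z) * (a' - x).
set E2 : C := (b + c) / 2 + z - (a' - x) * (a - z).
set E3 : C := (b + c) / 2 + - z - (a' - x) * (a - - z).
(* The exponent common to the two terms of the numerator. *)
pose T : C := E2 - (z - d - 2^-1).
have e1 : E1 = T + (b' + c' - a' + x - (1 + 2^-1)).
  by rewrite /T /E1 /E2 /a /b /c /d /a' /b' /c'; field.
have e2 : E2 = T + (z - d - 2^-1) by rewrite /T; ring.
have e3 : 2 * z * x = 2^-1 + d + z + (z + z) * a' - T + E3.
  by rewrite /T /E2 /E3; field.
rewrite e1 e2 e3 /diagK quartic_dual quartic_shift /K_scale.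
rewrite [qp (_ + E3)]qpowD [qp (_ - T)]qpowD qpowN ![qp (T + _)]qpowD.
exact: (scaled_difference _ _ _ _ _ _ _ _ _ _ _ _ nd' nd (qpow_neq0 q T) (qpow_neq0 q E3)).
Qed.

Lemma beta_BaE (z x : C) : S (s + x - z) != 0 ->
  beta_Ba q ze ze' up up' z x = K_scale z * K_off x.
Proof.
move=> ns; rewrite /beta_Ba.
rewrite -[calCt q ze ze' up up' (- x) (- z)]/(calC q ze up ze' up' (- x) (- z)).
rewrite !calC_sigma -/a -/b -/c -/d -/a' -/b' -/c' -/d' -/s.
rewrite /K_scale /K_off !opprK.
have -> : s - z + x = s + x - z by ring.
rewrite [(qp _ * _)^-1]invfM mulrACA -qpowN -qpowD [RHS]mulrACA -qpowD.
congr (qp _ * _); first by rewrite /a /b /c /d /a' /b' /c'; field.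
exact: cancel_common.
Qed.

(** The first term on the right of [diagK_norm]; this coincidence is what unitarity
    and the quadratic relation rest on. *)
Lemma K_off_norm (x : C) :
  K_off x * K_off (- x) = f (s - x) * f (s + x) / (S (x + x) * S (- x - x)).
Proof.
have -> : s + x = s - - x by rewrite opprK.
rewrite !quartic_dual /K_off opprK; apply: regroup_norm.
by rewrite -!qpowD; congr qp; rewrite /a /b' /c' /d /a'; field.
Qed.

(** The inverse of the second term on the right of [diagK_norm]. *)
Lemma K_scale_norm (z : C) :
  K_scale z * K_scale (- z) = S (z + z) * S (- z - z) / (f z * f (- z)).
Proof.
rewrite !quartic_shift /K_scale !opprK; apply: regroup_scale.
rewrite -!qpowD -qpowN; congr qp; ring.
Qed.

Lemma K_BaE (z x : C) : S (d - z) != 0 -> S (d' - x) != 0 -> S (d' + x) != 0 ->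
    S (s + x - z) != 0 -> S (s - x - z) != 0 ->
  K_Ba q ze ze' up up' z x =
  colmx 2 (two_cols (fun t => K_scale z * dK z t) (fun t => K_scale z * K_off t) x).
Proof.
move=> nd n1 n2 n3 n4.
apply/matrixP => i j; rewrite !mxE !alpha_BaE ?beta_BaE ?opprK //.
case: i j => [[|[|//]] ?] [[|[|//]] ?];
  by rewrite /= !big_cons !big_nil ?(mulr0n, mulr1n) ?(addr0, add0r).
Qed.
End Exponents.
End ReflectionParameters.

(** * The equations at generic points *)

Lemma unitary_two {R : realType} (al be al' be' : R[i] -> R[i]) x :
  al x * al' x + be x * be' (- x) = 1 -> al (- x) * al' (- x) + be (- x) * be' x = 1 ->
  al x * be' x + be x * al' (- x) = 0 -> al (- x) * be' (- x) + be (- x) * al' x = 0 ->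
  colmx 2 (two_cols al be x) *m colmx 2 (two_cols al' be' x) = 1%:M.
Proof.
move=> d1 d2 o1 o2; rewrite colmx_mul; last exact: two_cols_below.
apply/matrixP => i j; rewrite !mxE.
case: i j => [[|[|//]] ?] [[|[|//]] ?]; cbv [colmul two_cols map flatten foldr cat nth fst snd nat_of_ord];
rewrite !big_cons !big_nil ?(mulr0n, mulr1n) /= ?(addr0, add0r).
- by rewrite -[RHS]d1; ring.
- by rewrite -[RHS]o1; ring.
- by rewrite -[RHS]o2; ring.
- by rewrite -[RHS]d2; ring.
Qed.

Lemma divide_linear (F : fieldType) (ue ud v be y w y' : F) : v != 0 ->
  (ue * v) * y = (ud * v) * w + be * (ue * v) * y' -> ue * y = ud * w + be * ue * y'.
Proof. by move=> v0 L; apply: (mulIf v0); apply: (lincomb_eq (c := 1) L); ring. Qed.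

Lemma divide_quadratic (F : fieldType) (ue ud v b1 b2 b3 b4 y1 y2 y3 y4 h h' : F) : v != 0 ->
  b1 * (ud * v) * y1 + (ue * v) * b2 * y2 + (ud * v) * h
    = b3 * (ud * v) * y3 + (ue * v) * b4 * y4 + (ud * v) * h' ->
  b1 * ud * y1 + ue * b2 * y2 + ud * h = b3 * ud * y3 + ue * b4 * y4 + ud * h'.
Proof. by move=> v0 L; apply: (mulIf v0); apply: (lincomb_eq (c := 1) L); ring. Qed.

Lemma all_nz_cat (F : fieldType) (S : F -> F) (l l' : seq F) :
  all_nz S (l ++ l') = all_nz S l && all_nz S l'.
Proof. exact: all_cat. Qed.

Section Pointwise.
Context {R : realType} (q : R).
Hypothesis hq : 0 < q < 1.
Local Notation C := R[i].
Local Notation S := (sigma q).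
Local Notation all_nz := (all_nz S).
Let S_odd := sigma_odd hq.
Let S_three := sigma_three hq.
Variable kappa : C.
Local Notation p := (kappa + kappa).

Definition ybe_forms (a b x : C) : seq C :=
  [:: p - a; p - b; p - (a + b); x; p - x; a; p + p - x].

Lemma ybe_entries_Ba a b x : all_nz (ybe_forms a b x) ->
  ybe_entries (R_diag S p) (R_off S p) p a b x.
Proof.
do 7?[case/andP=> ?]; move=> _; rewrite /ybe_entries opprB; split; split.
- by apply: (ybe32 S_odd S_three).
- by apply: (ybe13 S_odd S_three).
- by apply: (ybe23 S_odd S_three).
- by apply: (ybe22 S_odd S_three).
- by apply: (ybe31 S_odd S_three).
- by apply: (ybe21 S_odd S_three).
- by apply: (ybe12 S_odd S_three).
Qed.

Lemma dynamical_YBE_Ba a b x : all_nz (ybe_forms a b x) -> all_nz (ybe_forms a b (- x)) ->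
  dyn_shift (fun x => leg12_3 (R_Ba q kappa a x)) x (- p) h3_3
       *m leg13_3 (R_Ba q kappa (a + b) x)
       *m dyn_shift (fun x => leg23_3 (R_Ba q kappa b x)) x (- p) h1_3
  = leg23_3 (R_Ba q kappa b x)
       *m dyn_shift (fun x => leg13_3 (R_Ba q kappa (a + b) x)) x (- p) h2_3
       *m leg12_3 (R_Ba q kappa a x).
Proof.
move=> n1 n2; apply: (dynamical_YBE_six (R_BaE hq kappa)).
- by move=> *; exact: R_diag_cross.
- exact: ybe_entries_Ba.
- exact: ybe_entries_Ba.
Qed.

Lemma unitary_R_Ba z x : all_nz [:: p - z; p + z; x] ->
  leg21 (R_Ba q kappa z x) *m R_Ba q kappa (- z) x = 1%:M.
Proof.
do 3?[case/andP=> ?]; move=> _.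
have nx : S (- x) != 0 by rewrite sigma_odd // oppr_eq0.
apply: (unitary_R_six (R_BaE hq kappa)).
- by apply: (R_unit_diag S_odd S_three).
- by have := R_unit_diag S_odd S_three (p := p) (a := z) (xi := - x); rewrite opprK; apply.
- by apply: (R_unit_off S_odd).
- by have := R_unit_off S_odd p z (- x); rewrite opprK.
Qed.

Variables ze ze' up up' : C.
Local Notation om := (half_period q).
Let a : C := ze + up.
Let b : C := ze - up + om.
Let c : C := 2^-1 + ze' + up'.
Let d : C := 2^-1 + ze' - up' - om.
Let d' : C := 2^-1 + up - up' - om.
Let s : C := 2^-1 - ze - up' - om.
Local Notation D := (diagK S a b c s).
Local Notation f := (quartic S a b c s).
Local Notation N := (K_scale q ze ze' up up').
Local Notation g := (K_off q ze ze' up up').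

(** The arguments of the sigmas that have to be cancelled to pass from alpha and
    beta to their factored forms. *)
Definition K_forms (z x : C) : seq C := [:: d - z; d' - x; d' + x; s + x - z; s - x - z].

Lemma K_Ba_colmx z x : all_nz (K_forms z x) ->
  K_Ba q ze ze' up up' z x = colmx 2 (two_cols (fun t => N z * D z t) (fun t => N z * g t) x).
Proof. by do 5?[case/andP=> ?]; move=> _; apply: K_BaE. Qed.

Definition quartic_forms (z : C) : seq C := [:: z + a; z + b; z + c; z - (a + b + c + s + s)].

Definition unitary_K_forms (z x : C) : seq C :=
  K_forms z x ++ K_forms (- z) x ++ norm_forms a b s z x ++ norm_forms a b s z (- x)
    ++ quartic_forms z ++ quartic_forms (- z).

Lemma quartic_neq0 z : all_nz (quartic_forms z) -> f z != 0.
Proof. by case/and5P=> n1 n2 n3 n4 _; exact: (mulf_neq0 (mulf_neq0 (mulf_neq0 n1 n2) n3) n4). Qed.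

Lemma diagK_Ba_opp z x : all_nz (norm_forms a b s z x) -> D (- z) (- x) = - D z x.
Proof. by do 7?[case/andP=> ?]; move=> _; apply: (diagK_opp S_odd S_three). Qed.

Lemma diagK_Ba_norm z x : all_nz (norm_forms a b s z x) ->
  g x * g (- x) - D z x * D z (- x) = f z * f (- z) / (S (z + z) * S (- z - z)).
Proof.
do 7?[case/andP=> ?]; move=> _; rewrite (diagK_norm S_odd S_three) // (K_off_norm hq).
by rewrite subKr.
Qed.

Lemma unitary_K_Ba z x : all_nz (unitary_K_forms z x) ->
  K_Ba q ze ze' up up' z x *m K_Ba q ze ze' up up' (- z) x = 1%:M.
Proof.
rewrite !all_nz_cat => /andP[k1 /andP[k2 /andP[n1 /andP[n2 /andP[q1 q2]]]]].
rewrite !K_Ba_colmx //.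
have scale : N z * N (- z) * (f z * f (- z) / (S (z + z) * S (- z - z))) = 1.
  have nz : S (z + z) != 0 by case/and3P: n1.
  have nz' : S (- z - z) != 0 by rewrite -opprD sigma_odd // oppr_eq0.
  have f1 := quartic_neq0 q1; have f2 := quartic_neq0 q2.
  by rewrite (K_scale_norm hq) [LHS]mulrC mulf_div [X in X / _]mulrC divff // (mulf_neq0 (mulf_neq0 nz nz') (mulf_neq0 f1 f2)).
have o1 := diagK_Ba_opp n1; have o2 := diagK_Ba_opp n2; rewrite opprK in o2.
have norm1 := diagK_Ba_norm n1; have norm2 := diagK_Ba_norm n2; rewrite opprK in norm2.
apply: unitary_two; rewrite ?opprK ?o1 ?o2.
- by rewrite -scale -norm1; ring.
- by rewrite -scale -norm2; ring.
- by ring.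
- by ring.
Qed.

Local Notation linear_forms := (linear_forms a b s).
Local Notation norm_forms := (norm_forms a b s).

Definition re_entry_forms (z1 z2 x : C) : seq C :=
  linear_forms z1 z2 x kappa ++ linear_forms z2 z1 x kappa ++ linear_forms z1 z2 (- x) kappa
    ++ norm_forms z2 (x + kappa) ++ norm_forms z2 (x - kappa)
    ++ [:: p + (z1 - z2); p - (x + x); x + x].

Definition R_spectral z : C := - S z / S (p - z).
Definition R_dynamical x : C := S (p + x) / S x.

Lemma R_diag_factor z x : R_diag S p z x = R_spectral z * R_dynamical x.
Proof. by rewrite /R_diag invfM /R_spectral /R_dynamical; ring. Qed.

Lemma re_entries_Ba z1 z2 x : all_nz (re_entry_forms z1 z2 x) ->
  re_entries (R_diag S p) (R_off S p) R_spectral kappa x (z1 + z2) (z1 - z2) (D z1) (D z2) g.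
Proof.
rewrite !all_nz_cat => /andP[l1 /andP[l2 /andP[l3 /andP[n1 /andP[n2 /and4P[m1 m2 m3 _]]]]]].
have v0 : R_dynamical (- (x + x)) != 0.
  apply: mulf_neq0 m2 _; rewrite invr_eq0.
  by rewrite sigma_odd // oppr_eq0.
split.
- exact: (reflection_linear_dual S_odd S_three c l1 l2 m1 m2).
- have := reflection_linear_nz S_odd S_three c l1; rewrite !R_diag_factor.
  exact: divide_linear.
have h t : all_nz (norm_forms z2 t) ->
    g t * g (- t) = f (s - t) * f (s + t) / (S (t + t) * S (- t - t)).
  by move=> _; exact: K_off_norm.
have := reflection_quadratic S_odd S_three h l1 l3 n1 n2; rewrite !R_diag_factor.
exact: divide_quadratic.
Qed.

(** The factored form of K is valid at generic points only, but in the shifted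
    matrices K is evaluated only at xi + kappa and xi - kappa. *)
Lemma dyn_shift_congr n (T T' : C -> 'M[C]_n) x al (h : 'M[C]_n) (e : 'I_n -> C) :
  (forall j, h j j = e j) -> (forall j, T (x + al * e j) = T' (x + al * e j)) ->
  dyn_shift T x al h = dyn_shift T' x al h.
Proof. by move=> hE TE; apply/matrixP=> i j; rewrite !mxE hE TE. Qed.

Definition re_forms (z1 z2 x : C) : seq C :=
  re_entry_forms z1 z2 x ++ re_entry_forms z1 z2 (- x)
    ++ K_forms z1 (x + kappa) ++ K_forms z1 (x - kappa)
    ++ K_forms z2 (x + kappa) ++ K_forms z2 (x - kappa).

Lemma reflection_Ba z1 z2 x : all_nz (re_forms z1 z2 x) ->
  leg21 (R_Ba q kappa (z1 - z2) (x + x))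
    *m dyn_shift (fun x => leg1 (K_Ba q ze ze' up up' z1 x)) x (- kappa) (leg2 h_op)
    *m R_Ba q kappa (z1 + z2) (x + x)
    *m dyn_shift (fun x => leg2 (K_Ba q ze ze' up up' z2 x)) x (- kappa) (leg1 h_op)
  = dyn_shift (fun x => leg2 (K_Ba q ze ze' up up' z2 x)) x (- kappa) (leg1 h_op)
    *m leg21 (R_Ba q kappa (z1 + z2) (x + x))
    *m dyn_shift (fun x => leg1 (K_Ba q ze ze' up up' z1 x)) x (- kappa) (leg2 h_op)
    *m R_Ba q kappa (z1 - z2) (x + x).
Proof.
rewrite all_nz_cat => /andP[e1]; rewrite all_nz_cat => /andP[e2].
rewrite all_nz_cat => /andP[k1]; rewrite all_nz_cat => /andP[k2].
rewrite all_nz_cat => /andP[k3 k4].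
pose K' z x := colmx 2 (two_cols (fun t => N z * D z t) (fun t => N z * g t) x).
have shifted z : all_nz (K_forms z (x + kappa)) -> all_nz (K_forms z (x - kappa)) ->
    forall n, K_Ba q ze ze' up up' z (x + - kappa * sgn n) = K' z (x + - kappa * sgn n).
  by move=> kp km n; rewrite /sgn; case: ifP => _;
    rewrite ?mulr1 ?mulrN1 ?opprK K_Ba_colmx.
have s1 : dyn_shift (fun x => leg1 (K_Ba q ze ze' up up' z1 x)) x (- kappa) (leg2 h_op)
    = dyn_shift (fun x => leg1 (K' z1 x)) x (- kappa) (leg2 h_op).
  by apply: (dyn_shift_congr (e := fun j => sgn j)) => j; rewrite ?leg2_hE // shifted.
have s2 : dyn_shift (fun x => leg2 (K_Ba q ze ze' up up' z2 x)) x (- kappa) (leg1 h_op)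
    = dyn_shift (fun x => leg2 (K' z2 x)) x (- kappa) (leg1 h_op).
  by apply: (dyn_shift_congr (e := fun j => sgn j./2)) => j; rewrite ?leg1_hE // shifted.
rewrite s1 s2.
have E1 := @re_entries_Ba z1 z2 x e1.
have E2 := @re_entries_Ba z1 z2 (- x) e2.
have KE z y : K' z y = colmx 2 (two_cols (fun t => N z * D z t) (fun t => N z * g t) y) by [].
clearbody K'.
have T := reflection_six R_diag_factor (R_BaE hq kappa) (KE z1) (KE z2).
have T1 := T kappa x (z1 + z2) (z1 - z2) E1.
have T2 := T1 E2.
exact: T2.
Qed.
End Pointwise.

Section GenericLists.
Context {R : realType} (q : R).
Hypothesis hq : 0 < q < 1.
Local Notation C := R[i].
Local Notation all_nz := (all_nz (sigma q)).
Context {V : normedModType C}.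

Lemma generic_nil : generic (fun p : V => all_nz [::]).
Proof. exact: generic_always. Qed.

Lemma generic_cons (l : V -> C) (ls : V -> seq C) :
  unit_slope l -> generic (fun p => all_nz (ls p)) -> generic (fun p => all_nz (l p :: ls p)).
Proof.
move=> fl gls; apply: generic_imply (generic_and (generic_sigma hq fl) gls) => p [n ns].
exact/andP.
Qed.

Lemma generic_cat (ls ls' : V -> seq C) :
  generic (fun p => all_nz (ls p)) -> generic (fun p => all_nz (ls' p)) ->
  generic (fun p => all_nz (ls p ++ ls' p)).
Proof.
by move=> g g'; apply: generic_imply (generic_and g g') => p /andP; rewrite all_nz_cat.
Qed.
End GenericLists.

Ltac generic_forms hq :=
  repeat match goal with
  | |- generic (fun p => is_true (all_nz _ (cons _ _))) =>
      apply: (generic_cons hq); [affine_form |]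
  | |- generic (fun p => is_true (all_nz _ (cat _ _))) => apply: generic_cat
  end;
  exact: generic_nil.

Section GenericIdentities.
Context {R : realType} (q : R).
Hypothesis hq : 0 < q < 1.
Local Notation C := R[i].
Variables kappa ze ze' up up' : C.

Lemma generic_ybe_forms : generic (V := (C * C * C * C)%type) (fun p =>
  all_nz (sigma q) (ybe_forms kappa (p.1.1.1 - p.1.1.2) (p.1.1.2 - p.1.2) p.2
     ++ ybe_forms kappa (p.1.1.1 - p.1.1.2) (p.1.1.2 - p.1.2) (- p.2))).
Proof. by rewrite /ybe_forms; generic_forms hq. Qed.

Lemma generic_unitary_K_forms : generic (V := (C * C)%type) (fun p =>
  all_nz (sigma q) (unitary_K_forms q ze ze' up up' p.1 p.2)).
Proof.
rewrite /unitary_K_forms /K_forms /norm_forms /quartic_forms; move: (half_period q) => om.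
generic_forms hq.
Qed.

Lemma generic_re_forms : generic (V := (C * C * C)%type) (fun p =>
  all_nz (sigma q) (re_forms q kappa ze ze' up up' p.1.1 p.1.2 p.2)).
Proof.
rewrite /re_forms /re_entry_forms /K_forms /norm_forms /linear_forms.
move: (half_period q) => om; generic_forms hq.
Qed.

Lemma dynamical_YBE_R_Ba : dynamical_YBE kappa (R_Ba q kappa).
Proof.
apply: generic_imply generic_ybe_forms => -[[[z1 z2] z3] xi].
rewrite all_nz_cat => /andP[n1 n2].
have -> : z1 - z3 = (z1 - z2) + (z2 - z3) by rewrite subrKA.
rewrite [2 * kappa](mulrDl 1 1) mul1r; exact: dynamical_YBE_Ba.
Qed.

Lemma unitary_R_R_Ba : unitary_R (R_Ba q kappa).
Proof.
have gen : generic (V := (C * C)%type) (fun p => all_nz (sigma q)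
    [:: kappa + kappa - p.1; kappa + kappa + p.1; p.2]) by generic_forms hq.
by apply: generic_imply gen => -[z xi]; exact: unitary_R_Ba.
Qed.

Lemma unitary_K_K_Ba : unitary_K (K_Ba q ze ze' up up').
Proof. by apply: generic_imply generic_unitary_K_forms => -[z xi]; exact: unitary_K_Ba. Qed.

Lemma right_dynamical_RE_K_Ba : right_dynamical_RE kappa (R_Ba q kappa) (K_Ba q ze ze' up up').
Proof.
apply: generic_imply generic_re_forms => -[[z1 z2] xi] n.
by rewrite [2 * xi](mulrDl 1 1) mul1r; exact: reflection_Ba.
Qed.
End GenericIdentities.

(** * Meromorphy *)

Section Quotients.
Context {R : realType} {V : normedModType R[i]}.
Local Notation C := R[i].
Implicit Types f g h : V -> C.

(** Global quotients of entire functions: a class closed under products, differences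
    and, given generic nonvanishing, inverses. *)
Definition quotient f := exists g h, [/\ forall p, differentiable g p,
  forall p, differentiable h p, generic (fun p => h p != 0) &
  forall p, h p != 0 -> f p = g p / h p].

Lemma quotient_meromorphic f : quotient f -> meromorphic f.
Proof.
move=> [g [h [dg dh hn fE]]] p; exists setT, g, h; split=> //.
- by split=> //; exact: openT.
- by rewrite (generic_closure hn).
- by move=> x _; exact: fE.
Qed.

Lemma quotient_entire f : (forall p, differentiable f p) -> quotient f.
Proof.
move=> df; exists f, (fun=> 1); split.
- exact: df.
- by move=> p; exact: differentiable_const.
- exact: (generic_always (fun _ => oner_neq0 C)).
- by move=> p _; rewrite divr1.
Qed.

Lemma quotient_mul f f' : quotient f -> quotient f' -> quotient (fun p => f p * f' p).
Proof.
move=> [g [h [dg dh hn fE]]] [g' [h' [dg' dh' hn' fE']]].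
exists (fun p => g p * g' p), (fun p => h p * h' p); split.
- by move=> p; exact: differentiable_mul.
- by move=> p; exact: differentiable_mul.
- by apply: generic_imply (generic_and hn hn') => p [n n']; rewrite mulf_neq0.
- move=> p; rewrite mulf_eq0 negb_or => /andP[n n']; by rewrite fE // fE' // mulf_div.
Qed.

Lemma quotient_sub f f' : quotient f -> quotient f' -> quotient (fun p => f p - f' p).
Proof.
move=> [g [h [dg dh hn fE]]] [g' [h' [dg' dh' hn' fE']]].
exists (fun p => g p * h' p + - (g' p * h p)), (fun p => h p * h' p); split.
- move=> p; apply: differentiable_add (differentiable_mul (dg p) (dh' p)) _.
  exact: differentiable_opp (differentiable_mul (dg' p) (dh p)).
- by move=> p; exact: differentiable_mul.
- by apply: generic_imply (generic_and hn hn') => p [n n']; rewrite mulf_neq0.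
- move=> p; rewrite mulf_eq0 negb_or => /andP[n n']; rewrite fE // fE' //.
  by rewrite -mulNr addf_div // mulNr.
Qed.

(** The denominator g h, rather than g, records that f p is only known where h does
    not vanish. *)
Lemma quotient_inv f : quotient f -> generic (fun p => f p != 0) -> quotient (fun p => (f p)^-1).
Proof.
move=> [g [h [dg dh hn fE]]] fn.
exists (fun p => h p * h p), (fun p => g p * h p); split.
- by move=> p; exact: differentiable_mul.
- by move=> p; exact: differentiable_mul.
- apply: generic_imply (generic_and hn fn) => p [n fn'].
  by rewrite mulf_neq0 //; apply: contraNneq fn' => g0; rewrite fE // g0 mul0r.
- move=> p; rewrite mulf_eq0 negb_or => /andP[n n']; rewrite fE // invf_div.
  by rewrite -mulf_div divff // mulr1.
Qed.
End Quotients.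

Section MeromorphicEntries.
Context {R : realType} (q : R).
Hypothesis hq : 0 < q < 1.
Local Notation C := R[i].
Local Notation qp := (qpow q).
Local Notation S := (sigma q).
Context {V : normedModType C}.
Implicit Types (l w y : V -> C).

Lemma quotient_sigma l : unit_slope l -> quotient (fun p => S (l p)).
Proof.
case=> dl _; apply: quotient_entire => p.
exact: differentiable_subst (dl p) (sigma_differentiable hq _).
Qed.

Lemma quotient_sigma_inv l : unit_slope l -> quotient (fun p => (S (l p))^-1).
Proof. by move=> fl; apply: quotient_inv (quotient_sigma fl) (generic_sigma hq fl). Qed.

Lemma quotient_qpow w : (forall p, differentiable w p) -> quotient (fun p => qp (w p)).
Proof.
move=> dw; apply: quotient_entire => p.
exact: differentiable_subst (dw p) (qpow_differentiable _ _).
Qed.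

Lemma quotient_calC (ze ze' up up' : C) w y :
  let om := half_period q in
  (forall p, differentiable w p) -> (forall p, differentiable y p) ->
  unit_slope (fun p => ze + ze' + y p) -> unit_slope (fun p => ze - ze' + om + y p) ->
  unit_slope (fun p => 2^-1 + up + up' + y p) -> unit_slope (fun p => 2^-1 - ze - up' - om + y p - w p) ->
  unit_slope (fun p => y p + y p) -> unit_slope (fun p => 2^-1 + ze' - up' - om - w p) ->
  quotient (fun p => calC q ze ze' up up' (w p) (y p)) /\
  generic (fun p => calC q ze ze' up up' (w p) (y p) != 0).
Proof.
move=> om dw dy f1 f2 f3 f4 f5 f6; split.
  have -> : (fun p => calC q ze ze' up up' (w p) (y p)) = (fun p =>
     qp ((ze - ze' + om + (2^-1 + up + up')) / 2 + y p - (ze + up - w p) * (ze + ze' - y p)) *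
     (S (ze + ze' + y p) * S (ze - ze' + om + y p) * S (2^-1 + up + up' + y p) *
      S (2^-1 - ze - up' - om + y p - w p)
     * ((S (y p + y p))^-1 * (S (2^-1 + ze' - up' - om - w p))^-1))).
    by apply/funext => p; rewrite calC_sigma // -invfM.
  apply: quotient_mul; last exact: (quotient_mul
    (quotient_mul (quotient_mul (quotient_mul (quotient_sigma f1) (quotient_sigma f2))
      (quotient_sigma f3)) (quotient_sigma f4))
    (quotient_mul (quotient_sigma_inv f5) (quotient_sigma_inv f6))).
  apply: quotient_qpow => p.
  have dc c : differentiable (fun _ : V => c : C) p by exact: differentiable_const.
  apply: differentiable_add; first exact: differentiable_add.
  apply: differentiable_opp; apply: differentiable_mul.
    exact: differentiable_add (dc _) (differentiable_opp _).
  exact: differentiable_add (dc _) (differentiable_opp _).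
have g := generic_and (generic_sigma hq f1) (generic_and (generic_sigma hq f2)
  (generic_and (generic_sigma hq f3) (generic_and (generic_sigma hq f4)
  (generic_and (generic_sigma hq f5) (generic_sigma hq f6))))).
apply: generic_imply g => p [n1 [n2 [n3 [n4 [n5 n6]]]]].
rewrite calC_sigma //; apply: mulf_neq0; first exact: qpow_neq0.
apply: mulf_neq0; last by rewrite invr_eq0; exact: mulf_neq0.
exact: (mulf_neq0 (mulf_neq0 (mulf_neq0 n1 n2) n3) n4).
Qed.
End MeromorphicEntries.

Section MeromorphicFamilies.
Context {R : realType} (q : R).
Hypothesis hq : 0 < q < 1.
Local Notation C := R[i].
Local Notation S := (sigma q).
Variables kappa ze ze' up up' : C.
Let V : normedModType C := (C * C)%type.

Lemma quotient_const (c : C) : quotient (fun _ : V => c).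
Proof. by apply: quotient_entire => p; exact: differentiable_const. Qed.

Lemma quotient_R_diag (y : V -> C) : unit_slope (fun p => kappa + kappa + y p) -> unit_slope y ->
  quotient (fun p => R_diag S (kappa + kappa) p.1 (y p)).
Proof.
move=> f1 f2.
have f3 : unit_slope (fun p : V => - p.1) by affine_form.
have f4 : unit_slope (fun p : V => kappa + kappa - p.1) by affine_form.
have -> : (fun p => R_diag S (kappa + kappa) p.1 (y p)) = (fun p =>
    S (- p.1) * S (kappa + kappa + y p) * ((S (kappa + kappa - p.1))^-1 * (S (y p))^-1)).
  by apply/funext => p; rewrite /R_diag invfM sigma_odd.
exact: (quotient_mul (quotient_mul (quotient_sigma hq f3) (quotient_sigma hq f1))
  (quotient_mul (quotient_sigma_inv hq f4) (quotient_sigma_inv hq f2))).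
Qed.

Lemma quotient_R_off (y : V -> C) : unit_slope (fun p => p.1 + y p) -> unit_slope y ->
  quotient (fun p => R_off S (kappa + kappa) p.1 (y p)).
Proof.
move=> f1 f2.
have f4 : unit_slope (fun p : V => kappa + kappa - p.1) by affine_form.
have -> : (fun p => R_off S (kappa + kappa) p.1 (y p)) = (fun p =>
    S (p.1 + y p) * S (kappa + kappa) * ((S (kappa + kappa - p.1))^-1 * (S (y p))^-1)).
  by apply/funext => p; rewrite /R_off invfM.
exact: (quotient_mul (quotient_mul (quotient_sigma hq f1) (quotient_const _))
  (quotient_mul (quotient_sigma_inv hq f4) (quotient_sigma_inv hq f2))).
Qed.

Lemma meromorphic_R_Ba : meromorphic_family (R_Ba q kappa).
Proof.
have a1 : quotient (fun p : V => R_diag S (kappa + kappa) p.1 p.2) by apply: quotient_R_diag; affine_form.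
have a2 : quotient (fun p : V => R_diag S (kappa + kappa) p.1 (- p.2)) by apply: quotient_R_diag; affine_form.
have b1 : quotient (fun p : V => R_off S (kappa + kappa) p.1 p.2) by apply: quotient_R_off; affine_form.
have b2 : quotient (fun p : V => R_off S (kappa + kappa) p.1 (- p.2)) by apply: quotient_R_off; affine_form.
move=> i j; apply: (@quotient_meromorphic _ V).
have -> : (fun p : V => R_Ba q kappa p.1 p.2 i j) = (fun p => nth 0 (nth [::]
    [:: [:: 1; 0; 0; 0];
        [:: 0; R_diag S (kappa + kappa) p.1 p.2; R_off S (kappa + kappa) p.1 p.2; 0];
        [:: 0; R_off S (kappa + kappa) p.1 (- p.2); R_diag S (kappa + kappa) p.1 (- p.2); 0];
        [:: 0; 0; 0; 1]] i) j).
  by apply/funext => p; rewrite mxE !A_BaE // !B_BaE.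
by case: i j => [[|[|[|[|//]]]] ?] [[|[|[|[|//]]]] ?] //; exact: quotient_const.
Qed.

Lemma quotient_alpha_beta (y : V -> C) : y = (fun p => p.2) \/ y = (fun p => - p.2) ->
  quotient (fun p => alpha_Ba q ze ze' up up' p.1 (y p)) /\
  quotient (fun p => beta_Ba q ze ze' up up' p.1 (y p)).
Proof.
move=> yE.
have d1 (p : V) : differentiable (fun p : V => p.1) p by exact: differentiable_fst.
have d2 (p : V) : differentiable y p.
  by case: yE => ->; [exact: differentiable_snd | exact: differentiable_opp (differentiable_snd _)].
have dN1 (p : V) : differentiable (fun p : V => - p.1) p by exact: differentiable_opp.
have dN2 (p : V) : differentiable (fun p : V => - y p) p by exact: differentiable_opp.
have [c1 _] : quotient (fun p => calC q ze ze' up up' p.1 (y p)) /\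
    generic (fun p => calC q ze ze' up up' p.1 (y p) != 0).
  by apply: (@quotient_calC _ _ hq V ze ze' up up' (fun p => p.1) y d1 d2); case: yE => yE; rewrite ?yE; move: (half_period q) => om; affine_form.
have [c2 _] : quotient (fun p => calC q ze up ze' up' (y p) p.1) /\
    generic (fun p => calC q ze up ze' up' (y p) p.1 != 0).
  by apply: (@quotient_calC _ _ hq V ze up ze' up' y (fun p => p.1) d2 d1); case: yE => yE; rewrite ?yE; move: (half_period q) => om; affine_form.
have [c3 n3] : quotient (fun p => calC q ze up ze' up' (y p) (- p.1)) /\
    generic (fun p => calC q ze up ze' up' (y p) (- p.1) != 0).
  by apply: (@quotient_calC _ _ hq V ze up ze' up' y (fun p => - p.1) d2 dN1); case: yE => yE; rewrite ?yE; move: (half_period q) => om; affine_form.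
have [c4 n4] : quotient (fun p => calC q ze up ze' up' (- y p) (- p.1)) /\
    generic (fun p => calC q ze up ze' up' (- y p) (- p.1) != 0).
  by apply: (@quotient_calC _ _ hq V ze up ze' up' (fun p => - y p) (fun p => - p.1) dN2 dN1); case: yE => yE; rewrite ?yE; move: (half_period q) => om; affine_form.
have e : quotient (fun p : V => qpow q (2 * p.1 * y p)).
  apply: quotient_qpow => p.
  exact: differentiable_mul (differentiable_mul (differentiable_const _ _) (d1 p)) (d2 p).
split; last exact: (quotient_mul c1 (quotient_inv c4 n4)).
exact: (quotient_mul (quotient_mul (quotient_sub c1 c2) (quotient_inv c3 n3)) e).
Qed.

Lemma meromorphic_K_Ba : meromorphic_family (K_Ba q ze ze' up up').
Proof.
have [a1 b1] := quotient_alpha_beta (or_introl erefl).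
have [a2 b2] := quotient_alpha_beta (or_intror erefl).
move=> i j; apply: (@quotient_meromorphic _ V).
have -> : (fun p : V => K_Ba q ze ze' up up' p.1 p.2 i j) = (fun p => nth 0 (nth [::]
    [:: [:: alpha_Ba q ze ze' up up' p.1 p.2; beta_Ba q ze ze' up up' p.1 p.2];
        [:: beta_Ba q ze ze' up up' p.1 (- p.2); alpha_Ba q ze ze' up up' p.1 (- p.2)]] i) j).
  by apply/funext => p; rewrite mxE.
by case: i j => [[|[|//]] ?] [[|[|//]] ?].
Qed.
End MeromorphicFamilies.

Theorem corollary2p18 (R : realType) (q : R)
    (kappa zeta zeta' upsilon upsilon' : R[i]) (hq : 0 < q < 1) :
  (dynamical_R_matrix kappa (R_Ba q kappa) /\ unitary_R (R_Ba q kappa)) /\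
  (right_dynamical_K_matrix kappa (R_Ba q kappa)
     (K_Ba q zeta zeta' upsilon upsilon') /\
   unitary_K (K_Ba q zeta zeta' upsilon upsilon')).
Proof.
split; split.
- by split; [exact: meromorphic_R_Ba | exact: dynamical_YBE_R_Ba].
- exact: unitary_R_R_Ba.
- by split; [exact: meromorphic_K_Ba | exact: right_dynamical_RE_K_Ba].
- exact: unitary_K_K_Ba.
Qed.
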